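(* Let $\{P_\theta\}_{\theta\in\Theta}$ be a family as described in the context, which is continuously differentiable in quadratic mean, satisfies: for every compact $K\subset\Theta$ and every $h\in\mathbb{R}^m$, $\sup_{\theta\in K}\mathrm{E}_\theta e^{h^T\ell_\theta}<\infty$, and has $J_\theta$ nonsingular for all $\theta$. Let $\Theta_0$ be a countable subset of $\Theta$ and $(\Omega',\mathcal{X}'):=(\mathbb{R}^m\times[0,1],\mathcal{B}(\mathbb{R}^m\times[0,1]))$. Then there exist, for every $\theta$ and $n\ge1$, a probability measure $\tilde P^n_\theta$ on $(\Omega^n\times\Omega',\mathcal{X}^{\otimes n}\otimes\mathcal{X}')$ whose marginal on $\Omega^n$ is $P^n_\theta$, and a Markov kernel $x\mapsto R^n_\theta(\cdot|x)$ from $\mathbb{R}^m$ to $\Omega^n\times\Omega'$ (which may depend on $\theta$ and $n$ but not on $h$), such that, with random variables $\lambda^n_h$ of law $\mathrm{N}(h,J_\theta^{-1})$ and \[ Q^n_{\theta,h}(A):=\mathrm{E}^{\lambda^n_h}R^n_\theta(A|\lambda^n_h)=\int R^n_\theta(A|x)\,\mathrm{N}(h,J_\theta^{-1})(dx), \] one has, for every compact $K\subset\Theta$ and every compact $K'\subset\mathbb{R}^m$, \[ \lim_{n\to\infty}\sup_{h\in K'}\sup_{\theta\in K\cap\Theta_0}\left\Vert\tilde P^n_{\theta+hn^{-1/2}}-Q^n_{\theta,h}\right\Vert_1=0 . \]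
   Context: $\Theta$ is an open subset of $\mathbb{R}^m$, $(\Omega,\mathcal{X})$ is a Polish space with its Borel $\sigma$-algebra, each $P_\theta$ has density $p_\theta$ with respect to a fixed measure $\mu$, and $P^n_\theta:=P_\theta^{\otimes n}$; $\mathrm{E}_\theta$ is expectation under $P_\theta$. Differentiability in quadratic mean: there is a measurable $\ell_\theta:\Omega\to\mathbb{R}^m$ with $\lim_{h\to0}\Vert h\Vert^{-2}\int\big(\sqrt{p_{\theta+h}}-\sqrt{p_\theta}-\tfrac12 h^T\ell_\theta\sqrt{p_\theta}\big)^2d\mu=0$ for all $\theta$; continuous if moreover $\theta\mapsto\ell_\theta$ is continuous. $J_\theta:=[\mathrm{E}_\theta\ell_{\theta,i}\ell_{\theta,j}]_{i,j}$ (Fisher information). $\mathrm{N}(\mu,\Sigma)$ is the Gaussian law; $\Vert\cdot\Vert_1$ is the total variation ($L^1$) norm. *)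

(* Defs.v *)
From HB Require Import structures.
From mathcomp Require Import all_boot all_order all_algebra.
From mathcomp Require Import all_classical all_reals all_analysis.

Set Implicit Arguments.
Unset Strict Implicit.
Unset Printing Implicit Defensive.

Import Order.TTheory GRing.Theory Num.Theory.
Import numFieldNormedType.Exports.

Local Open Scope classical_set_scope.
Local Open Scope ring_scope.

Section defs.
Variable R : realType.

Definition dotv m (u v : 'rV[R]_m) : R := \sum_(i < m) u ord0 i * v ord0 i.
Definition sqnorm m (u : 'rV[R]_m) : R := \sum_(i < m) u ord0 i ^+ 2.

(* the linear form x |-> t^T x on R^m, where R^m is m.-tuple R with its
   product (= Borel) sigma-algebra *)
Definition linform m (t : 'rV[R]_m) (x : m.-tuple R) : R :=
  \sum_(i < m) t ord0 i * tnth x i.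

Definition is_gaussian m (nu : set (m.-tuple R) -> \bar R)
    (mu : 'rV[R]_m) (Sigma : 'M[R]_m) : Prop :=
  forall t : 'rV[R]_m, forall B : set R, measurable B ->
    let mean := dotv t mu in
    let var := (t *m Sigma *m t^T) ord0 ord0 in
    nu [set x | B (linform t x)] =
      (if var == 0 then \d_mean B else normal_prob mean (Num.sqrt var) B).

Definition dist_open {T : Type} (dist : T -> T -> R) (U : set T) : Prop :=
  forall x, U x -> exists2 e : R, 0 < e & forall y, dist x y < e -> U y.

Definition polish_borel {d} (T : measurableType d) : Prop :=
  exists dist : T -> T -> R,
    [/\ (forall x y, dist x y = 0 <-> x = y),
        (forall x y, dist x y = dist y x),
        (forall x y z, dist x z <= dist x y + dist y z) &
        [/\
        (forall u : nat -> T,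
            (forall e, 0 < e -> exists N, forall p q, (N <= p)%N -> (N <= q)%N ->
               dist (u p) (u q) < e) ->
            exists l, forall e, 0 < e -> exists N, forall p, (N <= p)%N ->
               dist (u p) l < e),
        (exists s : nat -> T, forall x e, 0 < e -> exists k, dist x (s k) < e) &
        (@measurable _ T = <<s dist_open dist >>)]].

Definition fisher {d} {T : measurableType d} m
    (P : 'rV[R]_m -> probability T R) (l : 'rV[R]_m -> T -> 'rV[R]_m)
    (theta : 'rV[R]_m) : 'M[R]_m :=
  \matrix_(i, j) fine (\int[P theta]_x (l theta x ord0 i * l theta x ord0 j)%:E)%E.

(* The marginal of Pt on Omega^n is the n-fold product P^{(x) n}: the law of
   the first component is the product measure, i.e. the measure on the
   product sigma-algebra that gives every measurable rectangle the product
   of the P-masses of its sides. *)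
Definition marginal_is_product {d} {T : measurableType d} {d'}
    {Y : measurableType d'} n (Pt : set (n.-tuple T * Y) -> \bar R)
    (P : set T -> \bar R) : Prop :=
  forall A : 'I_n -> set T, (forall i, measurable (A i)) ->
    Pt [set z | forall i, A i (tnth z.1 i)] = (\prod_(i < n) P (A i))%E.

Definition tv_norm {d} {X : measurableType d} (P Q : set X -> \bar R) : \bar R :=
  ereal_sup [set ((P A - Q A) - (P (~` A) - Q (~` A)))%E | A in measurable].

End defs.

(* Main.v *)
Require Import Defs.
From HB Require Import structures.
From mathcomp Require Import all_boot all_order all_algebra.
From mathcomp Require Import all_classical all_reals all_analysis.
From mathcomp Require Import measurable_realfun ring lra.

Set Implicit Arguments.
Unset Strict Implicit.
Unset Printing Implicit Defensive.

Import Order.TTheory GRing.Theory Num.Theory.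
Import numFieldNormedType.Exports.

Local Open Scope classical_set_scope.
Local Open Scope ring_scope.

(** The kernel is built directly from a central limit theorem.  Let
    Delta_n = n^{-1/2} sum_i l_theta(w_i), and take a finite partition of unity
    (phi_j) on R^m made of trigonometric polynomials, concentrated near points
    a_j.  Set R(x, .) = sum_j phi_j(J x) kappa_j, where kappa_j is P_theta^n
    reweighted by phi_j(Delta_n).  For x ~ N(h, J^{-1}), J x ~ N(J h, J) is the
    limit law of Delta_n under the tilted product G . P_theta^n, with
    G = prod_i e^{h . l(w_i) / sqrt n} / E(e^{h . l / sqrt n}).  Hence
    E phi_j(J x) is close to E_theta^n(G phi_j(Delta_n)); as G is almost a
    function of Delta_n, it is nearly constant on the support of phi_j, so the
    mixture is close to G . P_theta^n.  By differentiability in quadratic mean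
    and a Hellinger estimate, the latter is close to P_{theta + h / sqrt n}^n.
    None of this depends on h except through the bounds, which are uniform for
    theta and h in compact sets.  Finally the precision is made to tend to 0 by
    a diagonal choice.  The auxiliary component R^m x [0,1] is not needed and is
    kept constant. *)

(** * Taylor bounds *)

(** Uniformity in theta is obtained by never fixing a law: the limit statements hold for every pair
    [(P, l)] in [score_class M], so thresholds in n depend only on the moment bound [M], on the
    bound [D] for h and on the precision. For trigonometric polynomials, convergence of expectations
    is an explicit estimate of characteristic functions, and a finite partition calls for finitely
    many of them. The price is that the phi_j are not compactly supported: their spread is
    controlled in mean by exponential moments of Delta_n, and the values of G at the a_j are
    truncated, since the exponential is not Lipschitz. Measures are compared one-sidedly, Q A <= P A
    + e for all measurable A; both having mass 1, complements give the reverse. Hence a subdensity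
    of P_{theta + h / sqrt n} with respect to P_theta is enough, and the mass it misses is
    controlled by the same quadratic-mean remainder. Constants are chosen in the order: truncation
    level, fineness of the partition, then n. *)

Section taylor.
Context {R : realType}.
Implicit Types x y c : R.

(** The Taylor bounds below apply this to a remainder whose derivative is a remainder already
    bounded. Only the power of [|x|] matters later, so no factorials are kept. *)
Lemma mean_value_bound (f df : R -> R) x c :
  (forall y, is_derive y 1 f (df y)) ->
  (forall y, `|y| <= `|x| -> `|df y| <= c) -> `|f x - f 0| <= c * `|x|.
Proof.
move=> fdf dfc.
have cf : continuous f.
  move=> y; apply: differentiable_continuous; apply/derivable1_diffP.
  exact: (ex_derive (is_derive := fdf y)).
have [x0|/ltW x0] := leP 0 x.
  have [z + ->] := MVT_segment x0 (fun y _ => fdf y) (continuous_subspaceT cf).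
  rewrite in_itv/= => /andP[z0 zx]; rewrite subr0 normrM ler_wpM2r// dfc//.
  by rewrite !ger0_norm.
have [z + ] := MVT_segment x0 (fun y _ => fdf y) (continuous_subspaceT cf).
rewrite in_itv/= => /andP[zx z0] e; rewrite distrC e sub0r normrM normrN.
by rewrite ler_wpM2r// dfc// !ler0_norm// lerN2.
Qed.

Lemma normr_sin_le x : `|sin x| <= `|x|.
Proof.
have := @mean_value_bound sin cos x 1 (fun y => is_derive_sin y).
by rewrite sin0 subr0 mul1r; apply => y _; exact: cos_max.
Qed.

Let is_derive_cosB1 y : is_derive y (1 : R) cos (- sin y).
Proof. exact: is_derive_cos. Qed.

Lemma cos_sub1_le x : `|cos x - 1| <= `|x|.
Proof.
have := @mean_value_bound cos _ x 1 is_derive_cosB1.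
by rewrite cos0 mul1r; apply => y _; rewrite normrN sin_max.
Qed.

Lemma cos_sub1_le2 x : `|cos x - 1| <= `|x| ^+ 2.
Proof.
have := @mean_value_bound cos _ x `|x| is_derive_cosB1.
rewrite cos0 expr2; apply => y yx.
by rewrite normrN (le_trans (normr_sin_le _)).
Qed.

Let is_derive_sinB y : is_derive y (1 : R) (fun z => sin z - z) (cos y - 1).
Proof. exact: is_deriveB. Qed.

Lemma sin_sub_le2 x : `|sin x - x| <= `|x| ^+ 2.
Proof.
have := @mean_value_bound _ _ x `|x| is_derive_sinB.
rewrite sin0 !subr0 expr2; apply => y yx.
by rewrite (le_trans (cos_sub1_le _)).
Qed.

Lemma sin_sub_le3 x : `|sin x - x| <= `|x| ^+ 3.
Proof.
have := @mean_value_bound _ _ x (`|x| ^+ 2) is_derive_sinB.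
rewrite sin0 !subr0 -exprSr; apply => y yx.
by rewrite (le_trans (cos_sub1_le2 _))// lerXn2r ?nnegrE.
Qed.

Lemma cos_sub2_le3 x : `|cos x - 1 + x ^+ 2 / 2| <= `|x| ^+ 3.
Proof.
have dv y : is_derive y (1 : R) (fun z => cos z - 1 + z ^+ 2 / 2) (y - sin y).
  apply: is_derive_eq.
  by rewrite /GRing.scale/=; field.
have := @mean_value_bound _ _ x (`|x| ^+ 2) dv.
rewrite cos0 expr0n/= mul0r subrr addr0 subr0 -exprSr; apply => y yx.
by rewrite distrC (le_trans (sin_sub_le2 _))// lerXn2r ?nnegrE.
Qed.

Lemma expR_sub1_le x : `|expR x - 1| <= `|x| * expR `|x|.
Proof.
have := @mean_value_bound expR expR x (expR `|x|) (fun y => is_derive_expR y).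
rewrite expR0 mulrC; apply => y yx.
by rewrite ger0_norm ?expR_ge0// ler_expR (le_trans (ler_norm _)).
Qed.

Lemma expR_sub2_le x : `|expR x - 1 - x| <= `|x| ^+ 2 * expR `|x|.
Proof.
have dv y : is_derive y (1 : R) (fun z => expR z - 1 - z) (expR y - 1).
  by apply: is_derive_eq; rewrite subr0.
have := @mean_value_bound _ _ x (`|x| * expR `|x|) dv.
rewrite expR0 subrr !subr0 [_ * expR _ * _]mulrAC -expr2; apply => y yx.
rewrite (le_trans (expR_sub1_le _))// ler_pM ?expR_ge0// ler_expR//.
Qed.

(** With k = n + 1, this is x / k <= e^(x / k) raised to the power k. It lets exponential moments
    absorb powers of an envelope. *)
Lemma exprn_le_expR x n : 0 <= x -> x ^+ n.+1 <= n.+1%:R ^+ n.+1 * expR x.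
Proof.
move=> x0; have n0 : (0 : R) < n.+1%:R by rewrite ltr0n.
rewrite -[x in x ^+ _](mulfVK (lt0r_neq0 n0)) exprMn mulrC ler_wpM2l//.
rewrite -[x in expR x](mulfVK (lt0r_neq0 n0)) expRM_natr lerXn2r ?nnegrE ?expR_ge0//.
  by rewrite mulr_ge0// invr_ge0 ltW.
by rewrite (le_trans _ (expR_ge1Dx _))// lerDr.
Qed.

End taylor.

(** * Densities and product measures *)

Section density.
Local Open Scope ereal_scope.
Context d (T : measurableType d) (R : realType).
Variables (mu : {measure set T -> \bar R}) (q : T -> R).

(** The two proofs are arguments, though absent from the value, so that the measure structure
    declared next can be attached to the term itself. *)
Definition mdensity of measurable_fun [set: T] q & (forall x, 0 <= q x)%R :=
  fun A => \int[mu]_(x in A) (q x)%:E.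

Hypotheses (mq : measurable_fun [set: T] q) (q0 : (forall x, 0 <= q x)%R).
Notation nu := (mdensity mq q0).

Let mdensity0 : nu set0 = 0.
Proof. exact: integral_set0. Qed.

Let mdensity_ge0 A : 0 <= nu A.
Proof. by apply: integral_ge0 => x _; rewrite lee_fin. Qed.

Let mdensity_sigma_additive : semi_sigma_additive nu.
Proof.
move=> F mF tF mUF; rewrite /mdensity ge0_integral_bigcup//=; last 2 first.
- by apply: (measurable_funS measurableT) => //; exact/measurable_EFinP.
- by move=> x _; rewrite lee_fin.
apply: is_cvg_ereal_nneg_natsum_cond => n _ _.
by apply: integral_ge0 => x _; rewrite lee_fin.
Qed.

HB.instance Definition _ := isMeasure.Build _ _ _
  nu mdensity0 mdensity_ge0 mdensity_sigma_additive.

Let integral_mdensity_indic A : measurable A ->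
  \int[nu]_x (\1_A x)%:E = \int[mu]_x ((\1_A x)%:E * (q x)%:E).
Proof.
move=> mA; rewrite integral_indic// setIT [LHS]integral_mkcond epatch_indic.
by apply: eq_integral => x _; rewrite /= muleC.
Qed.

Import HBNNSimple.

Let integral_mdensity_nnsfun (f : {nnsfun T >-> R}) :
  \int[nu]_x (f x)%:E = \int[mu]_x ((f x)%:E * (q x)%:E).
Proof.
under [in LHS]eq_integral do rewrite fimfunE -fsumEFin//.
rewrite ge0_integral_fsum//; last 2 first.
  - by move=> r; exact/measurable_EFinP/measurableT_comp.
  - by move=> r z _; rewrite EFinM nnfun_muleindic_ge0.
under [RHS]eq_integral => x _.
  rewrite fimfunE -fsumEFin// ge0_mule_fsuml; last first.
    by move=> r; rewrite EFinM nnfun_muleindic_ge0.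
  over.
rewrite /= ge0_integral_fsum//; last 2 first.
  - move=> r; apply: emeasurable_funM; last exact/measurable_EFinP.
    exact/measurable_EFinP/measurableT_comp.
  - by move=> r z _; rewrite mule_ge0 ?lee_fin// -lee_fin EFinM nnfun_muleindic_ge0.
apply: eq_fsbigr => r _.
rewrite (integralZl_indic _ (fun r => f @^-1` [set r]))//; last first.
  by move=> r0; rewrite preimage_nnfun0.
rewrite integral_mdensity_indic//.
(* Membership of [r] in the range has been dropped, so [r] may be negative; its preimage is then
   empty. *)
have [r0|r0] := leP 0%R r.
  rewrite -ge0_integralZl//.
  - by apply: eq_integral => x _; rewrite muleA -EFinM.
  - apply: emeasurable_funM; exact/measurable_EFinP.
  - by move=> x _; rewrite mule_ge0// lee_fin.
rewrite preimage_nnfun0// integral0_eq; last by move=> x _; rewrite indic0 mul0e.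
by rewrite mule0 integral0_eq// => x _; rewrite indic0 mulr0 mul0e.
Qed.

Lemma integral_mdensity (f : T -> \bar R) : measurable_fun [set: T] f ->
  (forall x, 0 <= f x) -> \int[nu]_x f x = \int[mu]_x (f x * (q x)%:E).
Proof.
move=> mf f0; pose g := nnsfun_approx measurableT mf.
have gf x : f x = lim ((g n x)%:E @[n --> \oo]).
  by apply/esym/cvg_lim => //; exact: cvg_nnsfun_approx.
have gfq x : f x * (q x)%:E = lim ((g n x)%:E * (q x)%:E @[n --> \oo]).
  by apply/esym/cvg_lim => //; apply: cvgeZr => //; exact: cvg_nnsfun_approx.
transitivity (\int[nu]_x (lim ((g n x)%:E @[n --> \oo]))).
  by apply: eq_integral => x _; exact: gf.
rewrite monotone_convergence//; last 3 first.
- by move=> n; exact/measurable_EFinP.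
- by move=> n x _; rewrite lee_fin.
- by move=> x _ a b ab; rewrite lee_fin; exact/lefP/nd_nnsfun_approx.
under eq_fun do rewrite integral_mdensity_nnsfun.
rewrite -monotone_convergence//.
- by apply: eq_integral => x _; rewrite gfq.
- by move=> n; apply: emeasurable_funM; exact/measurable_EFinP.
- by move=> n x _; rewrite mule_ge0// lee_fin.
- move=> x _ a b ab; rewrite lee_wpmul2r ?lee_fin//.
  exact/lefP/nd_nnsfun_approx.
Qed.

End density.

Lemma le_integral_density d (T : measurableType d) (R : realType)
    (mu nu : {measure set T -> \bar R}) (q : T -> R) (f : T -> \bar R) :
  measurable_fun [set: T] q -> (forall x, 0 <= q x) ->
  (forall A, measurable A -> \int[mu]_(x in A) (q x)%:E <= nu A)%E ->
  measurable_fun [set: T] f -> (forall x, 0 <= f x)%E ->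
  (\int[mu]_x (f x * (q x)%:E) <= \int[nu]_x f x)%E.
Proof.
move=> mq q0 qnu mf f0; rewrite -integral_mdensity//.
exact: ge0_le_measure_integral.
Qed.

Lemma integral_density d (T : measurableType d) (R : realType)
    (mu nu : {measure set T -> \bar R}) (q : T -> R) (f : T -> \bar R) :
  measurable_fun [set: T] q -> (forall x, 0 <= q x) ->
  (forall A, measurable A -> nu A = \int[mu]_(x in A) (q x)%:E)%E ->
  measurable_fun [set: T] f -> (forall x, 0 <= f x)%E ->
  (\int[nu]_x f x = \int[mu]_x (f x * (q x)%:E))%E.
Proof.
move=> mq q0 qnu mf f0; rewrite -integral_mdensity//.
by apply: eq_measure_integral => A mA _; exact: qnu.
Qed.

(** * Finite product measures on tuples *)

Section tuple_cons.
Context d (T : measurableType d) (n : nat).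

Definition tcons (z : T * n.-tuple T) : n.+1.-tuple T := [tuple of z.1 :: z.2].

Lemma measurable_tcons : measurable_fun [set: _] tcons.
Proof. exact: measurable_cons. Qed.

HB.instance Definition _ := isMeasurableFun.Build _ _ _ _ tcons measurable_tcons.

End tuple_cons.

Section iprod.
Local Open Scope ereal_scope.
Context d (T : measurableType d) (R : realType).

(** Adding one coordinate in front, as the image of a binary product, turns integrals over tuples
    into iterated ones and makes induction on n available. *)
Fixpoint iprod (P : probability T R) n : probability (n.-tuple T) R :=
  if n is n'.+1 then distribution (P \x iprod P n') (@tcons _ T n')
  else dirac [tuple].

Lemma ge0_integral_iprodS (P : probability T R) n (f : n.+1.-tuple T -> \bar R) :
  measurable_fun [set: _] f -> (forall w, 0 <= f w) ->
  \int[iprod P n.+1]_w f w = \int[P]_x \int[iprod P n]_t f (tcons (x, t)).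
Proof.
move=> mf f0; rewrite ge0_integral_distribution//.
rewrite fubini_tonelli1//; last by move=> z; exact: f0.
by apply: measurableT_comp => //; exact: measurable_tcons.
Qed.

Lemma integral_iprod_prod (P : probability T R) n (f : 'I_n -> T -> R) :
  (forall i, measurable_fun [set: T] (f i)) -> (forall i x, 0 <= f i x)%R ->
  \int[iprod P n]_w (\prod_(i < n) f i (tnth w i))%:E =
  \prod_(i < n) \int[P]_x (f i x)%:E.
Proof.
elim: n f => [|n IH] f mf f0.
  rewrite big_ord0; under eq_integral do rewrite big_ord0.
  by rewrite integral_cst// mul1e; exact: (probability_setT (iprod P 0)).
have mprod (k : nat) (g : 'I_k -> T -> R) :
    (forall i, measurable_fun [set: T] (g i)) ->
    measurable_fun [set: k.-tuple T]
      (fun w => (\prod_(i < k) g i (tnth w i))%:E).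
  move=> mg; apply/measurable_EFinP; apply: measurable_prod => i _.
  by apply: measurableT_comp => //; exact: measurable_tnth.
rewrite ge0_integral_iprodS; last 2 first.
- exact: mprod.
- by move=> w; rewrite lee_fin prodr_ge0.
rewrite big_ord_recl.
transitivity (\int[P]_x ((f ord0 x)%:E *
    \prod_(i < n) \int[P]_y (f (lift ord0 i) y)%:E)).
  apply: eq_integral => x _; rewrite -(IH (fun i => f (lift ord0 i)))//.
  rewrite -ge0_integralZl//.
  - apply: eq_integral => t _; rewrite big_ord_recl tnth0 EFinM.
    by congr (_ * _%:E); apply: eq_bigr => i _; rewrite tnthS.
  - exact: (mprod _ (fun i => f (lift ord0 i))).
  - by move=> t _; rewrite lee_fin prodr_ge0.
  - by rewrite lee_fin.
rewrite ge0_integralZr//; first exact/measurable_EFinP.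
- by move=> x _; rewrite lee_fin.
- by apply: prode_ge0 => i _; apply: integral_ge0 => x _; rewrite lee_fin.
Qed.

Lemma iprod_rectangle (P : probability T R) n (A : 'I_n -> set T) :
  (forall i, measurable (A i)) ->
  iprod P n [set w | forall i, A i (tnth w i)] = \prod_(i < n) P (A i).
Proof.
move=> mA.
have mE : measurable [set w : n.-tuple T | forall i, A i (tnth w i)].
  rewrite [X in measurable X](_ : _ =
      \bigcap_(i in [set: 'I_n]) (fun w : n.-tuple T => tnth w i) @^-1` A i).
    apply: fin_bigcap_measurable => // i _.
    by rewrite -[X in measurable X]setTI; exact: measurable_tnth.
  by apply/seteqP; split=> w /= Aw i => [_|]; exact: Aw.
transitivity (\int[iprod P n]_w
    (\1_[set w : n.-tuple T | forall i, A i (tnth w i)] w)%:E).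
  by rewrite integral_indic// setIT.
under [RHS]eq_bigr do rewrite -[A _]setIT -integral_indic//.
rewrite -(integral_iprod_prod P (f := fun i => \1_(A i)))//.
apply: eq_integral => w _; congr (_%:E).
rewrite indicE; have [/set_mem /= Aw|/negP nAw] := boolP (w \in _).
  by rewrite big1// => i _; rewrite indicE mem_set.
have /existsNP[i nAi] : ~ forall i, A i (tnth w i).
  by move=> Aw; apply: nAw; rewrite inE.
by rewrite (bigD1 i)//= indicE memNset// mul0r.
Qed.

(** Induction on n with [f] arbitrary: the inner integral under P' is again a nonnegative measurable
    function of the first coordinate, to which the one-coordinate comparison applies. *)
Lemma iprod_density_le (P P' : probability T R) (q : T -> R) n
    (f : n.-tuple T -> \bar R) :
  measurable_fun [set: T] q -> (forall x, 0 <= q x)%R ->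
  (forall A, measurable A -> \int[P]_(x in A) (q x)%:E <= P' A) ->
  measurable_fun [set: _] f -> (forall w, 0 <= f w) ->
  \int[iprod P n]_w (f w * (\prod_(i < n) q (tnth w i))%:E) <=
  \int[iprod P' n]_w f w.
Proof.
move=> mq q0 qP'.
have mprod k : measurable_fun [set: k.-tuple T]
    (fun w => (\prod_(i < k) q (tnth w i))%:E).
  apply/measurable_EFinP; apply: measurable_prod => i _.
  by apply: measurableT_comp => //; exact: measurable_tnth.
elim: n f => [|n IH] f mf f0.
  by under eq_integral do rewrite big_ord0 mule1.
rewrite !ge0_integral_iprodS//; last 2 first.
- by apply: emeasurable_funM => //; exact: mprod.
- by move=> w; rewrite mule_ge0// lee_fin prodr_ge0.
have mfc x : measurable_fun [set: n.-tuple T] (fun t => f (tcons (x, t))).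
  apply: (measurableT_comp mf); apply: (measurableT_comp (@measurable_tcons _ T n)).
  exact: pair1_measurable.
have mI : measurable_fun [set: T] (fun x => \int[iprod P' n]_t f (tcons (x, t))).
  apply: (measurable_fun_fubini_tonelli_F (fun z => f (tcons z))) => //.
    by apply: (measurableT_comp mf); exact: measurable_tcons.
have I0 x : 0 <= \int[iprod P' n]_t f (tcons (x, t)).
  by apply: integral_ge0.
apply: le_trans (le_integral_density mq q0 qP' mI I0).
apply: ge0_le_integral => //.
- by move=> x _; apply: integral_ge0 => t _; rewrite mule_ge0// lee_fin prodr_ge0.
- apply: (measurable_fun_fubini_tonelli_F
    (fun z => f (tcons z) * (\prod_(i < n.+1) q (tnth (tcons z) i))%:E)).
    apply: emeasurable_funM.
      by apply: (measurableT_comp mf); exact: measurable_tcons.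
    by apply: (measurableT_comp (mprod n.+1)); exact: measurable_tcons.
  by move=> z; rewrite mule_ge0// lee_fin prodr_ge0.
- by apply: emeasurable_funM => //; exact/measurable_EFinP.
move=> x _.
rewrite (eq_integral (fun t => (f (tcons (x, t)) *
    (\prod_(i < n) q (tnth t i))%:E) * (q x)%:E)); last first.
  move=> t _; rewrite big_ord_recl tnth0 -muleA -EFinM mulrC.
  by congr (_ * (_ * _)%:E); apply: eq_bigr => i _; rewrite tnthS.
rewrite ge0_integralZr//.
- by rewrite lee_wpmul2r ?lee_fin// IH.
- by apply: emeasurable_funM => //; exact: mprod.
- by move=> t _; rewrite mule_ge0// lee_fin prodr_ge0.
- by rewrite lee_fin.
Qed.

End iprod.

(** * A central limit theorem under exponential tilting *)

Section expectation.
Context d (T : measurableType d) (R : realType) (P : probability T R).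
Implicit Types f g : T -> R.
Notation integ f := (P.-integrable [set: T] (EFin \o f)).

Lemma integrable_dominated f g : measurable_fun [set: T] f ->
  (forall x, `|f x| <= g x) -> integ g -> integ f.
Proof.
move=> mf fg ig; apply: le_integrable ig => //; first exact/measurable_EFinP.
by move=> x _ /=; rewrite lee_fin (le_trans (fg x))// ler_norm.
Qed.

Lemma le_normr_expectation f g : measurable_fun [set: T] f ->
  (forall x, `|f x| <= g x) -> integ g ->
  `|\int[P]_x f x| <= \int[P]_x g x.
Proof.
move=> mf fg ig; have ifi := integrable_dominated mf fg ig.
rewrite (le_trans (le_normr_Rintegral _ _))//.
by apply: le_Rintegral => //; exact: integrable_norm.
Qed.

Lemma EFin_Rintegral f : integ f ->
  (\int[P]_x f x)%:E = (\int[P]_x (f x)%:E)%E.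
Proof. by move=> ifi; rewrite /Rintegral fineK//; exact: integrable_fin_num. Qed.

Lemma integrable_le_cst f c : measurable_fun [set: T] f ->
  (forall x, 0 <= f x) -> (\int[P]_x (f x)%:E <= c%:E)%E -> integ f.
Proof.
move=> mf f0 fc; apply/integrableP; split; first exact/measurable_EFinP.
rewrite (eq_integral (fun x => (f x)%:E)); first exact: (le_lt_trans fc (ltry _)).
by move=> x _ /=; rewrite ger0_norm.
Qed.

Lemma Rintegral_le_cst f c : measurable_fun [set: T] f ->
  (forall x, 0 <= f x) -> (\int[P]_x (f x)%:E <= c%:E)%E ->
  \int[P]_x f x <= c.
Proof.
move=> mf f0 fc; rewrite -lee_fin EFin_Rintegral//.
exact: integrable_le_cst fc.
Qed.

Lemma Rintegral_sum (D : set T) (I : Type) (s : seq I) (F : I -> T -> R) :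
  measurable D -> (forall i, P.-integrable D (EFin \o F i)) ->
  P.-integrable D (EFin \o (fun x => \sum_(i <- s) F i x)) /\
  \int[P]_(x in D) (\sum_(i <- s) F i x) = \sum_(i <- s) \int[P]_(x in D) F i x.
Proof.
move=> mD iF; elim: s => [|i s [is_ es]].
  have -> : (fun x => \sum_(i <- [::]) F i x) = cst 0.
    by apply/funext => x; rewrite big_nil.
  rewrite big_nil; split; first exact: finite_measure_integrable_cst.
  by rewrite Rintegral_cst// mul0r.
have -> : (fun x => \sum_(j <- i :: s) F j x) = (fun x => F i x + \sum_(j <- s) F j x).
  by apply/funext => x; rewrite big_cons.
split; last by rewrite RintegralD// big_cons es.
have := integrableD mD (iF i) is_.
by apply: eq_integrable => // x _ /=; rewrite EFinD.
Qed.

Lemma integrable_cst (c : R) : integ (cst c).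
Proof. exact: finite_measure_integrable_cst. Qed.

Lemma expectation_cst (c : R) : \int[P]_x c = c.
Proof. by rewrite Rintegral_cst// [X in fine X](probability_setT P) mulr1. Qed.

End expectation.

(** * Expansions in one coordinate under the tilt *)

Section pointwise.
Context {R : realType}.
Variables (X Y a r : R).
Hypotheses (r0 : 0 <= r) (r1 : r <= 1) (Xa : `|X| <= a) (Ya : `|Y| <= a).

Let a0 : 0 <= a. Proof. by rewrite (le_trans _ Xa). Qed.

Let nX : `|r * X| <= r * a. Proof. by rewrite normrM (ger0_norm r0) ler_wpM2l. Qed.
Let nY : `|r * Y| <= r * a. Proof. by rewrite normrM (ger0_norm r0) ler_wpM2l. Qed.
Let ra : r * a <= a. Proof. by rewrite ler_piMl. Qed.
Let ra0 : 0 <= r * a. Proof. by rewrite mulr_ge0. Qed.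
Let eY : expR `|r * Y| <= expR a.
Proof. by rewrite ler_expR (le_trans nY). Qed.

Lemma expR_scaled_le : expR (r * Y) <= expR a.
Proof. by rewrite (le_trans _ eY)// ler_expR ler_norm. Qed.

Let expR2a : expR a * expR a = expR (2 * a).
Proof. by rewrite -expRD; congr expR; ring. Qed.

Let a3 : a ^+ 3 * expR a <= 27 * expR (2 * a).
Proof.
rewrite -expR2a mulrA ler_wpM2r ?expR_ge0// (le_trans (exprn_le_expR 2 a0))//.
by rewrite ler_wpM2r ?expR_ge0// -natrX ler_nat.
Qed.

Let a2 : a ^+ 2 * expR a <= 4 * expR (2 * a).
Proof.
rewrite -expR2a mulrA ler_wpM2r ?expR_ge0// (le_trans (exprn_le_expR 1 a0))//.
by rewrite ler_wpM2r ?expR_ge0// -natrX ler_nat.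
Qed.

(** The tilt stays exact in front of the cosine and is replaced by 1 only in the quadratic term, at
    a cubic cost. Both errors are at most r^3 a^3 e^a, and 54 is twice the 27 = 3^3 of [a3]. *)
Lemma tilt_cos_le :
  `|expR (r * Y) * cos (r * X) - expR (r * Y) + (r * X) ^+ 2 / 2|
    <= 54 * r ^+ 3 * expR (2 * a).
Proof.
rewrite (_ : _ + _ = expR (r * Y) * (cos (r * X) - 1 + (r * X) ^+ 2 / 2)
   - (expR (r * Y) - 1) * ((r * X) ^+ 2 / 2)); last by field.
rewrite (le_trans (ler_normB _ _))// (normrM (expR _)) (normrM (_ - 1)).
have h1 : `|expR (r * Y)| * `|cos (r * X) - 1 + (r * X) ^+ 2 / 2|
    <= expR a * (r * a) ^+ 3.
  rewrite ler_pM//; first by rewrite ger0_norm ?expR_ge0// expR_scaled_le.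
  by rewrite (le_trans (cos_sub2_le3 _))// lerXn2r ?nnegrE.
have h2 : `|expR (r * Y) - 1| * `|(r * X) ^+ 2 / 2|
    <= (r * a * expR a) * (r * a) ^+ 2.
  rewrite ler_pM//; first by rewrite (le_trans (expR_sub1_le _))// ler_pM// expR_ge0.
  rewrite normrM normrX -[leRHS]mulr1 ler_pM// ?lerXn2r ?nnegrE//.
  by rewrite ger0_norm// invf_le1// ler1n.
rewrite (le_trans (lerD h1 h2))//.
rewrite (_ : _ + _ = 2 * r ^+ 3 * (a ^+ 3 * expR a)); last by ring.
rewrite (_ : 54 * _ * _ = 2 * r ^+ 3 * (27 * expR (2 * a))); last by ring.
by rewrite ler_wpM2l// mulr_ge0// exprn_ge0.
Qed.

(** Here the tilt is expanded to first order: r X will have mean zero, and the mean of r^2 X Y is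
    what shifts the limit law. *)
Lemma tilt_sin_le :
  `|expR (r * Y) * sin (r * X) - r * X - (r * X) * (r * Y)|
    <= 54 * r ^+ 3 * expR (2 * a).
Proof.
rewrite (_ : _ - _ - _ = expR (r * Y) * (sin (r * X) - r * X)
   + (r * X) * (expR (r * Y) - 1 - r * Y)); last by ring.
rewrite (le_trans (ler_normD _ _))// ![`|_ * (_ - _)|]normrM.
have h1 : `|expR (r * Y)| * `|sin (r * X) - r * X| <= expR a * (r * a) ^+ 3.
  rewrite ler_pM//; first by rewrite ger0_norm ?expR_ge0// expR_scaled_le.
  by rewrite (le_trans (sin_sub_le3 _))// lerXn2r ?nnegrE.
have h2 : `|r * X| * `|expR (r * Y) - 1 - r * Y|
    <= (r * a) * ((r * a) ^+ 2 * expR a).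
  rewrite ler_pM// (le_trans (expR_sub2_le _))// ler_pM// ?exprn_ge0 ?expR_ge0//.
  by rewrite lerXn2r ?nnegrE.
rewrite (le_trans (lerD h1 h2))//.
rewrite (_ : _ + _ = 2 * r ^+ 3 * (a ^+ 3 * expR a)); last by ring.
rewrite (_ : 54 * _ * _ = 2 * r ^+ 3 * (27 * expR (2 * a))); last by ring.
by rewrite ler_wpM2l// mulr_ge0// exprn_ge0.
Qed.

Lemma tilt_sub2_le :
  `|expR (r * Y) - 1 - r * Y| <= 4 * r ^+ 2 * expR (2 * a).
Proof.
rewrite (le_trans (expR_sub2_le _))//.
rewrite (_ : 4 * _ * _ = r ^+ 2 * (4 * expR (2 * a))); last by ring.
rewrite (@le_trans _ _ (r ^+ 2 * (a ^+ 2 * expR a)))//.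
  rewrite mulrA -exprMn ler_pM// ?exprn_ge0 ?expR_ge0//.
  by rewrite lerXn2r ?nnegrE.
by rewrite ler_wpM2l// exprn_ge0.
Qed.

Lemma mul_scaled_le : `|X * Y| <= 4 * expR (2 * a).
Proof.
rewrite normrM (@le_trans _ _ (a ^+ 2))//; first by rewrite expr2 ler_pM.
by rewrite (le_trans _ a2)// ler_peMr ?exprn_ge0// -expR0 ler_expR.
Qed.

End pointwise.

Section one_step.
Context d (T : measurableType d) (R : realType) (P : probability T R).
Variables (X Y a : T -> R) (C r : R).
Hypotheses (mX : measurable_fun [set: T] X) (mY : measurable_fun [set: T] Y).
Hypotheses (ma : measurable_fun [set: T] a).
Hypotheses (Xa : forall x, `|X x| <= a x) (Ya : forall x, `|Y x| <= a x).
Hypothesis aC : (\int[P]_x (expR (2 * a x))%:E <= C%:E)%E.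
Hypotheses (X0 : \int[P]_x X x = 0) (Y0 : \int[P]_x Y x = 0).
Hypotheses (r0 : 0 <= r) (r1 : r <= 1).

Notation integ f := (P.-integrable [set: T] (EFin \o f)).

Let a0 x : 0 <= a x. Proof. by rewrite (le_trans _ (Xa x)). Qed.

Let mE : measurable_fun [set: T] (fun x => expR (2 * a x)).
Proof. by apply: measurableT_comp => //; exact: measurable_funM. Qed.

Lemma integrable_expR_envelope : integ (fun x => expR (2 * a x)).
Proof. by apply: integrable_le_cst aC => // x; exact: expR_ge0. Qed.

Lemma expectation_envelope (c : R) : 0 <= c -> \int[P]_x (c * expR (2 * a x)) <= c * C.
Proof.
move=> c0; rewrite RintegralZl//; last exact: integrable_expR_envelope.
by rewrite ler_wpM2l// Rintegral_le_cst// => x; exact: expR_ge0.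
Qed.

Lemma integrable_envelope (f : T -> R) (c : R) : measurable_fun [set: T] f ->
  (forall x, `|f x| <= c * expR (2 * a x)) -> integ f.
Proof.
move=> mf fc; apply: (integrable_dominated mf fc).
have := integrableZl measurableT c integrable_expR_envelope.
by apply: eq_integrable => // x _ /=; rewrite EFinM.
Qed.

Lemma normr_expectation_envelope (f : T -> R) (c : R) : 0 <= c -> measurable_fun [set: T] f ->
  (forall x, `|f x| <= c * expR (2 * a x)) -> `|\int[P]_x f x| <= c * C.
Proof.
move=> c0 mf fc; apply: le_trans (expectation_envelope c0).
apply: le_normr_expectation => //.
have := integrableZl measurableT c integrable_expR_envelope.
by apply: eq_integrable => // x _ /=; rewrite EFinM.
Qed.

Let aE x : a x <= 1 * expR (2 * a x).
Proof.
rewrite mul1r (@le_trans _ _ (1 + 2 * a x)) ?expR_ge1Dx//.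
by have := a0 x; lra.
Qed.

Lemma integrable_X : integ X.
Proof. by apply: integrable_envelope => // x; rewrite (le_trans (Xa x)). Qed.

Lemma integrable_Y : integ Y.
Proof. by apply: integrable_envelope => // x; rewrite (le_trans (Ya x)). Qed.

Lemma integrable_XY : integ (fun x => X x * Y x).
Proof.
apply: (@integrable_envelope _ 4) => [|x]; first exact: measurable_funM.
exact: mul_scaled_le.
Qed.

Lemma integrable_XX : integ (fun x => X x ^+ 2).
Proof.
apply: (@integrable_envelope _ 4) => [|x]; first exact: measurable_funX.
exact: mul_scaled_le.
Qed.

Let eaE x : expR (a x) <= 1 * expR (2 * a x).
Proof. by rewrite mul1r ler_expR; have := a0 x; lra. Qed.

Let mexpY : measurable_fun [set: T] (fun x => expR (r * Y x)).
Proof. by apply: measurableT_comp => //; exact: measurable_funM. Qed.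

Let mcosX : measurable_fun [set: T] (fun x => cos (r * X x)).
Proof.
apply: measurableT_comp; first by apply: continuous_measurable_fun; exact: continuous_cos.
exact: measurable_funM.
Qed.

Let msinX : measurable_fun [set: T] (fun x => sin (r * X x)).
Proof.
apply: measurableT_comp; first by apply: continuous_measurable_fun; exact: continuous_sin.
exact: measurable_funM.
Qed.

Lemma integrable_tilt : integ (fun x => expR (r * Y x)).
Proof.
apply: (@integrable_envelope _ 1) => // x.
by rewrite ger0_norm ?expR_ge0// (le_trans _ (eaE x))// (expR_scaled_le r0 r1 (Xa x)).
Qed.

Lemma integrable_tilt_cos : integ (fun x => expR (r * Y x) * cos (r * X x)).
Proof.
apply: (@integrable_envelope _ 1) => [|x]; first exact: measurable_funM.
rewrite normrM ger0_norm ?expR_ge0// (le_trans _ (eaE x))//.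
rewrite -[leRHS]mulr1 ler_pM ?expR_ge0//; first exact: (expR_scaled_le r0 r1 (Xa x)).
exact: cos_max.
Qed.

Lemma integrable_tilt_sin : integ (fun x => expR (r * Y x) * sin (r * X x)).
Proof.
apply: (@integrable_envelope _ 1) => [|x]; first exact: measurable_funM.
rewrite normrM ger0_norm ?expR_ge0// (le_trans _ (eaE x))//.
rewrite -[leRHS]mulr1 ler_pM ?expR_ge0//; first exact: (expR_scaled_le r0 r1 (Xa x)).
exact: sin_max.
Qed.

Notation B := (\int[P]_x expR (r * Y x)).

Let integrable_rY : integ (fun x => r * Y x).
Proof.
have := integrableZl measurableT r integrable_Y.
by apply: eq_integrable => // x _ /=; rewrite EFinM.
Qed.

(** As [Y] is centred, the linear term can be subtracted freely. The integrand is then nonnegative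
    and of order r^2, which gives both bounds on the mass. *)
Lemma tilt_mass_sub1 : B - 1 = \int[P]_x (expR (r * Y x) - 1 - r * Y x).
Proof.
rewrite RintegralB//; last first.
  apply: (integrable_envelope (c := 2)) => [|x]; first exact: measurable_funB.
  rewrite (le_trans (ler_normB _ _))// normr1 ger0_norm ?expR_ge0//.
  have := eaE x; have := expR_scaled_le r0 r1 (Xa x) (Ya x).
  have := expR_ge1Dx (2 * a x); have := a0 x; lra.
rewrite RintegralB//; [|exact: integrable_tilt|exact: integrable_cst].
rewrite RintegralZl//; last exact: integrable_Y.
by rewrite Y0 mulr0 subr0 expectation_cst.
Qed.

Let msub2 : measurable_fun [set: T] (fun x => expR (r * Y x) - 1 - r * Y x).
Proof. by apply: measurable_funB; [exact: measurable_funB|exact: measurable_funM]. Qed.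

Lemma tilt_mass_ge1 : 1 <= B.
Proof.
rewrite -subr_ge0 tilt_mass_sub1 Rintegral_ge0// => x _.
by have := expR_ge1Dx (r * Y x); lra.
Qed.

Lemma tilt_mass_le : B <= 1 + 4 * r ^+ 2 * C.
Proof.
rewrite -lerBlDl tilt_mass_sub1 (le_trans (ler_norm _))//.
apply: normr_expectation_envelope => // [|x]; first by rewrite mulr_ge0// exprn_ge0.
exact: (tilt_sub2_le r0 r1 (Xa x)).
Qed.

Lemma expectation_XX_ge0 : 0 <= \int[P]_x (X x ^+ 2).
Proof. by apply: Rintegral_ge0 => x _; exact: sqr_ge0. Qed.

Lemma expectation_XX_le : \int[P]_x (X x ^+ 2) <= 4 * C.
Proof.
rewrite (le_trans (ler_norm _))//; apply: normr_expectation_envelope => //.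
  exact: measurable_funX.
by move=> x; exact: mul_scaled_le.
Qed.

Lemma expectation_XY_le : `|\int[P]_x (X x * Y x)| <= 4 * C.
Proof.
apply: normr_expectation_envelope => //; first exact: measurable_funM.
by move=> x; exact: mul_scaled_le.
Qed.

Lemma tilt_cos_expectation :
  `|\int[P]_x (expR (r * Y x) * cos (r * X x)) - B
     + r ^+ 2 * (\int[P]_x (X x ^+ 2)) / 2| <= 54 * r ^+ 3 * C.
Proof.
have -> : \int[P]_x (expR (r * Y x) * cos (r * X x)) - B
     + r ^+ 2 * (\int[P]_x (X x ^+ 2)) / 2 =
   \int[P]_x (expR (r * Y x) * cos (r * X x) - expR (r * Y x) + (r * X x) ^+ 2 / 2).
  rewrite RintegralD//; last 2 first.
  - have := integrableB measurableT integrable_tilt_cos integrable_tilt.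
    by apply: eq_integrable => // x _ /=; rewrite EFinB.
  - have := integrableZl measurableT (r ^+ 2 / 2) integrable_XX.
    by apply: eq_integrable => // x _ /=; rewrite -EFinM exprMn mulrAC.
  rewrite RintegralB//; [|exact: integrable_tilt_cos|exact: integrable_tilt].
  congr (_ + _); under [RHS]eq_Rintegral do rewrite exprMn mulrAC.
  by rewrite RintegralZl//; [rewrite mulrAC|exact: integrable_XX].
apply: normr_expectation_envelope => //.
- by rewrite mulr_ge0// exprn_ge0.
- apply: measurable_funD; last first.
    by apply: measurable_funM => //; apply: measurable_funX; exact: measurable_funM.
  by apply: measurable_funB => //; exact: measurable_funM.
by move=> x; exact: tilt_cos_le.
Qed.

Lemma tilt_sin_expectation :
  `|\int[P]_x (expR (r * Y x) * sin (r * X x))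
     - r ^+ 2 * (\int[P]_x (X x * Y x))| <= 54 * r ^+ 3 * C.
Proof.
have irX : integ (fun x => r * X x).
  have := integrableZl measurableT r integrable_X.
  by apply: eq_integrable => // x _ /=; rewrite EFinM.
have -> : \int[P]_x (expR (r * Y x) * sin (r * X x))
     - r ^+ 2 * (\int[P]_x (X x * Y x)) =
   \int[P]_x (expR (r * Y x) * sin (r * X x) - r * X x - (r * X x) * (r * Y x)).
  rewrite RintegralB//; last 2 first.
  - have := integrableB measurableT integrable_tilt_sin irX.
    by apply: eq_integrable => // x _ /=; rewrite EFinB.
  - have := integrableZl measurableT (r ^+ 2) integrable_XY.
    by apply: eq_integrable => // x _ /=; rewrite -EFinM; congr (_%:E); ring.
  rewrite RintegralB//; [|exact: integrable_tilt_sin].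
  rewrite (RintegralZl _ _ integrable_X)// X0 mulr0 subr0.
  congr (_ - _).
  under [RHS]eq_Rintegral do rewrite mulrACA -expr2.
  by rewrite RintegralZl//; exact: integrable_XY.
apply: normr_expectation_envelope => //.
- by rewrite mulr_ge0// exprn_ge0.
- apply: measurable_funB; last by apply: measurable_funM; exact: measurable_funM.
  by apply: measurable_funB; exact: measurable_funM.
by move=> x; exact: tilt_sin_le.
Qed.

End one_step.

(** * Induction over the coordinates *)

Section Rintegral_iprod.
Context d (T : measurableType d) (R : realType) (P : probability T R).

(** Fubini for signed [f]. Integrability is asked of every section, not of almost every one, so that
    the real-valued inner integral is faithful at each point. *)
Lemma Rintegral_iprodS n (f : n.+1.-tuple T -> R) :
  (iprod P n.+1).-integrable [set: _] (EFin \o f) ->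
  (forall x, (iprod P n).-integrable [set: _] (EFin \o (fun t => f (tcons (x, t))))) ->
  P.-integrable [set: T] (EFin \o (fun x => \int[iprod P n]_t f (tcons (x, t)))) /\
  \int[iprod P n.+1]_w f w = \int[P]_x \int[iprod P n]_t f (tcons (x, t)).
Proof.
move=> ff fx.
have mtc : measurable_fun [set: T * n.-tuple T] (@tcons _ T n).
  exact: measurable_tcons.
have ip : (P \x iprod P n)%E.-integrable [set: _] (EFin \o f \o @tcons _ T n).
  have mf : measurable_fun [set: _] (EFin \o f) by case/integrableP : ff.
  apply/integrableP; split; first exact: measurableT_comp.
  rewrite -(@ge0_integral_distribution _ _ _ _ _ (P \x iprod P n)%E (@tcons _ T n)
    (fun w => `|(f w)%:E|%E))//; first by case/integrableP : ff.
  by apply: measurableT_comp => //.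
have eF : EFin \o (fun x => \int[iprod P n]_t f (tcons (x, t))) =
    fubini_F (iprod P n) (EFin \o f \o @tcons _ T n).
  by apply/funext => x; rewrite /= /fubini_F EFin_Rintegral.
split; first by rewrite eF; exact: integrable_fubini_F.
rewrite [LHS]/Rintegral [RHS]/Rintegral; congr fine.
have -> : (\int[iprod P n.+1]_x (f x)%:E =
    \int[distribution (P \x iprod P n) (@tcons _ T n)]_x (f x)%:E)%E by [].
rewrite integral_distribution//; last by apply/measurable_EFinP; case/integrableP : ff => /measurable_EFinP.
rewrite -integral12_prod_meas1//; apply: eq_integral => x _.
by rewrite /fubini_F EFin_Rintegral.
Qed.

Lemma integrable_iprod_prod n (f : T -> R) :
  measurable_fun [set: T] f -> (forall x, 0 <= f x) ->
  P.-integrable [set: T] (EFin \o f) ->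
  (iprod P n).-integrable [set: _] (EFin \o (fun w => \prod_(i < n) f (tnth w i))) /\
  \int[iprod P n]_w \prod_(i < n) f (tnth w i) = (\int[P]_x f x) ^+ n.
Proof.
move=> mf f0 intf.
have e : (\int[iprod P n]_w (\prod_(i < n) f (tnth w i))%:E =
    ((\int[P]_x f x) ^+ n)%:E)%E.
  rewrite (integral_iprod_prod P (f := fun=> f))// -EFin_Rintegral//.
  by rewrite prodEFin big_const card_ord iter_mulr_1.
have mprod : measurable_fun [set: n.-tuple T] (fun w => \prod_(i < n) f (tnth w i)).
  apply: measurable_prod => i _.
  by apply: measurableT_comp => //; exact: measurable_tnth.
split; last by rewrite /Rintegral e.
apply: (integrable_le_cst (c := (\int[P]_x f x) ^+ n)) => //; last by rewrite e.
by move=> w; rewrite prodr_ge0.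
Qed.

End Rintegral_iprod.

(** The term 2 Q comes from the two expansion errors, 2 Q^2 (1 + Q) from exponentiating the
    quadratic term and from cos b against 1, and 4 Q^2 from B against 1 and from the sine part. *)
Definition char_step_cst (R : realType) (Q : R) :=
  2 * Q + 2 * Q ^+ 2 * (1 + Q) + 4 * Q ^+ 2.

(** Real form of one factor of a characteristic function: [p] and [s] stand for the tilted means of
    cos(r X) and sin(r X). Up to r^3, one coordinate multiplies by the mass B, damps by exp(- r^2
    sigma / 2) and turns the phase by r^2 tau. *)
Lemma char_step_le (R : realType) (B p s r Q sigma tau c : R) :
  0 <= r -> r <= 1 -> 1 <= B -> B <= 1 + Q * r ^+ 2 ->
  0 <= sigma -> sigma <= Q -> `|tau| <= Q ->
  `|p - B + r ^+ 2 * sigma / 2| <= Q * r ^+ 3 ->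
  `|s - r ^+ 2 * tau| <= Q * r ^+ 3 ->
  `|cos c * p - sin c * s
    - B * expR (- (r ^+ 2 * sigma / 2)) * cos (c + r ^+ 2 * tau)|
  <= char_step_cst Q * r ^+ 3.
Proof.
move=> r0 r1 B1 BQ s0 sQ tQ hp hs.
set y := r ^+ 2 * sigma / 2; set b := r ^+ 2 * tau; set e := expR (- y).
have Q0 : 0 <= Q by exact: le_trans sQ.
have rr : 0 <= r ^+ 2 by exact: sqr_ge0.
have rr1 : r ^+ 2 <= 1 by rewrite expr_le1.
have y0 : 0 <= y by rewrite /y !mulr_ge0.
have yQ : y <= Q * r ^+ 2.
  have : r ^+ 2 * sigma <= r ^+ 2 * Q by rewrite ler_wpM2l.
  by rewrite /y; have := mulr_ge0 rr s0; lra.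
have bQ : `|b| <= Q * r ^+ 2.
  by rewrite /b normrM (ger0_norm rr) mulrC ler_wpM2r.
have e0 : 0 <= e by exact: expR_ge0.
have e1 : e <= 1 by rewrite expR_le1 oppr_le0.
have ely : 1 - y <= e by exact: expR_ge1Dx.
(* From e (1 + y) <= 1 and (1 - y + y^2) (1 + y) = 1 + y^3. *)
have euy : e <= 1 - y + y ^+ 2.
  have y1 : 0 < 1 + y by lra.
  have h : e * (1 + y) <= 1.
    by rewrite /e expRN mulrC ler_pdivrMr ?expR_gt0// mul1r expR_ge1Dx.
  rewrite -(ler_pM2r y1) (le_trans h)//.
  rewrite (_ : _ * _ = 1 + y ^+ 3); last by ring.
  by rewrite lerDl exprn_ge0.
have r4 : r ^+ 4 <= r ^+ 3 by rewrite [leLHS]exprS ler_piMl ?exprn_ge0.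
have y2 : y ^+ 2 <= Q ^+ 2 * r ^+ 4.
  rewrite (_ : Q ^+ 2 * _ = (Q * r ^+ 2) ^+ 2); last by ring.
  by rewrite lerXn2r ?nnegrE// mulr_ge0.
have b2 : `|b| ^+ 2 <= Q ^+ 2 * r ^+ 4.
  rewrite (_ : Q ^+ 2 * _ = (Q * r ^+ 2) ^+ 2); last by ring.
  by rewrite lerXn2r ?nnegrE// mulr_ge0.
have Q2r4 : Q ^+ 2 * r ^+ 4 <= Q ^+ 2 * r ^+ 3 by rewrite ler_wpM2l// sqr_ge0.
have Q2r3 : 0 <= Q ^+ 2 * r ^+ 3 by rewrite mulr_ge0 ?sqr_ge0 ?exprn_ge0.
have B0 : 0 <= B by lra.
have B1Q : B <= 1 + Q by rewrite (le_trans BQ)// lerD2l ler_piMr.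
have hP : `|p - B * e * cos b| <= Q * r ^+ 3 + 2 * Q ^+ 2 * (1 + Q) * r ^+ 3
    + Q ^+ 2 * r ^+ 3.
  rewrite (_ : p - _ = (p - B + y) - (B * ((e - 1 + y) + e * (cos b - 1))
      - (B - 1) * y)); last by ring.
  rewrite (le_trans (ler_normB _ _))// -[leRHS]addrA lerD//.
  rewrite (le_trans (ler_normB _ _))// lerD//.
    rewrite normrM (ger0_norm B0).
    have hh : `|e - 1 + y + e * (cos b - 1)| <= 2 * (Q ^+ 2 * r ^+ 3).
      rewrite (le_trans (ler_normD _ _))// normrM (ger0_norm e0).
      have : `|e - 1 + y| <= y ^+ 2 by rewrite ler_norml; apply/andP; split; lra.
      have : e * `|cos b - 1| <= `|b| ^+ 2.
        by rewrite -[leRHS]mul1r ler_pM// cos_sub1_le2.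
      lra.
    rewrite (_ : 2 * _ * _ * _ = (1 + Q) * (2 * (Q ^+ 2 * r ^+ 3))); last by ring.
    by rewrite ler_pM.
  rewrite normrM !ger0_norm//; last by lra.
  rewrite (@le_trans _ _ (Q * r ^+ 2 * (Q * r ^+ 2)))//.
    by rewrite ler_pM//; lra.
  by rewrite (_ : _ * _ = Q ^+ 2 * r ^+ 4)//; ring.
have hS : `|s - B * e * sin b| <= Q * r ^+ 3 + 3 * (Q ^+ 2 * r ^+ 3).
  rewrite (_ : s - _ = (s - b) - ((sin b - b) + (B * e - 1) * sin b)); last by ring.
  rewrite (le_trans (ler_normB _ _))// lerD//.
  rewrite (le_trans (ler_normD _ _))//.
  have : `|sin b - b| <= `|b| ^+ 2 by exact: sin_sub_le2.
  have : `|(B * e - 1) * sin b| <= (2 * (Q * r ^+ 2)) * (Q * r ^+ 2).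
    rewrite normrM ler_pM//; last by rewrite (le_trans (normr_sin_le _)).
    have : 0 <= (B - 1) * e by rewrite mulr_ge0//; lra.
    have : (B - 1) * e <= (B - 1) * 1 by rewrite ler_wpM2l//; lra.
    by move=> h1 h2; rewrite ler_norml; apply/andP; split; lra.
  rewrite (_ : 2 * _ * _ = 2 * (Q ^+ 2 * r ^+ 4)); last by ring.
  lra.
rewrite cosD (_ : _ - _ - _ = cos c * (p - B * e * cos b)
   - sin c * (s - B * e * sin b)); last by ring.
rewrite (le_trans (ler_normB _ _))// !normrM.
have h1 : `|cos c| * `|p - B * e * cos b| <= 1 * `|p - B * e * cos b|.
  by rewrite ler_wpM2r// cos_max.
have h2 : `|sin c| * `|s - B * e * sin b| <= 1 * `|s - B * e * sin b|.
  by rewrite ler_wpM2r// sin_max.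
by rewrite /char_step_cst; lra.
Qed.

Section tilted_char.
Context d (T : measurableType d) (R : realType) (P : probability T R).
Variables (X Y a : T -> R) (C r : R).
Hypotheses (mX : measurable_fun [set: T] X) (mY : measurable_fun [set: T] Y).
Hypotheses (ma : measurable_fun [set: T] a).
Hypotheses (Xa : forall x, `|X x| <= a x) (Ya : forall x, `|Y x| <= a x).
Hypothesis aC : (\int[P]_x (expR (2 * a x))%:E <= C%:E)%E.
Hypotheses (X0 : \int[P]_x X x = 0) (Y0 : \int[P]_x Y x = 0).
Hypotheses (r0 : 0 <= r) (r1 : r <= 1).

Notation B := (\int[P]_x expR (r * Y x)).
Notation sigma := (\int[P]_x (X x ^+ 2)).
Notation tau := (\int[P]_x (X x * Y x)).

Let C0 : 0 <= C.
Proof. by rewrite -lee_fin (le_trans _ aC)// integral_ge0// => x _; rewrite lee_fin expR_ge0. Qed.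

Lemma one_step_char c :
  `|\int[P]_x (expR (r * Y x) * cos (r * X x + c))
    - B * expR (- (r ^+ 2 * sigma / 2)) * cos (c + r ^+ 2 * tau)|
  <= char_step_cst (54 * C) * r ^+ 3.
Proof.
have -> : \int[P]_x (expR (r * Y x) * cos (r * X x + c)) =
    cos c * (\int[P]_x (expR (r * Y x) * cos (r * X x))) -
    sin c * (\int[P]_x (expR (r * Y x) * sin (r * X x))).
  have ic := integrable_tilt_cos mX mY ma Xa Ya aC r0 r1.
  have is_ := integrable_tilt_sin mX mY ma Xa Ya aC r0 r1.
  rewrite -RintegralZl// -RintegralZl// -RintegralB//.
  - by apply: eq_Rintegral => x _; rewrite cosD; ring.
  - have := integrableZl measurableT (cos c) ic.
    by apply: eq_integrable => // x _ /=; rewrite EFinM.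
  - have := integrableZl measurableT (sin c) is_.
    by apply: eq_integrable => // x _ /=; rewrite EFinM.
have C4 : 4 * C <= 54 * C by rewrite ler_wpM2r// ler_nat.
apply: char_step_le => //.
- exact: tilt_mass_ge1 mY ma Xa Ya aC Y0 r0 r1.
- rewrite (le_trans (tilt_mass_le mY ma Xa Ya aC Y0 r0 r1))// lerD2l.
  by rewrite mulrAC ler_wpM2r// sqr_ge0.
- exact: expectation_XX_ge0.
- by rewrite (le_trans _ C4)//; exact: expectation_XX_le mX ma Xa aC.
- by rewrite (le_trans _ C4)//; exact: expectation_XY_le mX mY ma Xa Ya aC.
- rewrite [leRHS]mulrAC; exact: tilt_cos_expectation mX mY ma Xa Ya aC r0 r1.
- rewrite [leRHS]mulrAC; exact: tilt_sin_expectation mX mY ma Xa Ya aC X0 r0 r1.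
Qed.

Definition tsum n (f : T -> R) (w : n.-tuple T) : R := \sum_(i < n) f (tnth w i).

Lemma measurable_tsum n f : measurable_fun [set: T] f ->
  measurable_fun [set: _] (tsum (n := n) f).
Proof.
move=> mf; apply: measurable_sum => i.
by apply: measurableT_comp => //; exact: measurable_tnth.
Qed.

Lemma tsum_cons n f x (t : n.-tuple T) : tsum f (tcons (x, t)) = f x + tsum f t.
Proof.
rewrite /tsum big_ord_recl tnth0; congr (_ + _).
by apply: eq_bigr => i _; rewrite tnthS.
Qed.

Lemma expR_tsum n (w : n.-tuple T) f :
  expR (r * tsum f w) = \prod_(i < n) expR (r * f (tnth w i)).
Proof. by rewrite mulr_sumr expR_sum. Qed.

Lemma integrable_expR_tsum n :
  (iprod P n).-integrable [set: _] (EFin \o (fun w => expR (r * tsum Y w))) /\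
  \int[iprod P n]_w expR (r * tsum Y w) = B ^+ n.
Proof.
have mf : measurable_fun [set: T] (fun x => expR (r * Y x)).
  by apply: measurableT_comp => //; exact: measurable_funM.
have [i e] := integrable_iprod_prod n mf (fun x => expR_ge0 _)
  (integrable_tilt mY ma Xa Ya aC r0 r1).
split; last by rewrite -e; apply: eq_Rintegral => w _; rewrite expR_tsum.
by apply: eq_integrable i => // w _ /=; rewrite expR_tsum.
Qed.

Lemma measurable_tilted_cos n c : measurable_fun [set: n.-tuple T]
  (fun w => expR (r * tsum Y w) * cos (r * tsum X w + c)).
Proof.
apply: measurable_funM.
  by apply: measurableT_comp => //; apply: measurable_funM => //; exact: measurable_tsum.
apply: measurableT_comp.
  by apply: continuous_measurable_fun; exact: continuous_cos.
by apply: measurable_funD => //; apply: measurable_funM => //; exact: measurable_tsum.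
Qed.

Lemma integrable_tilted_cos n c : (iprod P n).-integrable [set: _]
  (EFin \o (fun w => expR (r * tsum Y w) * cos (r * tsum X w + c))).
Proof.
apply: integrable_dominated (integrable_expR_tsum n).1.
  exact: measurable_tilted_cos.
move=> w; rewrite normrM ger0_norm ?expR_ge0//.
by rewrite -[leRHS]mulr1 ler_wpM2l ?expR_ge0// cos_max.
Qed.

(** Induction on n with the phase [c] free: the first coordinate is absorbed in the phase of the
    other n, and the approximant is stable because each coordinate adds one factor and one rotation.
    Errors add up, each weighted by at most the total mass B^n. *)
Lemma tuple_char n c :
  `|\int[iprod P n]_w (expR (r * tsum Y w) * cos (r * tsum X w + c))
    - (B * expR (- (r ^+ 2 * sigma / 2))) ^+ n * cos (c + n%:R * (r ^+ 2 * tau))|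
  <= n%:R * (B ^+ n * (char_step_cst (54 * C) * r ^+ 3)).
Proof.
have B1 : 1 <= B := tilt_mass_ge1 mY ma Xa Ya aC Y0 r0 r1.
have B0 : 0 <= B by rewrite (le_trans _ B1).
have K0 : 0 <= char_step_cst (54 * C) * r ^+ 3.
  exact: le_trans (one_step_char 0).
set K := char_step_cst (54 * C) * r ^+ 3 in K0 *.
set al := expR _; have al0 : 0 <= al by exact: expR_ge0.
have al1 : al <= 1.
  rewrite expR_le1 oppr_le0 divr_ge0// mulr_ge0 ?sqr_ge0//.
  exact: expectation_XX_ge0.
set be := r ^+ 2 * tau.
elim: n c => [|n IH] c.
  rewrite mul0r expr0 mul1r mul0r addr0.
  rewrite (@eq_Rintegral _ _ _ _ _ (fun=> cos c)); last first.
    by move=> w _; rewrite /tsum !big_ord0 !mulr0 expR0 mul1r add0r.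
  by rewrite expectation_cst subrr normr0.
have [|ix ->] := Rintegral_iprodS (integrable_tilted_cos n.+1 c).
  move=> x; have := integrableZl measurableT (expR (r * Y x))
    (integrable_tilted_cos n (r * X x + c)).
  apply: eq_integrable => // w _ /=; rewrite !tsum_cons -EFinM !mulrDr expRD mulrA.
  by congr (_ * cos _)%:E; ring.
have inner x : \int[iprod P n]_t (expR (r * tsum Y (tcons (x, t))) *
      cos (r * tsum X (tcons (x, t)) + c)) =
    expR (r * Y x) * \int[iprod P n]_t (expR (r * tsum Y t) *
      cos (r * tsum X t + (r * X x + c))).
  rewrite -RintegralZl//; last exact: integrable_tilted_cos.
  apply: eq_Rintegral => w _; rewrite !tsum_cons !mulrDr expRD mulrA.
  by congr (_ * cos _); ring.
rewrite (@eq_Rintegral _ _ _ _ _ (fun x => expR (r * Y x) * \int[iprod P n]_t (expR (r * tsum Y t) *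
      cos (r * tsum X t + (r * X x + c)))))//.
have {}ix : P.-integrable [set: T] (EFin \o (fun x => expR (r * Y x) *
    \int[iprod P n]_t (expR (r * tsum Y t) * cos (r * tsum X t + (r * X x + c))))).
  by apply: eq_integrable ix => // x _ /=; rewrite inner.
pose g x := expR (r * Y x) * cos (r * X x + (c + n%:R * be)).
have mg : measurable_fun [set: T] g.
  apply: measurable_funM.
    by apply: measurableT_comp => //; exact: measurable_funM.
  apply: measurableT_comp.
    by apply: continuous_measurable_fun; exact: continuous_cos.
  by apply: measurable_funD => //; exact: measurable_funM.
have ie := integrable_tilt mY ma Xa Ya aC r0 r1.
have ig : P.-integrable [set: T] (EFin \o g).
  apply: (integrable_dominated mg _ ie) => x.
  rewrite normrM ger0_norm ?expR_ge0//.
  by rewrite -[leRHS]mulr1 ler_wpM2l ?expR_ge0// cos_max.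
have igB : P.-integrable [set: T] (EFin \o (fun x => (B * al) ^+ n * g x)).
  have := integrableZl measurableT ((B * al) ^+ n) ig.
  by apply: eq_integrable => // x _ /=; rewrite EFinM.
set V := \int[P]_x _.
(* Induction hypothesis at the random phase r X + c, averaged over the first coordinate with its
   tilt of mass [B]. *)
have h1 : `|V - (B * al) ^+ n * \int[P]_x g x| <= B * (n%:R * (B ^+ n * K)).
  rewrite -RintegralZl// -RintegralB//.
  rewrite -[leRHS]RintegralZr//.
  apply: le_normr_expectation.
  - apply: measurable_funB; last by apply: measurable_funM.
    by apply/measurable_EFinP; case/integrableP : ix.
  - move=> x; rewrite /g mulrCA -mulrBr normrM ger0_norm ?expR_ge0//.
    rewrite ler_wpM2l ?expR_ge0// addrA; exact: IH.
  - have := integrableZr measurableT (n%:R * (B ^+ n * K)) ie.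
    by apply: eq_integrable => // x _ /=; rewrite EFinM.
(* One-coordinate error at the phase already accumulated; al <= 1 <= B bounds its weight. *)
have h2 : `|(B * al) ^+ n * \int[P]_x g x -
    (B * al) ^+ n.+1 * cos (c + n.+1%:R * be)| <= B ^+ n.+1 * K.
  rewrite exprSr -mulrA -mulrBr normrM ger0_norm ?exprn_ge0 ?mulr_ge0//.
  rewrite ler_pM ?exprn_ge0 ?mulr_ge0//.
    rewrite (@le_trans _ _ (B ^+ n))//.
      by rewrite lerXn2r ?nnegrE ?mulr_ge0// ler_piMr.
    by rewrite exprSr ler_peMr ?exprn_ge0.
  have := one_step_char (c + n%:R * be).
  by rewrite -addrA -/be (_ : n%:R * be + be = n.+1%:R * be)// -[n.+1]addn1 natrD; ring.
rewrite -[n.+1%:R]/(n.+1)%:R (_ : V - _ = (V - (B * al) ^+ n * \int[P]_x g x) +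
  ((B * al) ^+ n * \int[P]_x g x - (B * al) ^+ n.+1 * cos (c + n.+1%:R * be))); last by ring.
rewrite (le_trans (ler_normD _ _))// (le_trans (lerD h1 h2))//.
by rewrite le_eqVlt; apply/orP; left; apply/eqP; rewrite exprS -[n.+1]addn1 natrD; ring.
Qed.

(* Bounding exp(r tsum Y) cos(r tsum X + c) one coordinate at a time keeps all
   constants explicit, so the limit is uniform over laws with common moments. *)
Lemma tilted_clt n c : (0 < n)%N -> r ^+ 2 = n%:R^-1 ->
  `|\int[iprod P n]_w (expR (r * tsum Y w) / B ^+ n * cos (r * tsum X w + c))
    - expR (- (sigma / 2)) * cos (c + tau)| <= char_step_cst (54 * C) * r.
Proof.
move=> n0 rn.
have B1 : 1 <= B := tilt_mass_ge1 mY ma Xa Ya aC Y0 r0 r1.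
have Bn0 : 0 < B ^+ n by rewrite exprn_gt0// (lt_le_trans _ B1).
have n0' : n%:R != 0 :> R by rewrite pnatr_eq0 -lt0n.
have -> : \int[iprod P n]_w (expR (r * tsum Y w) / B ^+ n * cos (r * tsum X w + c)) =
    (\int[iprod P n]_w (expR (r * tsum Y w) * cos (r * tsum X w + c))) / B ^+ n.
  rewrite -RintegralZr//; last exact: integrable_tilted_cos.
  by apply: eq_Rintegral => w _; rewrite mulrAC.
have := tuple_char n c.
rewrite exprMn -expRM_natl rn.
have -> : n%:R * - (n%:R^-1 * sigma / 2) = - (sigma / 2) by field.
have -> : n%:R * (n%:R^-1 * tau) = tau by field.
set V := (X in `|X - _|); set e := expR _ => h.
rewrite (_ : V / _ - _ = (V - B ^+ n * e * cos (c + tau)) / B ^+ n); last first.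
  by field; rewrite gt_eqF.
rewrite normrM normfV (ger0_norm (ltW Bn0)) ler_pdivrMr//.
rewrite (le_trans h)// le_eqVlt; apply/orP; left; apply/eqP.
rewrite (_ : r ^+ 3 = r * n%:R^-1); last by rewrite -rn; ring.
by field.
Qed.

End tilted_char.

(** * Characteristic functions of Gaussian laws *)

(** A quadratic remainder for small increments gives the derivative, so parameter integrals can be
    differentiated through estimates instead of under the integral sign. *)
Lemma is_derive_quadratic (R : realType) (f : R -> R) (x a K : R) :
  (forall u, `|u| <= 1 -> `|f (x + u) - f x - a * u| <= K * u ^+ 2) ->
  is_derive x 1 f a.
Proof.
move=> fK.
have K0 : 0 <= K.
  have : `|1 : R| <= 1 by rewrite normr1.
  by move=> /fK; rewrite expr1n [K * 1]mulr1 => /(le_trans (normr_ge0 _)).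
have cv : (fun h => h^-1 *: (f (h *: (1 : R) + x) - f x)) @ (0 : R)^' --> a.
  apply/cvgrPdist_le => e e0.
  have dl0 : 0 < Num.min 1 (e / (K + 1)).
    by rewrite lt_min ltr01/= divr_gt0// ltr_wpDl.
  near=> h.
  have h0 : h != 0 by near: h; exact: nbhs_dnbhs_neq.
  have hd : `|h| <= Num.min 1 (e / (K + 1)).
    by near: h; exact: dnbhs0_le.
  have hd1 : `|h| <= 1 by rewrite (le_trans hd)// ge_min lexx.
  have hd2 : `|h| <= e / (K + 1) by rewrite (le_trans hd)// ge_min lexx orbT.
  rewrite distrC (_ : _ - a = h^-1 * (f (x + h) - f x - a * h)); last first.
    by rewrite /GRing.scale/= mulr1 (addrC h) [RHS]mulrBr (mulrC a) mulKf.
  rewrite normrM normfV ler_pdivrMl ?normr_gt0//.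
  rewrite (le_trans (fK h hd1))// -real_normK ?num_real// expr2 mulrCA ler_wpM2l//.
  rewrite (@le_trans _ _ (K * (e / (K + 1))))// ?ler_wpM2l//.
  rewrite mulrCA ler_piMr ?(ltW e0)//.
  by rewrite ler_pdivrMr ?mul1r ?lerDl ?ltr_wpDl.
split; first by apply/cvg_ex; exists a.
exact: cvg_lim.
Unshelve. all: by end_near. Qed.

Section normal_char.
Context {R : realType}.
Implicit Types (m s t c h x : R) (f : R -> R).
Notation N m s := (normal_prob m s : probability (measurableTypeR R) R).
Notation N01 := (N (0 : R) 1).

Lemma integral_normal_prob m s f : measurable_fun [set: R] f ->
  (forall x, 0 <= f x) ->
  (\int[N m s]_x (f x)%:E = \int[lebesgue_measure]_x (f x * normal_pdf m s x)%:E)%E.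
Proof.
move=> mf f0.
rewrite (@integral_density _ _ _ lebesgue_measure _ (normal_pdf m s))//.
- exact: measurable_normal_pdf.
- by move=> x; exact: normal_pdf_ge0.
- exact/measurable_EFinP.
Qed.

Lemma integral_normal_prob_affine m s f : 0 < s -> continuous f ->
  (forall x, 0 <= f x) ->
  (\int[N m s]_x (f x)%:E = \int[N01]_x (f (s * x + m))%:E)%E.
Proof.
move=> s0 cf f0.
have s0' : s != 0 by rewrite gt_eqF.
pose F x := s * x + m.
have dF x : is_derive x 1 F s.
  by apply: is_derive_eq; rewrite /GRing.scale/= mulr1 addr0.
have F'E : derive1 F = cst s by apply/funext => x; rewrite derive1E derive_val.
have cF : continuous F.
  by move=> x; apply: cvgD; [apply: cvgM => //; exact: cvg_cst|exact: cvg_cst].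
have FE : F = (fun x => (x + m / s) * s).
  by apply/funext => x; rewrite /F; field.
have mfF : measurable_fun [set: R] (fun x => f (s * x + m)).
  apply: continuous_measurable_fun => x.
  by apply: continuous_comp; [exact: cF|exact: cf].
apply: (etrans (integral_normal_prob m s (continuous_measurable_fun cf) f0)).
apply/esym; apply: (etrans (integral_normal_prob 0 1 mfF (fun x => f0 _))).
apply/esym.
rewrite (@increasing_ge0_integration_by_substitutionT _ F
  (fun x => f x * normal_pdf m s x)).
- apply: eq_integral => x _; congr (_%:E).
  rewrite F'E !fctE/= -mulrA; congr (_ * _).
  rewrite !normal_pdfE// ?oner_eq0//.
  rewrite /normal_peak /normal_fun expr1n mul1r subr0 addrK.
  rewrite -[s ^+ 2 * pi *+ 2]mulrnAr sqrtrM ?sqr_ge0// sqrtr_sqr gtr0_norm// invfM.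
  rewrite mulrAC [s^-1 * _]mulrC mulfVK//; congr (_ * expR _).
  by field.
- by move=> x y xy; rewrite ltrD2r ltr_pM2l.
- by rewrite F'E => x; exact: cvg_cst.
- by rewrite F'E; exact: is_cvg_cst.
- by rewrite F'E; exact: is_cvg_cst.
- by move=> x; exact: ex_derive.
- by rewrite FE; apply/gt0_cvgMlNy; last exact: cvg_addrr_Ny.
- by rewrite FE; apply/gt0_cvgMly; last exact: cvg_addrr.
- move=> x; apply: cvgM; first exact: cf.
  exact: continuous_normal_pdf.
- by move=> x; rewrite mulr_ge0// normal_pdf_ge0.
Qed.

(** The Cameron-Martin formula in dimension one, by completing the square in the density. *)
Lemma integral_normal_shift h f : continuous f -> (forall x, 0 <= f x) ->
  (\int[N01]_x (f (x + h))%:E =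
   \int[N01]_x (f x * expR (h * x - h ^+ 2 / 2))%:E)%E.
Proof.
move=> cf f0.
have -> : (\int[N01]_x (f (x + h))%:E = \int[N h 1]_x (f x)%:E)%E.
  apply/esym; apply: (etrans (integral_normal_prob_affine h ltr01 cf f0)).
  by apply: eq_integral => x _; rewrite mul1r.
have mf : measurable_fun [set: R] f by exact: continuous_measurable_fun.
have mfe : measurable_fun [set: R] (fun x => f x * expR (h * x - h ^+ 2 / 2)).
  apply: measurable_funM => //; apply: measurableT_comp => //.
  by apply: measurable_funB => //; exact: measurable_funM.
have fe0 x : 0 <= f x * expR (h * x - h ^+ 2 / 2) by rewrite mulr_ge0 ?expR_ge0.
apply: (etrans (integral_normal_prob h 1 mf f0)).
apply/esym; apply: (etrans (integral_normal_prob 0 1 mfe fe0)); apply/esym.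
apply: eq_integral => x _; rewrite -mulrA; congr (_ * _)%:E.
rewrite !normal_pdfE ?oner_eq0//.
rewrite mulrCA; congr (_ * _); rewrite /normal_fun -expRD; congr expR.
by rewrite expr1n; field.
Qed.

Let integrable_expRM h :
  N01.-integrable [set: R] (EFin \o (fun x => expR (h * x))) .
Proof.
have me (k : R) : measurable_fun [set: R] (fun x => expR (h * x - k)).
  by apply: measurableT_comp => //; apply: measurable_funB => //; exact: measurable_funM.
have := integral_normal_shift h (@cst_continuous R R 1) (fun=> ler01).
rewrite integral_cst// mul1e => e.
have {e} : (\int[N01]_x (expR (h * x - h ^+ 2 / 2))%:E <= 1%:E)%E.
  under eq_integral do rewrite -[expR _]mul1r.
  rewrite -[leLHS]e; exact: probability_le1.
move=> /integrable_le_cst => /(_ (me _) (fun x => expR_ge0 _)) i.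
have := integrableZl measurableT (expR (h ^+ 2 / 2)) i.
apply: eq_integrable => // x _ /=; rewrite -EFinM -expRD.
by congr (expR _)%:E; ring.
Qed.

(** A majorant of e^(2 |x|) made of exponentials whose integrability is already known. *)
Let W x : R := expR (2 * x) + expR (- 2 * x).

Let expR_norm_le_W x : expR (2 * `|x|) <= W x.
Proof.
rewrite /W; have [x0|x0] := leP 0 x.
  by rewrite ger0_norm// lerDl expR_ge0.
by rewrite ltr0_norm// mulrN mulNr lerDr expR_ge0.
Qed.

Let integrable_W : N01.-integrable [set: R] (EFin \o W).
Proof.
have := integrableD measurableT (integrable_expRM 2) (integrable_expRM (- 2)).
by apply: eq_integrable => // x _ /=; rewrite EFinD.
Qed.

Let mcos t c : measurable_fun [set: R] (fun x => cos (t * x + c)).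
Proof.
apply: measurableT_comp; first by apply: continuous_measurable_fun; exact: continuous_cos.
by apply: measurable_funD => //; exact: measurable_funM.
Qed.

Let msin t c : measurable_fun [set: R] (fun x => sin (t * x + c)).
Proof.
apply: measurableT_comp; first by apply: continuous_measurable_fun; exact: continuous_sin.
by apply: measurable_funD => //; exact: measurable_funM.
Qed.

Let integrable_cos t c : N01.-integrable [set: R] (EFin \o (fun x => cos (t * x + c))).
Proof.
apply: (@integrable_dominated _ _ _ N01 _ (cst 1)) => //=.
- exact: mcos.
- by move=> x; exact: cos_max.
- exact: integrable_cst.
Qed.

Let integrable_sin t c : N01.-integrable [set: R] (EFin \o (fun x => sin (t * x + c))).
Proof.
apply: (@integrable_dominated _ _ _ N01 _ (cst 1)) => //=.
- exact: msin.
- by move=> x; exact: sin_max.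
- exact: integrable_cst.
Qed.

Let mexp u : measurable_fun [set: R] (fun x => expR (u * x)).
Proof. by apply: measurableT_comp => //; exact: measurable_funM. Qed.

Let integrable_cos_exp t c u : N01.-integrable [set: R]
  (EFin \o (fun x => cos (t * x + c) * expR (u * x))).
Proof.
apply: (@integrable_dominated _ _ _ N01 _ (fun x => expR (u * x))) => //.
  by apply: measurable_funM; [exact: mcos|exact: mexp].
move=> x; rewrite normrM (ger0_norm (expR_ge0 _)) ler_piMl ?expR_ge0//.
exact: cos_max.
Qed.

(** The shift formula is for nonnegative functions, so it is applied to 1 + cos; the share of the
    constant is given by the same formula for f = 1 and cancels. *)
Let shift_cos t c u : \int[N01]_x (cos (t * x + c) * expR (u * x)) =
  expR (u ^+ 2 / 2) * \int[N01]_x cos (t * x + (t * u + c)).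
Proof.
pose f x := 1 + cos (t * x + c).
have f0 x : 0 <= f x by have := cos_geN1 (t * x + c); rewrite /f; lra.
have cf : continuous f.
  move=> x; apply: cvgD; first exact: cvg_cst.
  apply: continuous_comp; last exact: continuous_cos.
  by apply: cvgD; [apply: cvgM => //; exact: cvg_cst|exact: cvg_cst].
have := integral_normal_shift u cf f0.
move=> /(congr1 fine); rewrite -![fine _]/(\int[_]_x _).
have -> : \int[N01]_x f (x + u) = 1 + \int[N01]_x cos (t * x + (t * u + c)).
  rewrite -[X in X + _](expectation_cst N01) -RintegralD//; last exact: integrable_cst.
  by apply: eq_Rintegral => x _; rewrite /f; congr (_ + cos _); ring.
have -> : \int[N01]_x (f x * expR (u * x - u ^+ 2 / 2)) = expR (- (u ^+ 2 / 2)) *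
    (\int[N01]_x expR (u * x) + \int[N01]_x (cos (t * x + c) * expR (u * x))).
  rewrite -RintegralD// -RintegralZl//; last first.
    have := integrableD measurableT (integrable_expRM u) (integrable_cos_exp t c u).
    by apply: eq_integrable => // x _ /=; rewrite EFinD.
  by apply: eq_Rintegral => x _; rewrite /f expRD; ring.
move=> E1.
have := integral_normal_shift u (@cst_continuous R R 1) (fun=> ler01).
move=> /(congr1 fine); rewrite -![fine _]/(\int[_]_x _) expectation_cst.
have -> : \int[N01]_x (1 * expR (u * x - u ^+ 2 / 2)) = expR (- (u ^+ 2 / 2)) *
    (\int[N01]_x expR (u * x)).
  rewrite -(RintegralZl _ measurableT (integrable_expRM u)).
  by apply: eq_Rintegral => x _; rewrite expRD; ring.
move=> E2; move: E1; rewrite mulrDr -E2 => /addrI ->; by rewrite mulrA -expRD subrr expR0 mul1r.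
Qed.

Let H c t := \int[N01]_x cos (t * x + c).
Let I c t := \int[N01]_x sin (t * x + c).

Let H1 c t : `|H c t| <= 1.
Proof.
rewrite -[leRHS](expectation_cst N01); apply: le_normr_expectation.
- exact: mcos.
- by move=> x; exact: cos_max.
- exact: integrable_cst.
Qed.

Let I1 c t : `|I c t| <= 1.
Proof.
rewrite -[leRHS](expectation_cst N01); apply: le_normr_expectation.
- exact: msin.
- by move=> x; exact: sin_max.
- exact: integrable_cst.
Qed.

Let shift_sin t c u : \int[N01]_x (sin (t * x + c) * expR (u * x)) =
  expR (u ^+ 2 / 2) * (cos (t * u) * I c t + sin (t * u) * H c t).
Proof.
under eq_Rintegral do rewrite -cosBpihalf -addrA.
rewrite shift_cos /I /H -(RintegralZl _ measurableT (integrable_sin t c)).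
rewrite -(RintegralZl _ measurableT (integrable_cos t c)).
rewrite -RintegralD//; last 2 first.
- have := integrableZl measurableT (cos (t * u)) (integrable_sin t c).
  by apply: eq_integrable => // x _ /=; rewrite EFinM.
- have := integrableZl measurableT (sin (t * u)) (integrable_cos t c).
  by apply: eq_integrable => // x _ /=; rewrite EFinM.
congr (_ * _); apply: eq_Rintegral => x _.
rewrite (_ : _ + _ = t * u + (t * x + c) - pi / 2); last by ring.
by rewrite cosBpihalf sinD addrC.
Qed.

(** To first order in u the two brackets are - u x sin(t x + c) and + u x sin(t x + c). They cancel,
    so the sum is quadratic in u, and the mean of the second bracket is explicit by [shift_sin]. *)
Let remainder (t c u x : R) : R := cos ((t + u) * x + c) - cos (t * x + c)
  + (sin (t * x + c) * expR (u * x) - sin (t * x + c)).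

Let remainder_le t c u x : `|u| <= 1 ->
  `|remainder t c u x| <= 12 * u ^+ 2 * W x.
Proof.
move=> u1; set y := t * x + c; set v := u * x.
have -> : remainder t c u x = cos y * (cos v - 1) - sin y * (sin v - v)
    + sin y * (expR v - 1 - v).
  rewrite /remainder -/y -/v.
  have -> : (t + u) * x + c = y + v by rewrite /y /v; ring.
  by rewrite cosD; ring.
have E0 : 1 <= expR `|v| by rewrite -expR0 ler_expR.
have v2 : 0 <= `|v| ^+ 2 by rewrite sqr_ge0.
have h1 : `|cos y * (cos v - 1)| <= `|v| ^+ 2.
  rewrite normrM -[leRHS]mul1r ler_pM//; first exact: cos_max.
  exact: cos_sub1_le2.
have h2 : `|sin y * (sin v - v)| <= `|v| ^+ 2.
  rewrite normrM -[leRHS]mul1r ler_pM//; first exact: sin_max.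
  exact: sin_sub_le2.
have h3 : `|sin y * (expR v - 1 - v)| <= `|v| ^+ 2 * expR `|v|.
  rewrite normrM -[leRHS]mul1r ler_pM//; first exact: sin_max.
  exact: expR_sub2_le.
have h4 : `|v| ^+ 2 <= `|v| ^+ 2 * expR `|v| by rewrite ler_peMr.
rewrite (@le_trans _ _ (3 * (`|v| ^+ 2 * expR `|v|)))//.
  rewrite (le_trans (ler_normD _ _))//.
  have := ler_normB (cos y * (cos v - 1)) (sin y * (sin v - v)); lra.
rewrite (_ : 12 * _ * _ = 3 * (u ^+ 2 * (4 * W x))); last by ring.
rewrite ler_wpM2l// normrM exprMn -mulrA real_normK ?num_real//.
rewrite ler_wpM2l ?sqr_ge0// (@le_trans _ _ (`|x| ^+ 2 * expR `|x|))//.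
  by rewrite ler_wpM2l ?sqr_ge0// ler_expR ler_piMl.
rewrite (@le_trans _ _ (4 * expR (2 * `|x|)))//; last by rewrite ler_wpM2l.
rewrite (_ : 2 * `|x| = `|x| + `|x|); last by ring.
rewrite expRD mulrA ler_wpM2r ?expR_ge0//.
by have := exprn_le_expR 1 (normr_ge0 x); rewrite -natrX.
Qed.

(** The mean of [remainder] is O(u^2). In the explicit mean of its second bracket, H carries the
    coefficient t u + O(u^2), while the sine integral [I] carries only O(u^2) and so leaves no trace
    in the derivative. *)
Let is_derive_H c t : is_derive t 1 (H c) (- (t * H c t)).
Proof.
pose e : R := expR 1.
have e0 : 0 <= e by exact: expR_ge0.
(* The three summands bound the mean of [remainder] and the coefficient errors [A1] and [A2] of I
   and H. *)
apply: (@is_derive_quadratic _ _ _ _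
  (12 * \int[N01]_x W x + (e * t ^+ 2 + e) + (e + t ^+ 2))) => u u1.
have mrem : measurable_fun [set: R] (remainder t c u).
  apply: measurable_funD; first by apply: measurable_funB; exact: mcos.
  by apply: measurable_funB; last exact: msin; apply: measurable_funM; [exact: msin|exact: mexp].
have hR : `|\int[N01]_x remainder t c u x| <= 12 * u ^+ 2 * \int[N01]_x W x.
  rewrite -RintegralZl//; apply: le_normr_expectation => //.
  - by move=> x; exact: remainder_le.
  - have := integrableZl measurableT (12 * u ^+ 2) integrable_W.
    by apply: eq_integrable => // x _ /=; rewrite EFinM.
have ie : N01.-integrable [set: R] (EFin \o (fun x => sin (t * x + c) * expR (u * x))).
  apply: (@integrable_dominated _ _ _ N01 _ (fun x => expR (u * x))) => //.
    by apply: measurable_funM; [exact: msin|exact: mexp].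
  move=> x; rewrite normrM (ger0_norm (expR_ge0 _)) ler_piMl ?expR_ge0//.
  exact: sin_max.
have eR : \int[N01]_x remainder t c u x = H c (t + u) - H c t
    + (expR (u ^+ 2 / 2) * (cos (t * u) * I c t + sin (t * u) * H c t) - I c t).
  rewrite -shift_sin /H /I.
  rewrite -(RintegralB measurableT (integrable_cos (t + u) c) (integrable_cos t c)).
  rewrite -(RintegralB measurableT ie (integrable_sin t c)) -RintegralD//.
  - have := integrableB measurableT (integrable_cos (t + u) c) (integrable_cos t c).
    by apply: eq_integrable => // x _ /=; rewrite EFinB.
  - have := integrableB measurableT ie (integrable_sin t c).
    by apply: eq_integrable => // x _ /=; rewrite EFinB.
have u2 : 0 <= u ^+ 2 by exact: sqr_ge0.
have u21 : u ^+ 2 <= 1 by rewrite -real_normK ?num_real// expr_le1.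
have Ee : expR (u ^+ 2 / 2) <= e by rewrite ler_expR; lra.
have E1 : `|expR (u ^+ 2 / 2) - 1| <= u ^+ 2 * e.
  rewrite (le_trans (expR_sub1_le _))// ger0_norm ?divr_ge0// ler_pM ?expR_ge0 ?divr_ge0//.
  by lra.
have tu : `|t * u| ^+ 2 = t ^+ 2 * u ^+ 2 by rewrite real_normK ?num_real// exprMn.
have A1 : `|expR (u ^+ 2 / 2) * cos (t * u) - 1| <= (e * t ^+ 2 + e) * u ^+ 2.
  rewrite (_ : _ - _ = expR (u ^+ 2 / 2) * (cos (t * u) - 1) + (expR (u ^+ 2 / 2) - 1)); last by ring.
  rewrite (le_trans (ler_normD _ _))// [leRHS]mulrDl lerD//; last by rewrite [leRHS]mulrC.
  rewrite normrM (ger0_norm (expR_ge0 _)) -mulrA ler_pM ?expR_ge0// -tu.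
  exact: cos_sub1_le2.
have A2 : `|expR (u ^+ 2 / 2) * sin (t * u) - t * u| <= (e + t ^+ 2) * u ^+ 2.
  rewrite (_ : _ - _ = (expR (u ^+ 2 / 2) - 1) * sin (t * u) + (sin (t * u) - t * u)); last by ring.
  rewrite (le_trans (ler_normD _ _))// [leRHS]mulrDl lerD//; last by rewrite -tu sin_sub_le2.
  rewrite normrM [leLHS]mulrC -[leRHS]mul1r ler_pM//; first exact: sin_max.
  by rewrite [leRHS]mulrC.
rewrite (_ : H c (t + u) - H c t - _ = \int[N01]_x remainder t c u x
  - (expR (u ^+ 2 / 2) * cos (t * u) - 1) * I c t
  - (expR (u ^+ 2 / 2) * sin (t * u) - t * u) * H c t); last by rewrite eR; ring.
rewrite (le_trans (ler_normB _ _))// [leRHS]mulrDl lerD//.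
  rewrite (le_trans (ler_normB _ _))// [leRHS]mulrDl lerD//.
    by rewrite [leRHS]mulrAC.
  by rewrite normrM -[leRHS]mulr1 ler_pM.
by rewrite normrM -[leRHS]mulr1 ler_pM.
Qed.

(* Comparing the shifts of the Gaussian along the real axis gives the equation
   H' = - t H for H(t) = E cos(t x + c) without complex integration. *)
Lemma standard_normal_char c t :
  \int[N01]_x cos (t * x + c) = expR (- (t ^+ 2 / 2)) * cos c.
Proof.
pose f t := expR (t ^+ 2 / 2) * H c t.
have df x : is_derive x 1 f 0.
  have := is_derive_H c x => dH.
  have dE : is_derive x 1 (fun t => expR (t ^+ 2 / 2)) (x * expR (x ^+ 2 / 2)).
    by apply: is_derive_eq; rewrite /GRing.scale/=; field.
  by apply: is_derive_eq; rewrite /GRing.scale/=; ring.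
have := is_derive_0_is_cst t 0 df; rewrite /f expr0n/= mul0r expR0 mul1r.
have -> : H c 0 = cos c.
  by rewrite /H; under eq_Rintegral do rewrite mul0r add0r; rewrite expectation_cst.
by move=> <-; rewrite mulrA -expRD addNr expR0 mul1r.
Qed.

Let expectation_1Dcos (Q : probability (measurableTypeR R) R) c :
  \int[Q]_x (1 + cos (x + c)) = 1 + \int[Q]_x cos (x + c).
Proof.
have mc : measurable_fun [set: R] (fun x : R => cos (x + c)).
  by under eq_fun do rewrite -[X in cos (X + _)]mul1r; exact: mcos.
have ic : Q.-integrable [set: R] (EFin \o (fun x => cos (x + c))).
  apply: (@integrable_dominated _ _ _ Q _ (cst 1)).
  - exact: mc.
  - by move=> x; exact: cos_max.
  - exact: integrable_cst.
apply: (etrans (RintegralD measurableT (integrable_cst Q 1) ic)).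
by congr (_ + _); exact: expectation_cst.
Qed.

Lemma normal_char m s c : 0 < s ->
  \int[N m s]_x cos (x + c) = expR (- (s ^+ 2 / 2)) * cos (c + m).
Proof.
move=> s0; pose f (x : R) := 1 + cos (x + c).
have f0 x : 0 <= f x by have := cos_geN1 (x + c); rewrite /f; lra.
have cf : continuous f.
  move=> x; apply: cvgD; first exact: cvg_cst.
  apply: continuous_comp; last exact: continuous_cos.
  by apply: cvgD; [exact: cvg_id|exact: cvg_cst].
have E : \int[N m s]_x f x = \int[N01]_x f (s * x + m).
  exact: (congr1 fine (integral_normal_prob_affine m s0 cf f0)).
have E1 : \int[N m s]_x f x = 1 + \int[N m s]_x cos (x + c).
  exact: expectation_1Dcos.
have E2 : \int[N01]_x f (s * x + m) = 1 + \int[N01]_x cos (s * x + (m + c)).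
  have -> : (fun x => f (s * x + m)) = (fun x => 1 + cos (s * x + (m + c))).
    by apply/funext => x; rewrite /f addrA.
  apply: (etrans (RintegralD measurableT (integrable_cst N01 1) (integrable_cos s (m + c)))).
  by congr (_ + _); exact: expectation_cst.
have /addrI -> := etrans (esym E1) (etrans E E2).
by rewrite standard_normal_char (addrC m).
Qed.

End normal_char.

(** * Linear forms and trigonometric polynomials on R^m *)

Section dotv_theory.
Context {R : realType} {m : nat}.
Implicit Types u v w : 'rV[R]_m.

Lemma dotvE u v : dotv u v = (u *m v^T) ord0 ord0.
Proof. by rewrite mxE; apply: eq_bigr => i _; rewrite mxE. Qed.

Lemma dotvDl u v w : dotv (u + v) w = dotv u w + dotv v w.
Proof. by rewrite !dotvE mulmxDl mxE. Qed.

Lemma dotvBl u v w : dotv (u - v) w = dotv u w - dotv v w.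
Proof. by rewrite !dotvE mulmxBl !mxE. Qed.

Lemma dot0v w : dotv 0 w = 0.
Proof. by rewrite dotvE mul0mx mxE. Qed.

(** This norm is the envelope of the score: a multiple of it dominates all linear forms with bounded
    coefficients, and its exponential is bounded by finitely many exponentials of linear forms. *)
Definition l1norm u : R := \sum_(i < m) `|u ord0 i|.

Lemma l1norm_ge0 u : 0 <= l1norm u.
Proof. by apply: sumr_ge0. Qed.

Lemma normr_dotv_le u v D : (forall i, `|u ord0 i| <= D) ->
  `|dotv u v| <= D * l1norm v.
Proof.
move=> uD; rewrite (le_trans (ler_norm_sum _ _ _))// mulr_sumr ler_sum// => i _.
by rewrite normrM ler_wpM2r.
Qed.

End dotv_theory.

Section trigonometric_polynomials.
Context {R : realType} {m : nat}.

Inductive trig : ('rV[R]_m -> R) -> Prop :=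
| trig_cos a u c : trig (fun z => a * cos (dotv u z + c))
| trig_add f g : trig f -> trig g -> trig (fun z => f z + g z).

Lemma trig_cst a : trig (fun=> a).
Proof.
have := trig_cos a 0 0; congr trig; apply/funext => z.
by rewrite dot0v addr0 cos0 mulr1.
Qed.

Lemma trig_scale a f : trig f -> trig (fun z => a * f z).
Proof.
elim=> [b u c|{}f g _ IHf _ IHg].
  by under eq_fun do rewrite mulrA; exact: trig_cos.
by under eq_fun do rewrite mulrDr; exact: trig_add.
Qed.

(** Product-to-sum formula for two cosines. *)
Lemma trig_mul f g : trig f -> trig g -> trig (fun z => f z * g z).
Proof.
move=> + tg; elim=> [a u c|{}f f' _ IHf _ IHf']; last first.
  by under eq_fun do rewrite mulrDl; exact: trig_add.
elim: tg => [b v e|{}g g' _ IHg _ IHg']; last first.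
  by under eq_fun do rewrite mulrDr; exact: trig_add.
have := trig_add (trig_cos (a * b / 2) (u + v) (c + e))
                 (trig_cos (a * b / 2) (u - v) (c - e)).
congr trig; apply/funext => z; rewrite dotvDl dotvBl.
rewrite (_ : dotv u z + _ + _ = (dotv u z + c) + (dotv v z + e)); last by ring.
rewrite (_ : dotv u z - _ + _ = (dotv u z + c) - (dotv v z + e)); last by ring.
by move: (_ + c) (_ + e) => A B; rewrite cosB cosD; field.
Qed.

Lemma trig_prod I (s : seq I) (F : I -> 'rV[R]_m -> R) :
  (forall i, trig (F i)) -> trig (fun z => \prod_(i <- s) F i z).
Proof.
move=> tF; elim: s => [|i s IH].
  by under eq_fun do rewrite big_nil; exact: trig_cst.
by under eq_fun do rewrite big_cons; exact: trig_mul.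
Qed.

Lemma trig_bounded f : trig f -> exists2 M, 0 <= M & forall z, `|f z| <= M.
Proof.
elim=> [a u c|{}f g _ [M M0 fM] _ [N N0 gN]].
  exists `|a| => // z; rewrite normrM ler_piMr//; exact: cos_max.
exists (M + N); first exact: addr_ge0.
by move=> z; rewrite (le_trans (ler_normD _ _))// lerD.
Qed.

Lemma measurable_dotv d (X : measurableType d) (Z : X -> 'rV[R]_m) u :
  (forall i, measurable_fun [set: X] (fun x => Z x ord0 i)) ->
  measurable_fun [set: X] (fun x => dotv u (Z x)).
Proof. by move=> mZ; apply: measurable_sum => i; exact: measurable_funM. Qed.

Lemma measurable_trig d (X : measurableType d) (Z : X -> 'rV[R]_m) f :
  (forall i, measurable_fun [set: X] (fun x => Z x ord0 i)) -> trig f ->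
  measurable_fun [set: X] (fun x => f (Z x)).
Proof.
move=> mZ; elim=> [a u c|{}f g _ IHf _ IHg]; last exact: measurable_funD.
apply: measurable_funM => //; apply: measurableT_comp.
  by apply: continuous_measurable_fun; exact: continuous_cos.
by apply: measurable_funD => //; exact: measurable_dotv.
Qed.

Lemma measurable_l1norm d (X : measurableType d) (Z : X -> 'rV[R]_m) :
  (forall i, measurable_fun [set: X] (fun x => Z x ord0 i)) ->
  measurable_fun [set: X] (fun x => l1norm (Z x)).
Proof. by move=> mZ; apply: measurable_sum => i; exact: measurableT_comp. Qed.

End trigonometric_polynomials.

Section gaussian_char.
Context {R : realType} {m : nat}.

Definition mxact (J : 'M[R]_m) (x : m.-tuple R) : 'rV[R]_m :=
  \row_i \sum_j J i j * tnth x j.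

Lemma dotv_mxact (J : 'M[R]_m) u x : dotv u (mxact J x) = linform (u *m J) x.
Proof.
rewrite /dotv /linform; under eq_bigr do rewrite mxE mulr_sumr.
rewrite exchange_big/=; apply: eq_bigr => j _; rewrite mxE mulr_suml.
by apply: eq_bigr => i _; rewrite mulrA.
Qed.

Lemma measurable_linform (t : 'rV[R]_m) :
  measurable_fun [set: m.-tuple R] (linform t).
Proof.
apply: measurable_sum => i; apply: measurable_funM => //.
exact: measurable_tnth.
Qed.

Let lin (t : 'rV[R]_m) : m.-tuple R -> measurableTypeR R := linform t.

Let measurable_lin t : measurable_fun [set: m.-tuple R] (lin t).
Proof. exact: measurable_linform. Qed.

HB.instance Definition _ (t : 'rV[R]_m) :=
  isMeasurableFun.Build _ _ _ _ (lin t) (measurable_lin t).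

Lemma measurable_mxact (J : 'M[R]_m) i :
  measurable_fun [set: m.-tuple R] (fun x => mxact J x ord0 i).
Proof.
under eq_fun do rewrite mxE.
by apply: measurable_sum => j; apply: measurable_funM => //; exact: measurable_tnth.
Qed.

(** [is_gaussian] prescribes the law of every linear form, so this is the one-dimensional formula
    for an image measure. Variance zero gives a Dirac mass and is treated apart. *)
Lemma gaussian_char (nu : probability (m.-tuple R) R) mu (Sigma : 'M[R]_m)
    (t : 'rV[R]_m) (c : R) :
  is_gaussian nu mu Sigma -> 0 <= (t *m Sigma *m t^T) ord0 ord0 ->
  \int[nu]_x cos (linform t x + c) =
  expR (- ((t *m Sigma *m t^T) ord0 ord0 / 2)) * cos (c + dotv t mu).
Proof.
move=> /(_ t)/=; set v := (_ *m _) _ _; set a := dotv t mu => nuE v0.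
have mg : measurable_fun [set: measurableTypeR R] (fun y : R => cos (y + c)).
  apply: measurableT_comp; last exact: measurable_funD.
  by apply: continuous_measurable_fun; exact: continuous_cos.
have -> : \int[nu]_x cos (linform t x + c) =
    \int[distribution nu (lin t)]_y cos (y + c).
  rewrite /Rintegral integral_distribution//; first exact/measurable_EFinP.
  apply: (@integrable_dominated _ _ _ nu _ (cst 1)) => //=.
  - by apply: (measurableT_comp mg); exact: measurable_linform.
  - by move=> x; exact: cos_max.
  - exact: integrable_cst.
have [v00|vN0] := eqVneq v 0.
  rewrite v00 mul0r oppr0 expR0 mul1r addrC.
  have -> : \int[distribution nu (lin t)]_y cos (y + c) =
      \int[@dirac _ (measurableTypeR R) a R]_y cos (y + c).
    congr fine; apply: eq_measure_integral => A mA _.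
    by have := nuE A mA; rewrite v00 eqxx.
  rewrite /Rintegral integral_dirac//=; last exact/measurable_EFinP.
  by rewrite indicT mul1r.
have s0 : 0 < Num.sqrt v by rewrite sqrtr_gt0 lt_neqAle eq_sym vN0.
have := normal_char a c s0; rewrite sqr_sqrtr// => <-.
congr fine; apply: eq_measure_integral => A mA _.
by have := nuE A mA; rewrite (negbTE vN0).
Qed.

End gaussian_char.

(** * Local asymptotics of the score *)

Section score.
Context d (T : measurableType d) (R : realType) (m : nat).
Implicit Types (P : probability T R) (l : T -> 'rV[R]_m) (h u : 'rV[R]_m).

(** The Fisher matrix of a single law: [fisher P l theta] is convertible to
    [info (P theta) (l theta)]. *)
Definition info P l : 'M[R]_m :=
  \matrix_(i, j) \int[P]_x (l x ord0 i * l x ord0 j).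

(** All that the limit theorem uses about a law and its score. The function [M] is shared by the
    whole class, so estimates stated in terms of [M] are uniform over it. *)
Definition score_class (M : R -> R) P l :=
  [/\ forall i, measurable_fun [set: T] (fun x => l x ord0 i),
      forall i, \int[P]_x l x ord0 i = 0 &
      forall B, 0 <= B ->
        (\int[P]_x (expR (B * l1norm (l x)))%:E <= (M B)%:E)%E].

Definition Delta r n l (w : n.-tuple T) : 'rV[R]_m :=
  \row_i (r * tsum (fun x => l x ord0 i) w).

Definition tilt r n P l h (w : n.-tuple T) : R :=
  expR (r * tsum (fun x => dotv h (l x)) w) /
  (\int[P]_x expR (r * dotv h (l x))) ^+ n.

(** Written so that [rate R n *: h] is convertible to the parameter shift in the theorem. *)
Definition rate n : R := (Num.sqrt n%:R)^-1.

Lemma rate_ge0 n : 0 <= rate n.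
Proof. by rewrite invr_ge0 sqrtr_ge0. Qed.

Lemma rate_sqr n : rate n ^+ 2 = n%:R^-1.
Proof. by rewrite exprVn sqr_sqrtr. Qed.

Lemma rate_le1 n : (0 < n)%N -> rate n <= 1.
Proof.
move=> n0; rewrite invf_le1 ?sqrtr_gt0 ?ltr0n//.
by rewrite -[leLHS]sqrtr1 ler_sqrt ?ler0n// ler1n.
Qed.

Lemma rate_cvg0 : rate n @[n --> \oo] --> 0.
Proof.
apply/cvgrPdist_le => e e0.
near=> n; rewrite sub0r normrN ger0_norm ?rate_ge0//.
have n0 : (0 < n)%N by near: n; exists 1%N.
rewrite -(@ler_pXn2r _ 2) ?nnegrE ?rate_ge0 ?(ltW e0)// rate_sqr.
rewrite -[leRHS]invrK lef_pV2 ?posrE ?ltr0n ?invr_gt0 ?exprn_gt0//.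
by near: n; exact: nbhs_infty_ger.
Unshelve. all: by end_near. Qed.

Lemma dotv_Delta r n l h (w : n.-tuple T) :
  dotv h (Delta r l w) = r * tsum (fun x => dotv h (l x)) w.
Proof.
rewrite /dotv /tsum; under eq_bigr do rewrite mxE mulrCA /tsum mulr_sumr.
by rewrite -mulr_sumr exchange_big.
Qed.

Section one_score.
Variables (P : probability T R) (l : T -> 'rV[R]_m) (M : R -> R).
Hypothesis lP : score_class M P l.

Let ml i : measurable_fun [set: T] (fun x => l x ord0 i).
Proof. by case: lP => /(_ i). Qed.

Lemma measurable_dotv_score u : measurable_fun [set: T] (fun x => dotv u (l x)).
Proof. exact: measurable_dotv. Qed.

Lemma measurable_envelope D : measurable_fun [set: T] (fun x => D * l1norm (l x)).
Proof. by apply: measurable_funM => //; exact: measurable_l1norm. Qed.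

Lemma envelope_le D : 0 <= D ->
  (\int[P]_x (expR (2 * (D * l1norm (l x))))%:E <= (M (2 * D))%:E)%E.
Proof.
move=> D0; case: lP => _ _ /(_ (2 * D)); rewrite mulr_ge0// => /(_ isT).
by under eq_integral do rewrite -mulrA.
Qed.

Let normr_coord_le (x : T) i : `|l x ord0 i| <= 1 * l1norm (l x).
Proof. by rewrite mul1r /l1norm (bigD1 i)//= lerDl sumr_ge0. Qed.

Let integrable_coord i : P.-integrable [set: T] (EFin \o (fun x => l x ord0 i)).
Proof.
apply: (integrable_X (a := fun x => 1 * l1norm (l x)) (C := M (2 * 1))) => //.
- exact: measurable_envelope.
- exact: envelope_le.
Qed.

Let integrable_coordM i j : P.-integrable [set: T]
  (EFin \o (fun x => l x ord0 i * l x ord0 j)).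
Proof.
apply: (integrable_XY (a := fun x => 1 * l1norm (l x)) (C := M (2 * 1))) => //.
- exact: measurable_envelope.
- exact: envelope_le.
Qed.

Lemma expectation_dotv u : \int[P]_x dotv u (l x) = 0.
Proof.
have [|_ e] := @Rintegral_sum _ _ _ P setT _ (index_enum _)
    (fun (i : 'I_m) x => u ord0 i * l x ord0 i) measurableT.
  move=> i; have := integrableZl measurableT (u ord0 i) (integrable_coord i).
  by apply: eq_integrable => // x _ /=; rewrite EFinM.
rewrite /dotv e big1// => i _; rewrite RintegralZl//.
by case: lP => _ -> _; rewrite mulr0.
Qed.

Lemma expectation_dotvM u h :
  \int[P]_x (dotv u (l x) * dotv h (l x)) = (u *m info P l *m h^T) ord0 ord0.
Proof.
have i1 i j : P.-integrable [set: T]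
    (EFin \o (fun x => u ord0 i * h ord0 j * (l x ord0 i * l x ord0 j))).
  have := integrableZl measurableT (u ord0 i * h ord0 j) (integrable_coordM i j).
  by apply: eq_integrable => // x _ /=; rewrite !EFinM.
have i2 i := Rintegral_sum (index_enum _) measurableT (i1 i).
have [_ e] := Rintegral_sum (index_enum _) measurableT (fun i => (i2 i).1).
transitivity (\int[P]_x (\sum_(i < m) \sum_(j < m)
    (u ord0 i * h ord0 j * (l x ord0 i * l x ord0 j)))).
  apply: eq_Rintegral => x _; rewrite /dotv mulr_suml; apply: eq_bigr => i _.
  by rewrite mulr_sumr; apply: eq_bigr => j _; rewrite mulrACA.
rewrite e mxE; under [RHS]eq_bigr do rewrite !mxE mulr_suml.
rewrite exchange_big/=; apply: eq_bigr => i _; rewrite (i2 i).2.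
by apply: eq_bigr => j _; rewrite RintegralZl// mxE mulrAC.
Qed.

Lemma info_sym : (info P l)^T = info P l.
Proof.
by apply/matrixP => i j; rewrite !mxE; apply: eq_Rintegral => x _; rewrite mulrC.
Qed.

Lemma tilted_clt_score (D : R) (h u : 'rV[R]_m) c n :
  (0 < n)%N -> 0 <= D ->
  (forall i, `|h ord0 i| <= D) -> (forall i, `|u ord0 i| <= D) ->
  `|\int[iprod P n]_w (tilt (rate n) P l h w * cos (dotv u (Delta (rate n) l w) + c))
    - expR (- ((u *m info P l *m u^T) ord0 ord0 / 2))
      * cos (c + (u *m info P l *m h^T) ord0 ord0)|
  <= char_step_cst (54 * M (2 * D)) * rate n.
Proof.
move=> n0 D0 hD uD.
have := tilted_clt (X := fun x => dotv u (l x)) (Y := fun x => dotv h (l x))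
  (measurable_dotv_score u) (measurable_dotv_score h) (measurable_envelope D)
  (fun x => normr_dotv_le (l x) uD) (fun x => normr_dotv_le (l x) hD)
  (envelope_le D0) (expectation_dotv u) (expectation_dotv h)
  (rate_ge0 n) (rate_le1 n0) c n0 (rate_sqr n).
have -> : \int[P]_x (dotv u (l x) ^+ 2) = (u *m info P l *m u^T) ord0 ord0.
  by rewrite -expectation_dotvM.
rewrite expectation_dotvM; congr (`|_ - _| <= _).
by apply: eq_Rintegral => w _; rewrite dotv_Delta.
Qed.

Lemma integrable_tilt_tuple D h n : (0 < n)%N -> 0 <= D ->
  (forall i, `|h ord0 i| <= D) ->
  (iprod P n).-integrable [set: _] (EFin \o tilt (rate n) P l h).
Proof.
move=> n0 D0 hD.
have [+ _] := integrable_expR_tsum (X := fun x => dotv h (l x)) (Y := fun x => dotv h (l x))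
  (measurable_dotv_score h) (measurable_envelope D)
  (fun x => normr_dotv_le (l x) hD) (fun x => normr_dotv_le (l x) hD)
  (envelope_le D0) (rate_ge0 n) (rate_le1 n0) n.
move=> /(integrableZr measurableT ((\int[P]_x expR (rate n * dotv h (l x))) ^+ n)^-1).
by apply: eq_integrable => // w _ /=; rewrite -EFinM.
Qed.

Lemma measurable_Delta n i : measurable_fun [set: n.-tuple T]
  (fun w => Delta (rate n) l w ord0 i).
Proof.
under eq_fun do rewrite mxE.
by apply: measurable_funM => //; exact: measurable_tsum.
Qed.

End one_score.

(** By linearity [f] is a cosine, where both expectations are explicit. The threshold in n precedes
    the quantifiers over P, l, h and nu: it depends only on f, M, D and e. *)
Lemma trig_clt f : trig f -> forall (M : R -> R) (D e : R), 0 <= D -> 0 < e ->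
  \forall n \near \oo, forall P l h (nu : probability (m.-tuple R) R),
    score_class M P l -> (forall i, `|h ord0 i| <= D) ->
    info P l \in unitmx -> is_gaussian nu h (invmx (info P l)) ->
    `|\int[iprod P n]_w (tilt (rate n) P l h w * f (Delta (rate n) l w))
      - \int[nu]_x f (mxact (info P l) x)| <= e.
Proof.
move=> + M D + D0; elim=> [a u c e e0|{}f g tf IHf tg IHg e e0]; last first.
  have e20 : 0 < e / 2 by rewrite divr_gt0.
  have /= nf := IHf _ e20; have /= ng := IHg _ e20.
  have n1 : \forall n \near \oo, (0 < n)%N by exists 1%N.
  near=> n => P l h nu lP hD Ju nuG.
  have n0 : (0 < n)%N by near: n.
  have hf : `|\int[iprod P n]_w (tilt (rate n) P l h w * f (Delta (rate n) l w))
      - \int[nu]_x f (mxact (info P l) x)| <= e / 2.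
    by move: P l h nu lP hD Ju nuG; near: n.
  have hg : `|\int[iprod P n]_w (tilt (rate n) P l h w * g (Delta (rate n) l w))
      - \int[nu]_x g (mxact (info P l) x)| <= e / 2.
    by move: P l h nu lP hD Ju nuG {hf}; near: n.
  have it := integrable_tilt_tuple lP n0 D0 hD.
  have itf k : trig k -> (iprod P n).-integrable [set: _] (EFin \o
      (fun w => tilt (rate n) P l h w * k (Delta (rate n) l w))).
    move=> tk; have [N N0 kN] := trig_bounded tk.
    apply: (@integrable_dominated _ _ _ (iprod P n) _ (fun w => tilt (rate n) P l h w * N)).
    - apply: measurable_funM; first by apply/measurable_EFinP; case/integrableP : it.
      by apply: measurable_trig => // i; exact: measurable_Delta lP n i.
    - move=> w; rewrite normrM ger0_norm ?ler_wpM2l//.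
        by rewrite divr_ge0 ?expR_ge0// exprn_ge0// Rintegral_ge0// => x _; exact: expR_ge0.
      by rewrite divr_ge0 ?expR_ge0// exprn_ge0// Rintegral_ge0// => x _; exact: expR_ge0.
    - have := integrableZr measurableT N it.
      by apply: eq_integrable => // w _ /=; rewrite EFinM.
  have ink k : trig k -> nu.-integrable [set: _] (EFin \o (fun x => k (mxact (info P l) x))).
    move=> tk; have [N N0 kN] := trig_bounded tk.
    apply: (@integrable_dominated _ _ _ nu _ (cst N)) => //.
    - by apply: measurable_trig => // i; exact: measurable_mxact.
    - exact: integrable_cst.
  under eq_Rintegral do rewrite mulrDr.
  rewrite (RintegralD measurableT (itf _ tf) (itf _ tg)).
  rewrite (RintegralD measurableT (ink _ tf) (ink _ tg)).
  rewrite opprD addrACA (le_trans (ler_normD _ _))//.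
  by rewrite (_ : e = e / 2 + e / 2) ?lerD//; field.
(* One envelope serves both linear forms, so its factor has to bound the coordinates of [h] and of
   [u]. *)
pose D' := D + \sum_(i < m) `|u ord0 i|.
have D'0 : 0 <= D' by rewrite addr_ge0// sumr_ge0.
pose K := `|a| * `|char_step_cst (54 * M (2 * D'))| + 1.
have K0 : 0 < K by rewrite ltr_wpDl// mulr_ge0.
have eK : 0 < e / K by rewrite divr_gt0.
near=> n => P l h nu lP hD Ju nuG.
have n0 : (0 < n)%N by near: n; exists 1%N.
have hD' i : `|h ord0 i| <= D'.
  by rewrite (le_trans (hD i))// lerDl sumr_ge0.
have uD' i : `|u ord0 i| <= D'.
  by rewrite /D' (bigD1 i)//= addrCA lerDl addr_ge0// sumr_ge0.
have := tilted_clt_score lP c n0 D'0 hD' uD'.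
set J := info P l in Ju nuG *.
have JT : J^T = J by exact: info_sym.
(* If x has covariance J^-1, then J x has covariance J. *)
have e1 : u *m J *m invmx J *m (u *m J)^T = u *m J *m u^T.
  by rewrite mulmxK// trmx_mul JT mulmxA.
have pos : 0 <= (u *m J *m u^T) ord0 ord0.
  rewrite -(expectation_dotvM lP) Rintegral_ge0// => x _.
  by rewrite -expr2 sqr_ge0.
have := gaussian_char c nuG (t := u *m J).
rewrite e1 => /(_ pos); rewrite dotvE => <-.
have -> : \int[nu]_x cos (linform (u *m J) x + c) =
    \int[nu]_x cos (dotv u (mxact J x) + c).
  by apply: eq_Rintegral => x _; rewrite dotv_mxact.
move=> h1.
have -> : \int[iprod P n]_w (tilt (rate n) P l h w * (a * cos (dotv u (Delta (rate n) l w) + c)))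
   = a * \int[iprod P n]_w (tilt (rate n) P l h w * cos (dotv u (Delta (rate n) l w) + c)).
  rewrite -RintegralZl//; first by apply: eq_Rintegral => w _; rewrite mulrCA.
  have it := integrable_tilt_tuple lP n0 D0 hD.
  apply: (@integrable_dominated _ _ _ (iprod P n) _ (tilt (rate n) P l h)) => //.
  - apply: measurable_funM; first by apply/measurable_EFinP; case/integrableP : it.
    apply: (measurable_trig (f := fun z => cos (dotv u z + c))).
      by move=> i; exact: measurable_Delta lP n i.
    by have := trig_cos 1 u c; under eq_fun do rewrite mul1r.
  - move=> w; have t0 : 0 <= tilt (rate n) P l h w.
      by rewrite divr_ge0 ?expR_ge0// exprn_ge0// Rintegral_ge0// => x _; exact: expR_ge0.
    by rewrite normrM ger0_norm// ler_piMr//; exact: cos_max.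
have -> : \int[nu]_x (a * cos (dotv u (mxact J x) + c)) =
    a * \int[nu]_x cos (dotv u (mxact J x) + c).
  rewrite RintegralZl//.
  apply: (@integrable_dominated _ _ _ nu _ (cst 1)).
  - apply: (measurable_trig (f := fun z => cos (dotv u z + c))).
      by move=> i; exact: measurable_mxact.
    by have := trig_cos 1 u c; under eq_fun do rewrite mul1r.
  - by move=> x; exact: cos_max.
  - exact: integrable_cst.
rewrite -mulrBr normrM.
rewrite (@le_trans _ _ (K * rate n))//.
  rewrite (@le_trans _ _ (`|a| * (`|char_step_cst (54 * M (2 * D'))| * rate n)))//.
    by rewrite ler_wpM2l// (le_trans h1)// ler_wpM2r ?rate_ge0// ler_norm.
  by rewrite mulrA ler_wpM2r ?rate_ge0// lerDl.
rewrite -ler_pdivlMl// mulrC.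
near: n.
have /cvgrPdist_le /(_ _ eK) := rate_cvg0.
apply: filterS => n; rewrite sub0r normrN ger0_norm//; exact: rate_ge0.
Unshelve. all: by end_near. Qed.

End score.

(** * Trigonometric partitions of unity *)

Section bernstein.
Context {R : realType}.
Implicit Types (p x : R) (f g : nat -> R).

(** The probability of k successes in N trials of parameter p, by conditioning on one trial. With
    this recursion the moments, and membership in [trig] after substitution, are plain
    inductions. *)
Fixpoint bern (N k : nat) p : R :=
  if N is N'.+1 then
    (1 - p) * bern N' k p + p * (if k is k'.+1 then bern N' k' p else 0)
  else (k == 0%N)%:R.

Lemma bern_ge0 N k p : 0 <= p <= 1 -> 0 <= bern N k p.
Proof.
move=> /andP[p0 p1]; elim: N k => [|N IH] k /=; first exact: ler0n.
by rewrite addr_ge0// mulr_ge0// ?subr_ge0//; case: k.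
Qed.

Lemma bern_gt N k p : (N < k)%N -> bern N k p = 0.
Proof.
elim: N k => [|N IH] [|k]//= Nk.
by rewrite !IH ?mulr0 ?addr0// (ltn_trans _ Nk).
Qed.

Definition bern_sum N f p := \sum_(k < N.+1) bern N k p * f k.

Lemma bern_sumS N f p :
  bern_sum N.+1 f p = (1 - p) * bern_sum N f p + p * bern_sum N (fun k => f k.+1) p.
Proof.
rewrite /bern_sum [in LHS]/=; under eq_bigr do rewrite mulrDl -!mulrA.
rewrite big_split/= -!mulr_sumr; congr (_ * _ + _ * _).
  by rewrite big_ord_recr/= bern_gt// mul0r addr0.
by rewrite big_ord_recl mul0r add0r.
Qed.

Lemma bern_sum_linear N f g a b p :
  bern_sum N (fun k => a * f k + b * g k) p = a * bern_sum N f p + b * bern_sum N g p.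
Proof.
by rewrite /bern_sum !mulr_sumr -big_split; apply: eq_bigr => k _ /=; ring.
Qed.

Lemma bern_sum1 N p : bern_sum N (fun=> 1) p = 1.
Proof.
elim: N => [|N IH]; last by rewrite bern_sumS !IH; ring.
by rewrite /bern_sum big_ord1 mulr1.
Qed.

Lemma bern_sum_mean N p : bern_sum N (fun k => k%:R - N%:R * p) p = 0.
Proof.
elim: N => [|N IH]; first by rewrite /bern_sum big_ord1/= mul0r subrr mulr0.
rewrite bern_sumS.
have -> : (fun k => k%:R - N.+1%:R * p) =
    (fun k => 1 * (k%:R - N%:R * p) + (- p) * 1) :> (nat -> R).
  by apply/funext => k; rewrite -[N.+1]addn1 natrD; ring.
have -> : (fun k => k.+1%:R - N.+1%:R * p) =
    (fun k => 1 * (k%:R - N%:R * p) + (1 - p) * 1) :> (nat -> R).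
  by apply/funext => k; rewrite -[N.+1]addn1 -[k.+1]addn1 !natrD; ring.
by rewrite !bern_sum_linear IH bern_sum1; ring.
Qed.

Lemma bern_sum_variance N p :
  bern_sum N (fun k => (k%:R - N%:R * p) ^+ 2) p = N%:R * (p * (1 - p)).
Proof.
elim: N => [|N IH].
  by rewrite /bern_sum big_ord1/= !mul0r subrr expr0n/= mulr0.
rewrite bern_sumS.
have -> : (fun k => (k%:R - N.+1%:R * p) ^+ 2) =
    (fun k => 1 * (1 * (k%:R - N%:R * p) ^+ 2 + (- p *+ 2) * (k%:R - N%:R * p))
              + p ^+ 2 * 1) :> (nat -> R).
  by apply/funext => k; rewrite -[N.+1]addn1 natrD; ring.
have -> : (fun k => (k.+1%:R - N.+1%:R * p) ^+ 2) =
    (fun k => 1 * (1 * (k%:R - N%:R * p) ^+ 2 + ((1 - p) *+ 2) * (k%:R - N%:R * p))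
              + (1 - p) ^+ 2 * 1) :> (nat -> R).
  by apply/funext => k; rewrite -[N.+1]addn1 -[k.+1]addn1 !natrD; ring.
rewrite !bern_sum_linear IH bern_sum_mean bern_sum1 -[N.+1]addn1 natrD; ring.
Qed.

Variable L : nat.
Hypothesis L0 : (0 < L)%N.

Let N := (L ^ 4)%N.
(* Evaluating Bernstein polynomials of degree L^4 at (1 + sin(x / L)) / 2 turns
   them into trigonometric polynomials that are concentrated near [node k]. *)
Definition sine_coord x := (1 + sin (x / L%:R)) / 2.
Definition node (k : nat) : R := L%:R * (2 * k%:R / (L ^ 4)%:R - 1).

Lemma sine_coord01 x : 0 <= sine_coord x <= 1.
Proof.
have := sin_geN1 (x / L%:R); have := sin_le1 (x / L%:R).
by rewrite /sine_coord => *; apply/andP; split; lra.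
Qed.

(** x - node k splits into - L (sin(x / L) - x / L), at most x^2 / L, and - 2 L^-3 (k - N p), at
    most 1 / L + L^-5 (k - N p)^2. The variance N p (1 - p) is at most N = L^4, so this degree
    brings the last mean down to 1 / L. *)
Lemma bern_node_le x :
  bern_sum N (fun k => `|x - node k|) (sine_coord x) <= (2 + x ^+ 2) / L%:R.
Proof.
set p := sine_coord x.
have l0 : 0 < L%:R :> R by rewrite ltr0n.
have l0' : L%:R != 0 :> R by rewrite gt_eqF.
have Nl : N%:R = L%:R ^+ 4 :> R by rewrite /N natrX.
have /andP[p0 p1] : 0 <= p <= 1 := sine_coord01 x.
have bound k : `|x - node k| <= (x ^+ 2 / L%:R + L%:R^-1) * 1 +
    L%:R^-1 ^+ 5 * (k%:R - N%:R * p) ^+ 2.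
  have -> : x - node k = - L%:R * (sin (x / L%:R) - x / L%:R)
      - 2 * (L%:R^-1 ^+ 3) * (k%:R - N%:R * p).
    by rewrite /node -/N Nl /p /sine_coord; field.
  rewrite (le_trans (ler_normB _ _))// mulr1 -addrA lerD//.
    rewrite normrM normrN (ger0_norm (ltW l0)).
    rewrite (@le_trans _ _ (L%:R * `|x / L%:R| ^+ 2))//.
      by rewrite ler_wpM2l ?(ltW l0)// sin_sub_le2.
    rewrite real_normK ?num_real// le_eqVlt; apply/orP; left; apply/eqP.
    by field.
  set z := k%:R - _.
  have li0 : 0 <= L%:R^-1 :> R by rewrite invr_ge0 ltW.
  have h := mulr_ge0 li0 (sqr_ge0 (L%:R^-1 ^+ 2 * `|z| - 1)).
  rewrite normrM ger0_norm; last by rewrite mulr_ge0// exprn_ge0.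
  rewrite -subr_ge0 -(real_normK (num_real z)); apply: le_trans h _.
  by rewrite le_eqVlt; apply/orP; left; apply/eqP; ring.
apply: (@le_trans _ _ (bern_sum N (fun k => (x ^+ 2 / L%:R + L%:R^-1) * 1 +
    L%:R^-1 ^+ 5 * (k%:R - N%:R * p) ^+ 2) p)).
  apply: ler_sum => k _; rewrite ler_wpM2l// bern_ge0//.
  exact: sine_coord01.
rewrite bern_sum_linear bern_sum1 bern_sum_variance mulr1.
have -> : L%:R^-1 ^+ 5 * (N%:R * (p * (1 - p))) = L%:R^-1 * (p * (1 - p)) :> R.
  by rewrite Nl; field.
have pp : p * (1 - p) <= 1 by have := mulr_ge0 p0 p0; lra.
have h : L%:R^-1 * (p * (1 - p)) <= L%:R^-1 * 1 by rewrite ler_wpM2l// invr_ge0 ltW.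
rewrite [leRHS]mulrDl; lra.
Qed.

End bernstein.

Section partition.
Context {R : realType} {m : nat}.

Lemma trig_sine_coord L (i : 'I_m) : trig (fun z : 'rV[R]_m => sine_coord L (z ord0 i)).
Proof.
have := trig_add (trig_cst (2^-1 : R))
  (trig_cos (2^-1 : R) (L%:R^-1 *: delta_mx ord0 i : 'rV[R]_m) (- (pi / 2))).
congr trig; apply/funext => z; rewrite cosBpihalf /sine_coord [RHS]mulrDl mul1r.
congr (_ + _); rewrite mulrC; congr (sin _ * _).
rewrite /dotv (bigD1 i)//= big1 => [|j ji]; last first.
  by rewrite !mxE (negbTE ji) andbF mulr0 mul0r.
by rewrite !mxE !eqxx mulr1 addr0 mulrC.
Qed.

Lemma trig_bern L N k (i : 'I_m) :
  trig (fun z : 'rV[R]_m => bern N k (sine_coord L (z ord0 i))).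
Proof.
elim: N k => [|N IH] k /=; first exact: trig_cst.
apply: trig_add; apply: trig_mul => //.
- apply: trig_add; first exact: trig_cst.
  have := trig_scale (-1) (trig_sine_coord L i).
  by congr trig; apply/funext => z; rewrite mulN1r.
- exact: trig_sine_coord.
- by case: k => [|k]; [exact: trig_cst|exact: IH].
Qed.

(** Marginalization: after expanding the product of sums, all factors other than the i-th sum to
    1. *)
Lemma sum_ffun_prod (I K : finType) (F : I -> K -> R) (i : I) (g : K -> R) :
  (forall j, \sum_k F j k = 1) ->
  \sum_(j : {ffun I -> K}) (\prod_i' F i' (j i')) * g (j i) = \sum_k F i k * g k.
Proof.
move=> F1; pose F' i' k := F i' k * (if i' == i then g k else 1).
transitivity (\sum_(j : {ffun I -> K}) \prod_i' F' i' (j i')).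
  apply: eq_bigr => j _; rewrite big_split/=; congr (_ * _).
  by rewrite -big_mkcond/= big_pred1_eq.
rewrite -bigA_distr_bigA/= (bigD1 i)//= [X in _ * X]big1 ?mulr1.
  by apply: eq_bigr => k _; rewrite /F' eqxx.
move=> j ji; rewrite -[RHS](F1 j); apply: eq_bigr => k _.
by rewrite /F' (negbTE ji) mulr1.
Qed.

(** Tensor product of the one-dimensional Bernstein weights; the mean deviation in one coordinate
    involves only the factor of that coordinate. *)
Lemma trig_partition L : (0 < L)%N ->
  exists (K : finType) (phi : K -> 'rV[R]_m -> R) (a : K -> 'rV[R]_m),
    [/\ forall j, trig (phi j), forall j z, 0 <= phi j z,
        forall z, \sum_j phi j z = 1 &
        forall z i, \sum_j phi j z * `|z ord0 i - a j ord0 i|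
          <= (2 + z ord0 i ^+ 2) / L%:R].
Proof.
move=> L0; pose N := (L ^ 4)%N.
pose F (z : 'rV[R]_m) i (k : 'I_N.+1) := bern N k (sine_coord L (z ord0 i)).
have F1 z i : \sum_k F z i k = 1.
  by rewrite -(bern_sum1 N (sine_coord L (z ord0 i))); apply: eq_bigr => k _; rewrite mulr1.
exists {ffun 'I_m -> 'I_N.+1}, (fun (j : {ffun 'I_m -> 'I_N.+1}) z => \prod_i F z i (j i)),
  (fun j : {ffun 'I_m -> 'I_N.+1} => \row_i node L (j i)); split.
- move=> j; apply: trig_prod => i; exact: trig_bern.
- by move=> j z; apply: prodr_ge0 => i _; apply: bern_ge0; exact: sine_coord01.
- move=> z; rewrite -(bigA_distr_bigA (F z)) big1// => i _; exact: F1.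
- move=> z i; under eq_bigr do rewrite mxE.
  rewrite (sum_ffun_prod i (fun k : 'I_N.+1 => `|z ord0 i - node L k|) (F1 z)).
  exact: bern_node_le.
Qed.

End partition.

(** * Gaussian mixtures approximate product measures *)

Section mixture.
Context d (W : measurableType d) (R : realType) (Q : probability W R).
Variables (phi : W -> R) (mphi : measurable_fun [set: W] phi).
Variables (phi0 : forall w, 0 <= phi w) (phi1 : forall w, phi w <= 1).

(* [mnormalize] falls back on Q itself when phi has mass 0. *)
Definition reweight : probability W R := mnormalize (mdensity Q mphi phi0) Q.

Let iphi : Q.-integrable [set: W] (EFin \o phi).
Proof.
apply: (@integrable_dominated _ _ _ Q _ (cst 1)) => //.
- by move=> w; rewrite ger0_norm.
- exact: integrable_cst.
Qed.

Lemma reweightE A : measurable A -> 0 < \int[Q]_w phi w ->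
  fine (reweight A) = (\int[Q]_(w in A) phi w) / \int[Q]_w phi w.
Proof.
move=> mA b0.
have e : mdensity Q mphi phi0 setT = (\int[Q]_w phi w)%:E.
  by rewrite /mdensity EFin_Rintegral.
have E : reweight A = ((\int[Q]_(w in A) phi w) / \int[Q]_w phi w)%:E.
  transitivity (if (mdensity Q mphi phi0 setT == 0%E) ||
      (mdensity Q mphi phi0 setT == +oo%E) then Q A else
    mdensity Q mphi phi0 A * (fine (mdensity Q mphi phi0 setT))^-1%:E)%E.
    by rewrite /reweight /= /mnormalize; case: ifP.
  rewrite e eqe gt_eqF//= EFinM; congr (_ * _)%E.
  rewrite /mdensity /Rintegral fineK//.
  by apply: integrable_fin_num => //; apply: integrableS iphi.
by rewrite E.
Qed.

(** If G were the constant [c], this would be an equality without error term. Replacing G by [c]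
    costs the integral of phi |c - G| twice: in the total mass of G phi and in its mass on A. *)
Lemma reweight_le (G : W -> R) c A : measurable A ->
  (forall w, 0 <= G w) -> Q.-integrable [set: W] (EFin \o G) ->
  (\int[Q]_w (G w * phi w)) * fine (reweight A) <=
  \int[Q]_(w in A) (G w * phi w) + 2 * \int[Q]_w (phi w * `|c - G w|).
Proof.
move=> mA G0 iG.
have mG : measurable_fun [set: W] G by apply/measurable_EFinP; case/integrableP : iG.
have iGp : Q.-integrable [set: W] (EFin \o (fun w => G w * phi w)).
  apply: (@integrable_dominated _ _ _ Q _ G) => //; first exact: measurable_funM.
  by move=> w; rewrite normrM !ger0_norm// ler_piMr.
have icG : Q.-integrable [set: W] (EFin \o (fun w => phi w * (c - G w))).
  have h := integrableB measurableT (integrableZl measurableT c iphi) iGp.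
  by apply: eq_integrable h => // w _ /=; rewrite -EFinM -EFinB; congr (_%:E); ring.
have iab : Q.-integrable [set: W] (EFin \o (fun w => phi w * `|c - G w|)).
  have := integrable_norm icG; apply: eq_integrable => // w _ /=.
  by rewrite normrM (ger0_norm (phi0 _)).
set I := \int[Q]_w (phi w * `|c - G w|).
have I0 : 0 <= I by apply: Rintegral_ge0 => w _; rewrite mulr_ge0.
set b := \int[Q]_w phi w; set e := \int[Q]_w (G w * phi w).
have e0 : 0 <= e by apply: Rintegral_ge0 => w _; rewrite mulr_ge0.
have b0 : 0 <= b by exact: Rintegral_ge0.
have ecb : `|e - c * b| <= I.
  rewrite /e /b -RintegralZl// -RintegralB//; last first.
    by have := integrableZl measurableT c iphi; apply: eq_integrable => // w _ /=; rewrite EFinM.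
  apply: le_normr_expectation => //.
    apply: measurable_funB; first exact: measurable_funM.
    exact: measurable_funM.
  move=> w; rewrite (_ : G w * phi w - c * phi w = - (phi w * (c - G w))); last by ring.
  by rewrite normrN normrM (ger0_norm (phi0 _)).
have IA0 : 0 <= \int[Q]_(w in A) (G w * phi w).
  by apply: Rintegral_ge0 => w _; rewrite mulr_ge0.
have k0 : 0 <= fine (reweight A) by rewrite fine_ge0.
have k1 : fine (reweight A) <= 1.
  have := probability_le1 reweight mA.
  by rewrite -lee_fin fineK// fin_num_measure.
(* If phi has mass zero, then e <= I, and the bound holds whatever [reweight] is. *)
have [b00|bN0] := eqVneq b 0.
  have : `|e - c * b| <= I by [].
  rewrite b00 mulr0 subr0 ger0_norm// => eI.
  have : e * fine (reweight A) <= e by rewrite ler_piMr.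
  lra.
have bp : 0 < b by rewrite lt_neqAle eq_sym bN0.
have SA : \int[Q]_(w in A) phi w <= b.
  rewrite /b -lee_fin !EFin_Rintegral// /Rintegral fineK; last first.
    by apply: integrable_fin_num => //; apply: integrableS iphi.
  apply: ge0_subset_integral => //; first exact/measurable_EFinP.
  by move=> w _; rewrite lee_fin.
have SA0 : 0 <= \int[Q]_(w in A) phi w by exact: Rintegral_ge0.
have AS f : Q.-integrable [set: W] (EFin \o f) -> Q.-integrable A (EFin \o f).
  by move=> h; apply: integrableS h.
rewrite reweightE// -/b.
have h1 : (e - c * b) * ((\int[Q]_(w in A) phi w) / b) <= I.
  rewrite (le_trans (ler_norm _))// normrM -[leRHS]mulr1 ler_pM//.
  by rewrite ger0_norm ?divr_ge0// ler_pdivrMr// mul1r.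
have h2 : c * \int[Q]_(w in A) phi w - \int[Q]_(w in A) (G w * phi w) <= I.
  rewrite -RintegralZl//; last exact: AS.
  rewrite -RintegralB//; last 2 first.
  - by apply: AS; have := integrableZl measurableT c iphi; apply: eq_integrable => // w _ /=; rewrite EFinM.
  - exact: AS.
  rewrite (le_trans (ler_norm _))// (@le_trans _ _ (\int[Q]_(w in A) (phi w * `|c - G w|)))//.
    rewrite (le_trans (le_normr_Rintegral _ _))//.
      apply: AS; apply: eq_integrable icG => // w _ /=; congr (_%:E); ring.
    rewrite le_eqVlt; apply/orP; left; apply/eqP; apply: eq_Rintegral => w _.
    rewrite (_ : c * phi w - G w * phi w = phi w * (c - G w)); last by ring.
    by rewrite normrM (ger0_norm (phi0 _)).
  rewrite /I -lee_fin EFin_Rintegral// /Rintegral fineK; last first.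
    by apply: integrable_fin_num => //; exact: AS.
  apply: ge0_subset_integral => //.
    by apply/measurable_EFinP; apply/measurable_EFinP; case/integrableP : iab.
  by move=> w _; rewrite lee_fin mulr_ge0.
set S := \int[Q]_(w in A) phi w in h1 h2 *.
have -> : e * (S / b) = (e - c * b) * (S / b) + c * S by field.
lra.
Qed.

End mixture.

(** * Hellinger comparison of product densities *)

Lemma sub_le_exprn (R : realType) (x : R) n : 0 <= x -> x <= 1 ->
  1 - n%:R * (1 - x) <= x ^+ n.
Proof.
move=> x0 x1; elim: n => [|n IH]; first by rewrite mul0r subr0 expr0.
rewrite exprS -[n.+1]addn1 natrD.
have := ler_wpM2l x0 IH; have : 0 <= n%:R * (1 - x) ^+ 2 by rewrite mulr_ge0// sqr_ge0.
lra.
Qed.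

Section product_hellinger.
Context d (T : measurableType d) (R : realType) (P : probability T R).
Notation integ f := (P.-integrable [set: T] (EFin \o f)).
Variables (s g : T -> R).
Hypotheses (ms : measurable_fun [set: T] s) (mg : measurable_fun [set: T] g).
Hypotheses (s0 : forall x, 0 <= s x) (g0 : forall x, 0 <= g x).
Hypotheses (is2 : integ (fun x => s x ^+ 2)) (ig2 : integ (fun x => g x ^+ 2)).
Hypotheses (g1 : \int[P]_x (g x ^+ 2) = 1) (s1 : \int[P]_x (s x ^+ 2) <= 1).

Let isg : integ (fun x => s x * g x).
Proof.
have := integrableD measurableT is2 ig2.
apply: le_integrable => //; first exact/measurable_EFinP/measurable_funM.
move=> x _; rewrite /= !lee_fin !ger0_norm ?addr_ge0 ?sqr_ge0 ?mulr_ge0//.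
have := sqr_ge0 (s x - g x); have := mulr_ge0 (s0 x) (g0 x).
by rewrite sqrrB -[_ *+ 2]mulr_natl; lra.
Qed.

Let Esg : 2 * \int[P]_x (s x * g x) =
  \int[P]_x (s x ^+ 2) + 1 - \int[P]_x ((s x - g x) ^+ 2).
Proof.
have i2sg : integ (fun x => 2 * (s x * g x)).
  by have := integrableZl measurableT 2 isg; apply: eq_integrable => // x _ /=; rewrite EFinM.
have iD : integ (fun x => s x ^+ 2 + g x ^+ 2).
  by have := integrableD measurableT is2 ig2; apply: eq_integrable.
have -> : \int[P]_x ((s x - g x) ^+ 2) =
    \int[P]_x ((s x ^+ 2 + g x ^+ 2) - 2 * (s x * g x)).
  by apply: eq_Rintegral => x _; ring.
by rewrite RintegralB// RintegralD// RintegralZl// g1; ring.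
Qed.

(** Let C be the affinity of s and g. The products have affinity C^n, at least 1 - n (1 - C) by
    Bernoulli's inequality, and 2 (1 - C) is the mass defect of s^2 plus the squared distance of s
    and g. The free parameter [rho] replaces the square root in Cauchy-Schwarz by a weighted sum. *)
Lemma product_hellinger n rho : 0 < rho ->
  \int[iprod P n]_w `|\prod_(i < n) (g (tnth w i) ^+ 2) - \prod_(i < n) (s (tnth w i) ^+ 2)|
  <= n%:R * ((1 - \int[P]_x (s x ^+ 2)) + \int[P]_x ((s x - g x) ^+ 2)) / (2 * rho)
     + 2 * rho.
Proof.
move=> r0.
have [iS eS] := integrable_iprod_prod n (measurable_funX 2 ms) (fun x => sqr_ge0 _) is2.
have [iG eG] := integrable_iprod_prod n (measurable_funX 2 mg) (fun x => sqr_ge0 _) ig2.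
have [iSG eSG] := integrable_iprod_prod n (measurable_funM ms mg)
  (fun x => mulr_ge0 (s0 x) (g0 x)) isg.
rewrite g1 expr1n in eG; have Esg' := Esg.
set A := \int[P]_x (s x ^+ 2) in Esg' eS *; set H := \int[P]_x ((s x - g x) ^+ 2) in Esg' *.
set C := \int[P]_x (s x * g x) in Esg' eSG.
have A1 : A <= 1 := s1.
have A0 : 0 <= A by apply: Rintegral_ge0 => x _; exact: sqr_ge0.
have H0 : 0 <= H by apply: Rintegral_ge0 => x _; exact: sqr_ge0.
have C0 : 0 <= C by apply: Rintegral_ge0 => x _; rewrite mulr_ge0.
have C1 : C <= 1 by lra.
pose F w := (2 * rho)^-1 * (\prod_(i < n) (s (tnth w i) ^+ 2) + \prod_(i < n) (g (tnth w i) ^+ 2)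
   - 2 * \prod_(i < n) (s (tnth w i) * g (tnth w i)))
  + rho * (\prod_(i < n) (s (tnth w i) ^+ 2) + \prod_(i < n) (g (tnth w i) ^+ 2)).
have iD := integrableD measurableT iS iG.
have i2 := integrableZl measurableT 2 iSG.
have iB := integrableB measurableT iD i2.
have iF1 := integrableZl measurableT (2 * rho)^-1 iB.
have iF2 := integrableZl measurableT rho iD.
have iF : (iprod P n).-integrable [set: _] (EFin \o F).
  by have := integrableD measurableT iF1 iF2; apply: eq_integrable.
have EF : \int[iprod P n]_w F w = (2 * rho)^-1 * (A ^+ n + 1 - 2 * C ^+ n) + rho * (A ^+ n + 1).
  rewrite /F RintegralD; [|exact: measurableT|exact: iF1|exact: iF2].
  rewrite RintegralZl; [|exact: measurableT|exact: iB].
  rewrite RintegralZl; [|exact: measurableT|exact: iD].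
  rewrite RintegralB; [|exact: measurableT|exact: iD|exact: i2].
  rewrite RintegralZl; [|exact: measurableT|exact: iSG].
  by rewrite (RintegralD measurableT iS iG) eS eG eSG.
have mprod (k : T -> R) : measurable_fun [set: T] k ->
    measurable_fun [set: n.-tuple T] (fun w => \prod_(i < n) k (tnth w i)).
  move=> mk; apply: measurable_prod => i _.
  by apply: measurableT_comp => //; exact: measurable_tnth.
rewrite (@le_trans _ _ (\int[iprod P n]_w F w))//.
  rewrite (le_trans (ler_norm _))// le_normr_expectation//.
    apply: measurableT_comp => //; apply: measurable_funB.
      exact: (mprod (fun x => g x ^+ 2) (measurable_funX 2 mg)).
    exact: (mprod (fun x => s x ^+ 2) (measurable_funX 2 ms)).
  move=> w; rewrite normr_id /F.
  pose a := \prod_(i < n) s (tnth w i); pose b := \prod_(i < n) g (tnth w i).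
  have -> : \prod_(i < n) (s (tnth w i) ^+ 2) = a ^+ 2 by rewrite prodrXl.
  have -> : \prod_(i < n) (g (tnth w i) ^+ 2) = b ^+ 2 by rewrite prodrXl.
  have -> : \prod_(i < n) (s (tnth w i) * g (tnth w i)) = a * b by rewrite big_split.
  have a0 : 0 <= a by exact: prodr_ge0.
  have b0 : 0 <= b by exact: prodr_ge0.
  (* AM-GM: |a^2 - b^2| = |a - b| (a + b) <= (a - b)^2 / (2 rho) + rho (a + b)^2 / 2 *)
  have h (z t : R) : z * t <= (2 * rho)^-1 * z ^+ 2 + rho * t ^+ 2 / 2.
    have : 0 <= (2 * rho)^-1 * (z - rho * t) ^+ 2.
      by rewrite mulr_ge0 ?sqr_ge0// invr_ge0 mulr_ge0// ltW.
    rewrite -subr_ge0 => h; rewrite -subr_ge0; apply: le_trans h _.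
    by rewrite le_eqVlt; apply/orP; left; apply/eqP; field; rewrite gt_eqF.
  have := h `|b - a| (b + a).
  rewrite real_normK ?num_real// (_ : (b - a) ^+ 2 = a ^+ 2 + b ^+ 2 - 2 * (a * b)); last by ring.
  have -> : `|b ^+ 2 - a ^+ 2| = `|b - a| * (b + a).
    by rewrite subr_sqr normrM (ger0_norm (addr_ge0 b0 a0)).
  move=> h1; rewrite (le_trans h1)// lerD2l -mulrA ler_wpM2l ?(ltW r0)//.
  by have := sqr_ge0 (b - a); rewrite !expr2; lra.
rewrite EF.
have An1 : A ^+ n <= 1 by rewrite exprn_ile1.
have := sub_le_exprn n C0 C1 => Cn.
have ri : 0 < (2 * rho)^-1 by rewrite invr_gt0 mulr_gt0.
rewrite lerD//.
  rewrite [leRHS]mulrC ler_wpM2l ?(ltW ri)//.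
  have -> : n%:R * (1 - A + H) = 2 * (n%:R * (1 - C)).
    by rewrite (_ : 1 - A + H = 2 * (1 - C)); [ring|lra].
  lra.
by rewrite mulrC ler_wpM2r ?(ltW r0)//; lra.
Qed.

End product_hellinger.

Section local_approximation.
Context d (T : measurableType d) (R : realType) (m : nat).
Variables (P : probability T R) (l : T -> 'rV[R]_m) (M : R -> R).
Hypothesis lP : score_class M P l.
Variables (D : R) (h : 'rV[R]_m) (n : nat).
Hypotheses (D0 : 0 <= D) (hD : forall i, `|h ord0 i| <= D) (n0 : (0 < n)%N).

Notation r := (rate R n).
Let Y x := dotv h (l x).
Let a x := D * l1norm (l x).
Let B := \int[P]_x expR (r * Y x).

Let r0 : 0 <= r. Proof. exact: rate_ge0. Qed.
Let r1 : r <= 1. Proof. exact: rate_le1. Qed.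
Let Ya x : `|Y x| <= a x. Proof. exact: normr_dotv_le. Qed.
Let mY : measurable_fun [set: T] Y. Proof. exact: measurable_dotv_score lP h. Qed.
Let ma : measurable_fun [set: T] a. Proof. exact: measurable_envelope lP D. Qed.
Let aC : (\int[P]_x (expR (2 * a x))%:E <= (M (2 * D))%:E)%E.
Proof. exact: envelope_le lP _ D0. Qed.
Let Y0 : \int[P]_x Y x = 0. Proof. exact: expectation_dotv lP h. Qed.

Let a0 x : 0 <= a x. Proof. by rewrite mulr_ge0// l1norm_ge0. Qed.

Lemma tilt_norm_ge1 : 1 <= B.
Proof. exact: tilt_mass_ge1 mY ma Ya Ya aC Y0 r0 r1. Qed.

Lemma tilt_norm_le : B <= 1 + 4 * r ^+ 2 * M (2 * D).
Proof. exact: tilt_mass_le mY ma Ya Ya aC Y0 r0 r1. Qed.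

Lemma integrable_exp_score : P.-integrable [set: T] (EFin \o (fun x => expR (r * Y x))).
Proof. exact: integrable_tilt mY ma Ya Ya aC r0 r1. Qed.

(** Square root of the density of one tilted coordinate, to be compared in L^2 with the square root
    of the likelihood ratio. *)
Definition tilt_root x : R := expR (r * Y x / 2) / Num.sqrt B.

Let B0 : 0 < B. Proof. exact: lt_le_trans tilt_norm_ge1. Qed.
Let sB0 : 0 < Num.sqrt B. Proof. by rewrite sqrtr_gt0. Qed.

Lemma measurable_tilt_root : measurable_fun [set: T] tilt_root.
Proof.
apply: measurable_funM => //; apply: measurableT_comp => //.
by apply: measurable_funM => //; exact: measurable_funM.
Qed.

Lemma tilt_root_ge0 x : 0 <= tilt_root x.
Proof. by rewrite divr_ge0 ?expR_ge0// sqrtr_ge0. Qed.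

Lemma tilt_root_sqr x : tilt_root x ^+ 2 = expR (r * Y x) / B.
Proof.
rewrite exprMn exprVn sqr_sqrtr ?(ltW B0)// -expRM_natl.
by congr (expR _ / _); field.
Qed.

Lemma expectation_tilt_root :
  P.-integrable [set: T] (EFin \o (fun x => tilt_root x ^+ 2)) /\
  \int[P]_x (tilt_root x ^+ 2) = 1.
Proof.
split.
  have := integrableZr measurableT B^-1 integrable_exp_score.
  by apply: eq_integrable => // x _ /=; rewrite tilt_root_sqr EFinM.
under eq_Rintegral do rewrite tilt_root_sqr.
rewrite RintegralZr//; last exact: integrable_exp_score.
by rewrite mulfV// gt_eqF.
Qed.

Lemma prod_tilt_root (w : n.-tuple T) :
  \prod_(i < n) (tilt_root (tnth w i) ^+ 2) = tilt r P l h w.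
Proof.
under eq_bigr do rewrite tilt_root_sqr.
rewrite big_split/= prodr_const card_ord exprVn /tilt -/Y; congr (_ / _).
by rewrite -expR_tsum.
Qed.

Let K := 1 + 4 * M (2 * D).

(** [K] collects two errors of order r^2: 1 for the Taylor remainder of the exponential and 4 M(2 D)
    for the normalization, since 1 - 1 / sqrt B <= B - 1. *)
Lemma tilt_root_remainder x :
  `|tilt_root x - 1 - 2^-1 * (r * Y x)| <= r ^+ 2 * K * expR (2 * a x).
Proof.
set v := r * Y x / 2.
have sB1 : 1 <= Num.sqrt B.
  by rewrite -[leLHS]sqrtr1 ler_sqrt ?(ltW B0)// tilt_norm_ge1.
have e1 : 1 - (Num.sqrt B)^-1 <= 4 * r ^+ 2 * M (2 * D).
  rewrite (@le_trans _ _ (B - 1))//; last first.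
    by have := tilt_norm_le; lra.
  have -> : B - 1 = (Num.sqrt B - 1) * (Num.sqrt B + 1).
    by rewrite -{1}(sqr_sqrtr (ltW B0)); ring.
  have -> : 1 - (Num.sqrt B)^-1 = (Num.sqrt B - 1) * (Num.sqrt B)^-1.
    by field; rewrite gt_eqF.
  rewrite ler_wpM2l ?subr_ge0// (@le_trans _ _ 1)//; last by rewrite lerDr.
  by rewrite invf_le1.
have e0 : 0 <= 1 - (Num.sqrt B)^-1 by rewrite subr_ge0 invf_le1.
rewrite (_ : tilt_root x - 1 - _ = (expR v - 1 - v) - expR v * (1 - (Num.sqrt B)^-1)); last first.
  by rewrite /tilt_root -/v /v; field; rewrite gt_eqF.
have -> : r ^+ 2 * K * expR (2 * a x) =
    r ^+ 2 * expR (2 * a x) + 4 * r ^+ 2 * M (2 * D) * expR (2 * a x).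
  by rewrite /K; ring.
rewrite (le_trans (ler_normB _ _))// lerD//.
  have va : `|v| <= r * a x / 2.
    by rewrite /v !normrM (ger0_norm r0) (@ger0_norm _ 2^-1)// ler_wpM2r// ler_wpM2l.
  have rax : r * a x <= a x by rewrite ler_piMl.
  have ax := a0 x.
  rewrite (le_trans (expR_sub2_le _))//.
  have E1 : expR `|v| <= expR (a x) by rewrite ler_expR; lra.
  have v2 : `|v| ^+ 2 <= (r * a x / 2) ^+ 2.
    have ra0 : 0 <= r * a x / 2 by exact: le_trans va.
    by rewrite lerXn2r ?nnegrE.
  rewrite (le_trans (ler_pM _ _ v2 E1)) ?sqr_ge0 ?expR_ge0//.
  rewrite (_ : (r * a x / 2) ^+ 2 * _ = r ^+ 2 * (a x ^+ 2 * expR (a x) / 4)); last by field.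
  rewrite ler_wpM2l ?sqr_ge0// ler_pdivrMr// (_ : 2 * a x = a x + a x); last by ring.
  rewrite expRD [leRHS]mulrAC ler_wpM2r ?expR_ge0// [leRHS]mulrC.
  by have := exprn_le_expR 1 ax; rewrite -natrX.
rewrite normrM (ger0_norm (expR_ge0 _)) (ger0_norm e0) mulrC.
rewrite ler_pM ?expR_ge0// ler_expR.
have : v <= r * a x / 2.
  rewrite ler_wpM2r// ler_wpM2l//; exact: le_trans (ler_norm _) (Ya x).
have : r * a x <= a x by rewrite ler_piMl.
by have := a0 x; lra.
Qed.

Lemma expectation_tilt_root_remainder :
  P.-integrable [set: T] (EFin \o (fun x => (tilt_root x - 1 - 2^-1 * (r * Y x)) ^+ 2)) /\
  \int[P]_x ((tilt_root x - 1 - 2^-1 * (r * Y x)) ^+ 2)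
    <= r ^+ 4 * K ^+ 2 * M (4 * D).
Proof.
have D20 : 0 <= 2 * D by rewrite mulr_ge0.
have aC2 : (\int[P]_x (expR (2 * (2 * a x)))%:E <= (M (4 * D))%:E)%E.
  rewrite (_ : 4 * D = 2 * (2 * D)); last by ring.
  by under eq_integral do rewrite (mulrA 2 D); exact: envelope_le lP _ D20.
have m2a : measurable_fun [set: T] (fun x => 2 * a x) by exact: measurable_funM.
have mf : measurable_fun [set: T] (fun x => (tilt_root x - 1 - 2^-1 * (r * Y x)) ^+ 2).
  apply: measurable_funX; apply: measurable_funB.
    by apply: measurable_funB => //; exact: measurable_tilt_root.
  by apply: measurable_funM => //; exact: measurable_funM.
have bf x : `|(tilt_root x - 1 - 2^-1 * (r * Y x)) ^+ 2| <=
    r ^+ 4 * K ^+ 2 * expR (2 * (2 * a x)).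
  rewrite (ger0_norm (sqr_ge0 _)) -real_normK ?num_real//.
  rewrite (_ : _ * expR _ = (r ^+ 2 * K * expR (2 * a x)) ^+ 2); last first.
    by rewrite (expRM_natl 2); ring.
  rewrite lerXn2r ?nnegrE//; last exact: tilt_root_remainder.
  exact: le_trans (tilt_root_remainder x).
split; first exact: (integrable_envelope m2a aC2 _ bf).
rewrite (le_trans (ler_norm _))//.
apply: (normr_expectation_envelope m2a aC2) => //.
by rewrite mulr_ge0 ?sqr_ge0// exprn_ge0.
Qed.

(** sqrt q and [tilt_root] share the expansion 1 + r Y / 2, so their squared distance is at most 2
    dl / n plus a term in r^4 = n^-2. With the mass defect dl / n of q and the factor n of
    [product_hellinger], this gives 3 dl and a term of order 1 / n. *)
Lemma tilt_likelihood_le (q : T -> R) (dl rho : R) :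
  measurable_fun [set: T] q -> (forall x, 0 <= q x) ->
  P.-integrable [set: T] (EFin \o q) -> \int[P]_x q x <= 1 ->
  1 - dl / n%:R <= \int[P]_x q x ->
  P.-integrable [set: T]
    (EFin \o (fun x => (Num.sqrt (q x) - 1 - 2^-1 * (r * Y x)) ^+ 2)) ->
  \int[P]_x ((Num.sqrt (q x) - 1 - 2^-1 * (r * Y x)) ^+ 2) <= dl / n%:R ->
  0 < rho ->
  \int[iprod P n]_w `|tilt r P l h w - \prod_(i < n) q (tnth w i)|
  <= (3 * dl + 2 * (K ^+ 2 * M (4 * D)) / n%:R) / (2 * rho) + 2 * rho.
Proof.
move=> mq q0 iq q1 qdl irem rem rho0.
have nR : 0 < n%:R :> R by rewrite ltr0n.
have sq x : Num.sqrt (q x) ^+ 2 = q x by rewrite sqr_sqrtr.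
have msq : measurable_fun [set: T] (fun x => Num.sqrt (q x)).
  by apply: measurableT_comp => //; apply: continuous_measurable_fun; exact: sqrt_continuous.
have [ig g1] := expectation_tilt_root.
have [irg rg] := expectation_tilt_root_remainder.
have isq : P.-integrable [set: T] (EFin \o (fun x => Num.sqrt (q x) ^+ 2)).
  by apply: eq_integrable iq => // x _ /=; rewrite sq.
have esq : \int[P]_x (Num.sqrt (q x) ^+ 2) = \int[P]_x q x.
  by apply: eq_Rintegral => x _; rewrite sq.
have := product_hellinger msq measurable_tilt_root (fun x => sqrtr_ge0 _)
  tilt_root_ge0 isq ig g1 _ n rho0.
rewrite esq => /(_ q1).
have -> : \int[iprod P n]_w `|\prod_(i < n) (tilt_root (tnth w i) ^+ 2) -
      \prod_(i < n) (Num.sqrt (q (tnth w i)) ^+ 2)| =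
    \int[iprod P n]_w `|tilt r P l h w - \prod_(i < n) q (tnth w i)|.
  apply: eq_Rintegral => w _; rewrite prod_tilt_root.
  by under [in LHS]eq_bigr do rewrite sq.
move=> H; rewrite (le_trans H)// lerD2r ler_wpM2r ?invr_ge0 ?mulr_ge0 ?(ltW rho0)//.
have Hsg : \int[P]_x ((Num.sqrt (q x) - tilt_root x) ^+ 2) <=
    2 * (dl / n%:R) + 2 * (r ^+ 4 * K ^+ 2 * M (4 * D)).
  pose F x := 2 * (Num.sqrt (q x) - 1 - 2^-1 * (r * Y x)) ^+ 2 +
    2 * (tilt_root x - 1 - 2^-1 * (r * Y x)) ^+ 2.
  have i1 := integrableZl measurableT 2 irem.
  have i2 := integrableZl measurableT 2 irg.
  have iF : P.-integrable [set: T] (EFin \o F).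
    by have := integrableD measurableT i1 i2; apply: eq_integrable.
  rewrite (@le_trans _ _ (\int[P]_x F x))//.
    rewrite (le_trans (ler_norm _))// le_normr_expectation//.
      by apply: measurable_funX; apply: measurable_funB => //; exact: measurable_tilt_root.
    move=> x; rewrite ger0_norm ?sqr_ge0// /F.
    set u := Num.sqrt _; set v := tilt_root x; set y := 2^-1 * _.
    by have := sqr_ge0 ((u - 1 - y) + (v - 1 - y)); rewrite !expr2; lra.
  rewrite /F RintegralD; [|exact: measurableT|exact: i1|exact: i2].
  rewrite (RintegralZl 2 measurableT irem) (RintegralZl 2 measurableT irg).
  by rewrite lerD// ler_wpM2l.
have -> : 3 * dl + 2 * (K ^+ 2 * M (4 * D)) / n%:R =
    n%:R * (dl / n%:R + (2 * (dl / n%:R) + 2 * (r ^+ 4 * K ^+ 2 * M (4 * D)))).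
  rewrite (_ : r ^+ 4 = n%:R^-1 ^+ 2); last by rewrite -rate_sqr -exprM.
  by field; rewrite gt_eqF.
by rewrite ler_wpM2l ?(ltW nR)// lerD//; lra.
Qed.

End local_approximation.

(** * Truncation and discretization of the tilt *)

Lemma expR_sub_minr_le (R : realType) (y c : R) :
  `|expR y - expR (Num.min y c)| <= expR (2 * y) * expR (- c).
Proof.
rewrite -expRD; have [yc|cy] := leP y c; first by rewrite subrr normr0 expR_ge0.
rewrite ger0_norm; last by rewrite subr_ge0 ler_expR ltW.
rewrite (@le_trans _ _ (expR y)) ?gerBl ?expR_ge0// ler_expR; lra.
Qed.

Lemma expR_minr_lipschitz (R : realType) (y z c : R) :
  `|expR (Num.min y c) - expR (Num.min z c)| <= expR c * `|y - z|.
Proof.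
have main u v : v <= u -> u <= c -> `|expR u - expR v| <= expR c * (u - v).
  move=> vu uc; rewrite ger0_norm; last by rewrite subr_ge0 ler_expR.
  rewrite (@le_trans _ _ (expR u * (u - v)))//; last first.
    by rewrite ler_wpM2r ?subr_ge0// ler_expR.
  have := expR_ge1Dx (v - u); rewrite -(ler_pM2l (expR_gt0 u)) -expRD.
  by rewrite (_ : u + (v - u) = v); [lra|ring].
have mc w : Num.min w c <= c by rewrite ge_min lexx orbT.
wlog zy : y z / z <= y.
  move=> hw; have [/hw//|/ltW yz] := leP z y.
  by rewrite distrC (distrC y); exact: hw.
have zy' : Num.min z c <= Num.min y c.
  by rewrite le_min mc ge_min zy.
rewrite (le_trans (main _ _ zy' (mc y)))// ler_wpM2l ?expR_ge0//.
rewrite (ger0_norm (_ : 0 <= y - z)) ?subr_ge0//.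
by case: (leP y c); case: (leP z c) => *; lra.
Qed.

Lemma sqr_le_expRD (R : realType) (x : R) : x ^+ 2 <= 2 * (expR x + expR (- x)).
Proof.
rewrite -(real_normK (num_real x)).
have := expR_ge1Dxn 1 (normr_ge0 x); rewrite (_ : 2`! = 2)%N// => h.
have [x0|x0] := leP 0 x.
  by move: h; rewrite ger0_norm//; have := expR_ge0 (- x); lra.
by move: h; rewrite ltr0_norm//; have := expR_ge0 x; lra.
Qed.

Section discretization.
Context d (T : measurableType d) (R : realType) (m : nat).
Variables (P : probability T R) (l : T -> 'rV[R]_m) (M : R -> R).
Hypothesis lP : score_class M P l.
Variables (n : nat) (n0 : (0 < n)%N).
Notation r := (rate R n).
Notation Q := (iprod P n).

(** The moment is B^n <= (1 + 4 M(2 E) / n)^n <= e^(4 M(2 E)), a bound free of n: the substitute for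
    tightness of [Delta]. *)
Lemma exp_moment (E : R) (v : 'rV[R]_m) : 0 <= E -> (forall i, `|v ord0 i| <= E) ->
  Q.-integrable [set: _] (EFin \o (fun w => expR (dotv v (Delta r l w)))) /\
  \int[Q]_w expR (dotv v (Delta r l w)) <= expR (4 * M (2 * E)).
Proof.
move=> E0 vE.
have mY := measurable_dotv_score lP v; have ma := measurable_envelope lP E.
have Ya x := normr_dotv_le (l x) vE; have aC := envelope_le lP E0.
have Y0 := expectation_dotv lP v.
have r0 := rate_ge0 R n; have r1 := rate_le1 R n0.
have [i e] := integrable_expR_tsum mY ma Ya Ya aC r0 r1 n.
have eD : (fun w : n.-tuple T => expR (dotv v (Delta r l w))) =
    (fun w => expR (r * tsum (fun x => dotv v (l x)) w)).
  by apply/funext => w; rewrite dotv_Delta.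
rewrite eD; split => //; rewrite e.
have B1 := tilt_mass_ge1 mY ma Ya Ya aC Y0 r0 r1.
have BM := tilt_mass_le mY ma Ya Ya aC Y0 r0 r1.
rewrite (@le_trans _ _ (expR (4 * r ^+ 2 * M (2 * E)) ^+ n))//.
  by rewrite lerXn2r ?nnegrE ?expR_ge0 ?(le_trans _ B1)// (le_trans BM)// expR_ge1Dx.
rewrite -expRM_natl rate_sqr ler_expR le_eqVlt; apply/orP; left; apply/eqP.
by field; rewrite pnatr_eq0 -lt0n.
Qed.

Let delta (e : R) i : 'rV[R]_m := e *: delta_mx ord0 i.

Let dotv_delta e i z : dotv (delta e i) z = e * z ord0 i.
Proof.
rewrite /dotv (bigD1 i)//= big1 => [|j ji]; last first.
  by rewrite !mxE (negbTE ji) andbF mulr0 mul0r.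
by rewrite !mxE !eqxx mulr1 addr0.
Qed.

Variables (D : R) (h : 'rV[R]_m).
Hypotheses (D0 : 0 <= D) (hD : forall i, `|h ord0 i| <= D).
Variables (K : finType) (phi : K -> 'rV[R]_m -> R) (a : K -> 'rV[R]_m) (L : nat).
Hypotheses (L0 : (0 < L)%N) (tphi : forall j, trig (phi j)).
Hypotheses (phi0 : forall j z, 0 <= phi j z) (phi1 : forall z, \sum_j phi j z = 1).
Hypothesis phia : forall z i, \sum_j phi j z * `|z ord0 i - a j ord0 i|
  <= (2 + z ord0 i ^+ 2) / L%:R.
Variable c : R.

Notation B := (\int[P]_x expR (r * dotv h (l x))).

(** The value of the tilt at the node a_j, truncated: the truncated exponential is Lipschitz with
    constant e^c. *)
Definition node_value j : R := expR (Num.min (dotv h (a j)) c) / B ^+ n.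

Let Bn1 : 1 <= B ^+ n.
Proof. by apply: exprn_ege1; exact: (tilt_norm_ge1 lP D0 hD n0). Qed.

Let pointwise (w : n.-tuple T) : \sum_j phi j (Delta r l w) * `|node_value j - tilt r P l h w| <=
  expR (- c) * expR (dotv (2 *: h) (Delta r l w)) +
  expR c * D / L%:R * (\sum_(i < m) (2 +
    2 * (expR (dotv (delta 1 i) (Delta r l w)) + expR (dotv (delta (-1) i) (Delta r l w))))).
Proof.
set z := Delta r l w.
have -> : tilt r P l h w = expR (dotv h z) / B ^+ n by rewrite /tilt dotv_Delta.
have d2 : dotv (2 *: h) z = 2 * dotv h z.
  by rewrite !dotvE -scalemxAl mxE.
apply: (@le_trans _ _ (\sum_j phi j z * (expR (- c) * expR (dotv (2 *: h) z)) +
    expR c * D * \sum_(i < m) \sum_j phi j z * `|z ord0 i - a j ord0 i|)).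
  rewrite exchange_big mulr_sumr -big_split/=; apply: ler_sum => j _.
  rewrite -mulr_sumr (mulrCA (expR c * D)) -mulrDr ler_wpM2l//.
  rewrite -mulrBl normrM normfV (ger0_norm (le_trans ler01 Bn1)).
  rewrite ler_pdivrMr ?(lt_le_trans ltr01)//.
  apply: (@le_trans _ _ (`|expR (dotv h z) - expR (Num.min (dotv h z) c)| +
      `|expR (Num.min (dotv h z) c) - expR (Num.min (dotv h (a j)) c)|)).
    rewrite distrC; apply: le_trans (ler_normD _ _).
    by rewrite addrA subrK.
  rewrite -[leLHS]mulr1 ler_pM ?addr_ge0//.
  rewrite lerD//; first by rewrite d2 mulrC expR_sub_minr_le.
  rewrite (le_trans (expR_minr_lipschitz _ _ _))// -mulrA ler_wpM2l ?expR_ge0//.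
  have -> : dotv h z - dotv h (a j) = dotv h (z - a j).
    by rewrite /dotv -sumrB; apply: eq_bigr => i _; rewrite -mulrBr !mxE.
  have zi i : (z - a j) ord0 i = z ord0 i - a j ord0 i by rewrite !mxE.
  have := normr_dotv_le (z - a j) hD; rewrite /l1norm.
  by under eq_bigr do rewrite zi.
rewrite -mulr_suml phi1 mul1r lerD2l -[leRHS]mulrA ler_wpM2l ?mulr_ge0 ?expR_ge0//.
rewrite mulrC mulr_suml; apply: ler_sum => i _.
rewrite (le_trans (phia _ _))// ler_wpM2r ?invr_ge0// lerD2l !dotv_delta mul1r mulN1r.
exact: sqr_le_expRD.
Qed.

(** The first term is the part beyond the truncation level, the second the Lipschitz error at the
    nodes. One is made small by [c], the other then by [L]; n occurs in neither. *)
Lemma discretization_le :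
  \sum_j \int[Q]_w (phi j (Delta r l w) * `|node_value j - tilt r P l h w|) <=
  expR (- c) * expR (4 * M (4 * D)) +
  expR c * D / L%:R * (m%:R * (2 + 4 * expR (4 * M 2))).
Proof.
have mD i : measurable_fun [set: n.-tuple T] (fun w => Delta r l w ord0 i).
  exact: measurable_Delta lP n i.
have it := integrable_tilt_tuple lP n0 D0 hD.
have mt : measurable_fun [set: n.-tuple T] (tilt r P l h).
  by apply/measurable_EFinP; case/integrableP : it.
have mphi j : measurable_fun [set: n.-tuple T] (fun w => phi j (Delta r l w)).
  exact: measurable_trig.
have phil j z : phi j z <= 1.
  by rewrite -(phi1 z) (bigD1 j)//= lerDl sumr_ge0.
have ij j : Q.-integrable [set: _]
    (EFin \o (fun w => phi j (Delta r l w) * `|node_value j - tilt r P l h w|)).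
  apply: (@integrable_dominated _ _ _ Q _ (fun w => `|node_value j - tilt r P l h w|)).
  - by apply: measurable_funM => //; apply: measurableT_comp => //; exact: measurable_funB.
  - by move=> w; rewrite normrM normr_id ger0_norm// ler_piMl.
  - apply: integrable_norm; have := integrableB measurableT (integrable_cst Q (node_value j)) it.
    by apply: eq_integrable => // w _ /=; rewrite EFinB.
have [iS <-] := Rintegral_sum (index_enum K) measurableT ij.
have D20 : 0 <= 2 * D by rewrite mulr_ge0.
have h2 i : `|(2 *: h) ord0 i| <= 2 * D.
  by rewrite mxE normrM ger0_norm// ler_wpM2l.
have [i2h e2h] := exp_moment D20 h2.
have dbound (e : R) i : `|e| = 1 -> forall j, `|delta e i ord0 j| <= 1.
  move=> e1 j; rewrite !mxE normrM e1 mul1r.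
  by case: (_ && _); rewrite ?normr1 ?normr0.
have e1 i := exp_moment ler01 (dbound 1 i (normr1 R)).
have nN1 : `|-1 : R| = 1 by rewrite normrN normr1.
have eN1 i := exp_moment ler01 (dbound (-1) i nN1).
pose G i (w : n.-tuple T) := 2 + 2 * (expR (dotv (delta 1 i) (Delta r l w))
  + expR (dotv (delta (-1) i) (Delta r l w))).
have iG i : Q.-integrable [set: _] (EFin \o G i) /\ \int[Q]_w G i w <= 2 + 4 * expR (4 * M 2).
  have iD := integrableD measurableT (e1 i).1 (eN1 i).1.
  have i2 := integrableZl measurableT 2 iD.
  split; first by have := integrableD measurableT (integrable_cst Q 2) i2; apply: eq_integrable.
  rewrite /G RintegralD; [|exact: measurableT|exact: integrable_cst|exact: i2].
  rewrite expectation_cst lerD2l RintegralZl; [|exact: measurableT|exact: iD].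
  rewrite (RintegralD measurableT (e1 i).1 (eN1 i).1).
  by have := (e1 i).2; have := (eN1 i).2; rewrite mulr1; lra.
have [iSG eSG] := Rintegral_sum (index_enum 'I_m) measurableT (fun i => (iG i).1).
have j1 := integrableZl measurableT (expR (- c)) i2h.
have j2 := integrableZl measurableT (expR c * D / L%:R) iSG.
pose F w := expR (- c) * expR (dotv (2 *: h) (Delta r l w)) +
  expR c * D / L%:R * \sum_(i < m) G i w.
have iF : Q.-integrable [set: _] (EFin \o F).
  by have := integrableD measurableT j1 j2; apply: eq_integrable.
apply: (@le_trans _ _ (\int[Q]_w F w)).
  by apply: le_Rintegral => // w _; exact: pointwise.
rewrite /F RintegralD; [|exact: measurableT|exact: j1|exact: j2].
rewrite (RintegralZl _ measurableT i2h) (RintegralZl _ measurableT iSG).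
rewrite lerD ?ler_wpM2l ?expR_ge0//.
  by rewrite (le_trans e2h)// ler_expR (_ : 2 * (2 * D) = 4 * D)//; ring.
  by rewrite !mulr_ge0 ?expR_ge0 ?invr_ge0.
rewrite eSG (le_trans (ler_sum _ (fun i _ => (iG i).2)))//.
by rewrite sumr_const card_ord [m%:R * _]mulr_natl.
Qed.

End discretization.

(* q is a subdensity of P' with respect to P: no domination is assumed, the
   singular part of P' has mass at most dl / n. *)
Definition local_density d (T : measurableType d) (R : realType) (m : nat)
    (P P' : probability T R) (l : T -> 'rV[R]_m) (h : 'rV[R]_m) (n : nat)
    (dl : R) (q : T -> R) : Prop :=
  [/\ measurable_fun [set: T] q, (forall x, 0 <= q x),
      (forall A, measurable A -> (\int[P]_(x in A) (q x)%:E <= P' A)%E),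
      1 - dl / n%:R <= \int[P]_x q x &
      P.-integrable [set: T] (EFin \o (fun x =>
        (Num.sqrt (q x) - 1 - 2^-1 * (rate R n * dotv h (l x))) ^+ 2)) /\
      \int[P]_x ((Num.sqrt (q x) - 1 - 2^-1 * (rate R n * dotv h (l x))) ^+ 2)
        <= dl / n%:R].

Lemma near_div_le (R : realType) (c k : R) : 0 < k ->
  \forall n \near \oo, c / n%:R <= k.
Proof.
move=> k0; near=> n.
have n0 : 0 < n%:R :> R by rewrite ltr0n; near: n; exists 1%N.
rewrite ler_pdivrMr// mulrC -ler_pdivrMr//.
by near: n; exact: nbhs_infty_ger.
Unshelve. all: by end_near. Qed.

(** * The one-sided bound for Gaussian mixtures *)

Section core.
Context d (T : measurableType d) (R : realType) (m : nat).

Let sum_cst_le (K : finType) (F : K -> R) (e : R) : 0 <= e ->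
  (forall j, F j <= e / #|K|.+1%:R) -> \sum_j F j <= e.
Proof.
move=> e0 Fe; rewrite (le_trans (ler_sum _ (fun j _ => Fe j)))//.
rewrite sumr_const -[leLHS]mulr_natr -mulrA ler_piMr// mulrC ler_pdivrMr ?ltr0n//.
by rewrite mul1r ler_nat.
Qed.

(** The order of quantifiers is the point: [dl] and the partition precede n, the laws [kappa] depend
    on P and l, and h, nu, P' and q come last. Hence one kernel serves all h, and one threshold all
    laws of the class. *)
Lemma gaussian_mixture_le (M : R -> R) (D eps : R) : 0 <= D -> 0 < eps ->
  exists (dl : R) (K : finType) (phi : K -> 'rV[R]_m -> R),
    [/\ 0 < dl, forall j, trig (phi j), forall j z, 0 <= phi j z,
        forall z, \sum_j phi j z = 1 &
    \forall n \near \oo, forall (P : probability T R) (l : T -> 'rV[R]_m),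
      score_class M P l -> info P l \in unitmx ->
      exists kappa : K -> probability (n.-tuple T) R,
      forall (h : 'rV[R]_m) (nu : probability (m.-tuple R) R)
          (P' : probability T R) (q : T -> R),
        (forall i, `|h ord0 i| <= D) ->
        is_gaussian nu h (invmx (info P l)) ->
        local_density P P' l h n dl q ->
        forall A, measurable A ->
          \sum_j (\int[nu]_x phi j (mxact (info P l) x)) * fine (kappa j A)
          <= fine (iprod P' n A) + eps].
Proof.
move=> D0 e0.
(* Budget: eps / 4 for the limit theorem, eps / 4 for the discretization, and eps / 8 each for 3 dl
   / (2 rho), the term of order 1 / n and 2 rho. *)
pose rho := eps / 16; pose dl := eps * rho / 12.
have rho0 : 0 < rho by rewrite divr_gt0.
have dl0 : 0 < dl by rewrite !mulr_gt0.
(* Then e^(-c) e^X = e^(-16 / eps) <= eps / 16, because 16 / eps <= e^(16 / eps). *)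
pose X := 4 * M (4 * D); pose c := X + 16 / eps.
have cX : expR (- c) * expR X <= eps / 16.
  rewrite -expRD (_ : - c + X = - (16 / eps)); last by rewrite /c; ring.
  rewrite expRN -[leRHS]invrK lef_pV2 ?posrE ?expR_gt0 ?invr_gt0 ?divr_gt0//.
  by rewrite invf_div (le_trans _ (expR_ge1Dx _))// lerDr.
pose Z := expR c * D * (m%:R * (2 + 4 * expR (4 * M 2))).
have Z0 : 0 <= Z by rewrite !mulr_ge0 ?expR_ge0 ?addr_ge0 ?mulr_ge0 ?expR_ge0.
(* Exceeds 16 Z / eps, so the Lipschitz error Z / L is at most eps / 16. *)
pose L := (Num.truncn (16 * Z / eps)).+1.
have L0 : (0 < L)%N by [].
have lZ : expR c * D / L%:R * (m%:R * (2 + 4 * expR (4 * M 2))) <= eps / 16.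
  rewrite (_ : _ * _ = Z / L%:R); last by rewrite /Z; ring.
  have hL : 16 * Z / eps < L%:R by exact: truncnS_gt.
  rewrite ler_pdivrMr ?ltr0n//; move: hL; rewrite ltr_pdivrMr//; lra.
have [K [phi [a [tphi phi0 phi1 phia]]]] := @trig_partition R m L L0.
exists dl, K, phi; split => //.
have phil j z : phi j z <= 1.
  by rewrite -(phi1 z) (bigD1 j)//= lerDl sumr_ge0.
pose e' := eps / 4 / #|K|.+1%:R.
have e'0 : 0 < e' by rewrite !divr_gt0.
pose Kst := (1 + 4 * M (2 * D)) ^+ 2 * M (4 * D).
have clt : \forall n \near \oo, forall j, forall P l (h : 'rV[R]_m) (nu : probability (m.-tuple R) R),
    @score_class _ T R m M P l -> (forall i, `|h ord0 i| <= D) ->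
    info P l \in unitmx -> is_gaussian nu h (invmx (info P l)) ->
    `|\int[iprod P n]_w (tilt (rate R n) P l h w * phi j (Delta (rate R n) l w))
      - \int[nu]_x phi j (mxact (info P l) x)| <= e'.
  by apply: filter_forall => j; exact: (@trig_clt _ T R m _ (tphi j) M _ _ D0 e'0).
have nearK := near_div_le (2 * Kst / (2 * rho)) (divr_gt0 e0 (ltr0Sn R 7)).
near=> n.
have n0 : (0 < n)%N by near: n; exists 1%N.
have nK : (2 * Kst / n%:R) / (2 * rho) <= eps / 8 by rewrite mulrAC; near: n.
have cltn : forall j P l (h : 'rV[R]_m) (nu : probability (m.-tuple R) R),
    @score_class _ T R m M P l -> (forall i, `|h ord0 i| <= D) ->
    info P l \in unitmx -> is_gaussian nu h (invmx (info P l)) ->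
    `|\int[iprod P n]_w (tilt (rate R n) P l h w * phi j (Delta (rate R n) l w))
      - \int[nu]_x phi j (mxact (info P l) x)| <= e'.
  by near: n.
move=> P l lP Ju.
pose r := rate R n.
have mD i : measurable_fun [set: n.-tuple T] (fun w => Delta r l w ord0 i).
  exact: measurable_Delta lP n i.
have mphi j : measurable_fun [set: n.-tuple T] (fun w => phi j (Delta r l w)).
  exact: measurable_trig.
exists (fun j => reweight (iprod P n) (mphi j) (fun w => phi0 j _)).
move=> h nu P' q hD nuG [mq q0 qP' q1 [irem rem]] A mA.
set kappa := fun j => reweight (iprod P n) (mphi j) (fun w => phi0 j _).
have it := integrable_tilt_tuple lP n0 D0 hD.
have t0 w : 0 <= tilt r P l h w.
  rewrite divr_ge0 ?expR_ge0// exprn_ge0// Rintegral_ge0// => x _; exact: expR_ge0.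
pose e j := \int[iprod P n]_w (tilt r P l h w * phi j (Delta r l w)).
pose cj j := node_value P l n h a c j.
have k0 j : 0 <= fine (kappa j A) by rewrite fine_ge0.
have k1 j : fine (kappa j A) <= 1.
  have := probability_le1 (kappa j) mA.
  by rewrite -lee_fin fineK// fin_num_measure.
have step1 : \sum_j (\int[nu]_x phi j (mxact (info P l) x)) * fine (kappa j A) <=
    \sum_j e j * fine (kappa j A) + eps / 4.
  rewrite -lerBlDl -sumrB; apply: sum_cst_le; first by rewrite divr_ge0// ltW.
  move=> j; rewrite -mulrBl (@le_trans _ _ (e' * 1))//; last by rewrite mulr1.
  rewrite (le_trans (ler_norm _))// normrM (ger0_norm (k0 _)) ler_pM//.
  by rewrite distrC; exact: cltn.
have mt : measurable_fun [set: n.-tuple T] (tilt r P l h).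
  by apply/measurable_EFinP; case/integrableP : it.
have ite j : (iprod P n).-integrable [set: _]
    (EFin \o (fun w => tilt r P l h w * phi j (Delta r l w))).
  apply: (@integrable_dominated _ _ _ (iprod P n) _ (tilt r P l h)) => //.
    exact: measurable_funM.
  by move=> w; rewrite normrM !ger0_norm// ler_piMr.
have AS f : (iprod P n).-integrable [set: _] (EFin \o f) ->
    (iprod P n).-integrable A (EFin \o f).
  by move=> i; apply: integrableS i.
have step2 : \sum_j e j * fine (kappa j A) <=
    \int[iprod P n]_(w in A) tilt r P l h w + 2 * (eps / 16 + eps / 16).
  have -> : \int[iprod P n]_(w in A) tilt r P l h w =
      \sum_j \int[iprod P n]_(w in A) (tilt r P l h w * phi j (Delta r l w)).
    have [_ <-] := Rintegral_sum (index_enum K) mA (fun j => AS _ (ite j)).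
    by apply: eq_Rintegral => w _; rewrite -mulr_sumr phi1 mulr1.
  have disc := discretization_le lP n0 D0 hD tphi phi0 phi1 phia c.
  have h2 : \sum_j e j * fine (kappa j A) <=
      \sum_j (\int[iprod P n]_(w in A) (tilt r P l h w * phi j (Delta r l w)) +
       2 * \int[iprod P n]_w (phi j (Delta r l w) * `|cj j - tilt r P l h w|)).
    apply: ler_sum => j _; apply: reweight_le => //.
  rewrite (le_trans h2)// big_split/= lerD2l -mulr_sumr ler_wpM2l//.
  by rewrite (le_trans disc)// lerD.
pose Pi (w : n.-tuple T) := \prod_(i < n) q (tnth w i).
have Pi0 w : 0 <= Pi w by exact: prodr_ge0.
have qle : (\int[P]_x (q x)%:E <= 1%:E)%E.
  by rewrite -(probability_setT P'); exact: qP'.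
have iq : P.-integrable [set: T] (EFin \o q) by exact: integrable_le_cst qle.
have q1' : \int[P]_x q x <= 1 by exact: Rintegral_le_cst.
have iPi : (iprod P n).-integrable [set: _] (EFin \o Pi).
  exact: (integrable_iprod_prod n mq q0 iq).1.
have mPi : measurable_fun [set: n.-tuple T] Pi.
  by apply/measurable_EFinP; case/integrableP : iPi.
(* Tensorized subdensity inequality, tested on the indicator of A. *)
have PiA : \int[iprod P n]_(w in A) Pi w <= fine (iprod P' n A).
  rewrite -lee_fin [X in (_ <= X)%E]fineK ?fin_num_measure// /Rintegral fineK; last first.
    by apply: integrable_fin_num => //; exact: AS.
  have m1 : measurable_fun [set: n.-tuple T] (fun w => (\1_A w)%:E : \bar R).
    exact/measurable_EFinP.
  have f0 (w : n.-tuple T) : (0 <= (\1_A w)%:E :> \bar R)%E by rewrite lee_fin.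
  have := iprod_density_le mq q0 qP' m1 f0.
  rewrite integral_indic// setIT; apply: le_trans.
  rewrite [leLHS]integral_mkcond epatch_indic le_eqVlt; apply/orP; left; apply/eqP.
  by apply: eq_integral => w _; rewrite /= muleC.
have step3 : \int[iprod P n]_(w in A) tilt r P l h w <= fine (iprod P' n A)
    + ((3 * dl + 2 * Kst / n%:R) / (2 * rho) + 2 * rho).
  rewrite -lerBlDl.
  apply: le_trans (tilt_likelihood_le lP D0 hD n0 mq q0 iq q1' q1 irem rem rho0).
  apply: le_trans (lerB (lexx _) PiA) _.
  have iB : (iprod P n).-integrable [set: _] (EFin \o (fun w => tilt r P l h w - Pi w)).
    by have := integrableB measurableT it iPi; apply: eq_integrable.
  have iBn : (iprod P n).-integrable [set: _] (EFin \o (fun w => `|tilt r P l h w - Pi w|)).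
    exact: integrable_norm iB.
  rewrite -RintegralB//; [|exact: AS|exact: AS].
  rewrite (le_trans (ler_norm _))// (le_trans (le_normr_Rintegral _ _))//; first exact: AS.
  rewrite -lee_fin EFin_Rintegral// /Rintegral fineK; last first.
    by apply: integrable_fin_num => //; exact: AS.
  apply: ge0_subset_integral => //.
    by apply/measurable_EFinP/measurable_EFinP; case/integrableP : iBn.
have : 3 * dl / (2 * rho) = eps / 8.
  by rewrite /dl; field; rewrite gt_eqF.
rewrite /rho in step3 nK *; lra.
Unshelve. all: by end_near. Qed.

End core.

(** * Uniform differentiability in quadratic mean *)

(* Applied to a local Lipschitz bound, this replaces the derivative of
   t |-> sqrt(p_{theta + t h}), which exists only in L^2. *)
Lemma interval_induction (R : realType) (Q : R -> Prop) :
  Q 0 ->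
  (forall t : R, 0 <= t <= 1 -> exists2 e : R, 0 < e & forall s : R, 0 <= s <= 1 ->
    `|s - t| < e -> (s < t -> Q s -> Q t) /\ (t < s -> Q t -> Q s)) ->
  Q 1.
Proof.
move=> Q0 step; pose E := [set t | 0 <= t <= 1 /\ Q t].
have E0 : E 0 by split=> //; rewrite lexx ler01.
have ubE : ubound E 1 by move=> t [/andP[_ ->]].
have hsE : has_sup E by split; [exists 0|exists 1].
pose t := sup E.
have t01 : 0 <= t <= 1.
  apply/andP; split; first by apply: ub_le_sup => //; exists 1.
  by apply: ge_sup => //; exists 0.
have [e e0 he] := step _ t01.
have Qt : Q t.
  have [s Es ts] := sup_adherent e0 hsE.
  have st : s <= t by apply: ub_le_sup => //; exists 1.
  case: Es => s01 Qs; move: st; rewrite le_eqVlt => /predU1P[<-//|st].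
  have : `|s - t| < e by rewrite ltr0_norm ?subr_lt0// opprB ltrBlDl -ltrBlDr.
  by move=> /(he _ s01)[/(_ st Qs)].
have [t1|t1] := eqVneq t 1; first by rewrite -t1.
have {}t1 : t < 1 by rewrite lt_neqAle t1; case/andP: t01.
pose s := Num.min 1 (t + e / 2).
have ts : t < s by rewrite lt_min t1 ltrDl divr_gt0.
have s01 : 0 <= s <= 1.
  by rewrite (le_trans _ (ltW ts))/= ?ge_min ?lexx//; case/andP: t01.
have Qs : Q s.
  have : `|s - t| < e.
    rewrite gtr0_norm ?subr_gt0// ltrBlDl gt_min; apply/orP; right.
    by rewrite ltrD2l ltr_pdivrMr// ltr_pMr// ltr1n.
  by move=> /(he _ s01)[_ /(_ ts Qt)].
have : s <= t by apply: ub_le_sup; [exists 1|split].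
by rewrite leNgt ts.
Qed.

Section L2.
Context d (T : measurableType d) (R : realType).
Variable mu : {measure set T -> \bar R}.
Implicit Types (f g : T -> R) (a b : R).

(** A bound on the L^2 norm through squares in the extended reals, which includes its finiteness.
    The radius [a] is meant to be nonnegative. *)
Definition L2le f a := (\int[mu]_x ((f x) ^+ 2)%:E <= (a ^+ 2)%:E)%E.

Lemma L2leW f a b : 0 <= a -> a <= b -> L2le f a -> L2le f b.
Proof.
move=> a0 ab; move=> /le_trans; apply; rewrite lee_fin.
by rewrite lerXn2r ?nnegrE// (le_trans a0).
Qed.

Let msqr f : measurable_fun [set: T] f ->
  measurable_fun [set: T] (fun x => (f x ^+ 2)%:E).
Proof. by move=> mf; apply/measurable_EFinP; exact: measurable_funX. Qed.

Lemma L2leZ k f a : measurable_fun [set: T] f -> L2le f a ->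
  L2le (fun x => k * f x) (`|k| * a).
Proof.
move=> mf; rewrite /L2le => fa.
under eq_integral do rewrite exprMn EFinM.
rewrite ge0_integralZl//; first 1 last.
- exact: msqr.
- by move=> x _; rewrite lee_fin sqr_ge0.
- by rewrite lee_fin sqr_ge0.
rewrite exprMn real_normK ?num_real// (EFinM (k ^+ 2)).
by apply: lee_pmul => //; rewrite ?lee_fin ?sqr_ge0// integral_ge0// => x _; rewrite lee_fin sqr_ge0.
Qed.

(* (f + g)^2 <= (1 + b/a) f^2 + (1 + a/b) g^2 *)
Lemma L2leD f g a b : measurable_fun [set: T] f -> measurable_fun [set: T] g ->
  0 < a -> 0 < b -> L2le f a -> L2le g b -> L2le (fun x => f x + g x) (a + b).
Proof.
move=> mf mg a0 b0 fa gb; rewrite /L2le.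
have ka : 0 <= 1 + b / a by rewrite addr_ge0// divr_ge0// ltW.
have kb : 0 <= 1 + a / b by rewrite addr_ge0// divr_ge0// ltW.
apply: (@le_trans _ _ (\int[mu]_x
    ((1 + b / a)%:E * (f x ^+ 2)%:E + (1 + a / b)%:E * (g x ^+ 2)%:E)))%E.
  apply: ge0_le_integral => //.
  - by move=> x _; rewrite lee_fin sqr_ge0.
  - by apply: msqr; exact: measurable_funD.
  - by apply: emeasurable_funD; apply: emeasurable_funM => //; exact: msqr.
  move=> x _; rewrite -!EFinM -EFinD lee_fin -subr_ge0.
  rewrite (_ : _ - _ = a / b * (b / a * f x - g x) ^+ 2); last first.
    by field; rewrite !gt_eqF.
  by rewrite mulr_ge0 ?sqr_ge0// divr_ge0// ltW.
rewrite ge0_integralD//; last 4 first.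
- by move=> x _; rewrite mule_ge0// lee_fin sqr_ge0.
- by apply: emeasurable_funM => //; exact: msqr.
- by move=> x _; rewrite mule_ge0// lee_fin sqr_ge0.
- by apply: emeasurable_funM => //; exact: msqr.
rewrite !ge0_integralZl//; last 4 first.
- exact: msqr.
- by move=> x _; rewrite lee_fin sqr_ge0.
- exact: msqr.
- by move=> x _; rewrite lee_fin sqr_ge0.
apply: (@le_trans _ _ ((1 + b / a)%:E * (a ^+ 2)%:E + (1 + a / b)%:E * (b ^+ 2)%:E))%E.
  by apply: leeD; apply: lee_pmul => //; rewrite ?lee_fin// integral_ge0// => x _; rewrite lee_fin sqr_ge0.
rewrite -!EFinM -EFinD lee_fin le_eqVlt; apply/orP; left; apply/eqP.
by field; rewrite !gt_eqF.
Qed.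

(** The extra unit gives the empty sum a positive radius, as [L2leD] demands. *)
Lemma L2le_sum (I : eqType) (r : seq I) (F : I -> T -> R) a :
  0 < a -> (forall i, measurable_fun [set: T] (F i)) -> (forall i, L2le (F i) a) ->
  L2le (fun x => \sum_(i <- r) F i x) ((size r).+1%:R * a).
Proof.
move=> a0 mF Fa; elim: r => [|i r IH].
  rewrite mul1r /L2le (_ : (fun x => _) = cst 0%E).
    by rewrite integral0 lee_fin sqr_ge0.
  by apply/funext => x /=; rewrite big_nil expr0n.
rewrite (_ : (fun x => _) = fun x => F i x + \sum_(j <- r) F j x); last first.
  by apply/funext => x; rewrite big_cons.
rewrite -[(size (i :: r)).+1]add1n natrD mulrDl mul1r.
apply: L2leD => //; first exact: measurable_sum.
by rewrite mulr_gt0// ltr0n.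
Qed.

(** Mean value inequality for a curve in L^2: increments that are locally close to multiples of [v]
    add up along [0, 1] by the triangle inequality, through [interval_induction]. *)
Lemma L2_mean_value (u : R -> T -> R) (v : T -> R) (c : R) :
  (forall t : R, 0 <= t <= 1 -> measurable_fun [set: T] (u t)) ->
  measurable_fun [set: T] v -> 0 < c ->
  (forall t : R, 0 <= t <= 1 -> exists2 e : R, 0 < e & forall s : R, 0 <= s <= 1 ->
    `|s - t| < e -> s != t ->
    L2le (fun x => u s x - u t x - (s - t) * v x) (c * `|s - t|)) ->
  L2le (fun x => u 1 x - u 0 x - v x) (2 * c).
Proof.
move=> mu_ mv c0 H.
have m01 : 0 <= (0 : R) <= 1 by rewrite lexx ler01.
have mw s t : 0 <= s <= 1 -> 0 <= t <= 1 ->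
    measurable_fun [set: T] (fun x => u s x - u t x - (s - t) * v x).
  move=> s01 t01; apply: measurable_funB; last exact: measurable_funM.
  by apply: measurable_funB; exact: mu_.
(* The offset [c] keeps the radius positive at t = 0; it accounts for the factor 2 in the
   conclusion. *)
pose Q t := L2le (fun x => u t x - u 0 x - (t - 0) * v x) (c * t + c).
have step s t : 0 <= s <= 1 -> 0 <= t <= 1 -> s < t ->
    L2le (fun x => u t x - u s x - (t - s) * v x) (c * (t - s)) -> Q s -> Q t.
  move=> s01 t01 st h Qs; rewrite /Q.
  have -> : (fun x => u t x - u 0 x - (t - 0) * v x) =
      (fun x => (u t x - u s x - (t - s) * v x) + (u s x - u 0 x - (s - 0) * v x)).
    by apply/funext => x; ring.
  rewrite (_ : c * t + c = c * (t - s) + (c * s + c)); last by ring.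
  apply: L2leD => //; [exact: mw|exact: mw| |].
  - by rewrite mulr_gt0// subr_gt0.
  - by rewrite ltr_wpDl// mulr_ge0// ?(ltW c0)//; case/andP: s01.
suff : Q 1.
  rewrite /Q mulr1 -mulr2n mulr_natl.
  rewrite (_ : (fun x => _ - _ * v x) = (fun x => u 1 x - u 0 x - v x))//.
  by apply/funext => x; rewrite subr0 mul1r.
apply: (@interval_induction R Q).
  rewrite /Q /L2le mulr0 add0r (_ : (fun x => _) = cst 0%E).
    by rewrite integral0 lee_fin sqr_ge0.
  by apply/funext => x /=; congr EFin; ring.
move=> t t01; have [e e0 he] := H _ t01; exists e => // s s01 ste; split=> lst.
  apply: step => //; have := he _ s01 ste; rewrite lt_eqF// => /(_ isT).
  rewrite ltr0_norm ?subr_lt0// opprB => h.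
  have := L2leZ (-1) (mw _ _ s01 t01) h; rewrite normrN1 mul1r /L2le.
  rewrite (_ : (fun x => (_ ^+ 2)%:E) =
      fun x => ((u t x - u s x - (t - s) * v x) ^+ 2)%:E)//.
  by apply/funext => x; congr EFin; ring.
apply: step => //; have := he _ s01 ste; rewrite gt_eqF// => /(_ isT).
by rewrite gtr0_norm// subr_gt0.
Qed.

End L2.

Section dqm.
Context d (T : measurableType d) (R : realType) (m : nat).
Variables (Theta : set 'rV[R]_m) (mu : {measure set T -> \bar R}).
Variables (p : 'rV[R]_m -> T -> R) (l : 'rV[R]_m -> T -> 'rV[R]_m).
Hypothesis oTheta : open Theta.
Hypothesis mp : forall th, Theta th -> measurable_fun [set: T] (p th).
Hypothesis ml : forall th, Theta th -> forall i,
  measurable_fun [set: T] (fun x => l th x ord0 i).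

Definition dqm_rem th h x : R := Num.sqrt (p (th + h) x) - Num.sqrt (p th x)
  - 2^-1 * dotv h (l th x) * Num.sqrt (p th x).

Hypothesis dqm : forall th, Theta th ->
  (fun h : 'rV[R]_m => ((sqnorm h)^-1)%:E * \int[mu]_x ((dqm_rem th h x) ^+ 2)%:E)%E
     @ (0 : 'rV[R]_m)^' --> 0%E.
Hypothesis cts : forall th, Theta th ->
  (fun th' : 'rV[R]_m =>
     \int[mu]_x (\sum_(i < m) (l th' x ord0 i * Num.sqrt (p th' x)
                               - l th x ord0 i * Num.sqrt (p th x)) ^+ 2)%:E)%E
    @ th --> 0%E.

Let W (i : 'I_m) th x := l th x ord0 i * Num.sqrt (p th x).

Let msqrt th : Theta th -> measurable_fun [set: T] (fun x => Num.sqrt (p th x)).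
Proof.
move=> /mp mpth; apply: measurableT_comp => //.
by apply: continuous_measurable_fun; exact: sqrt_continuous.
Qed.

Let mW i th : Theta th -> measurable_fun [set: T] (W i th).
Proof. by move=> Tth; apply: measurable_funM; [exact: ml|exact: msqrt]. Qed.

Let mdotl h th : Theta th -> measurable_fun [set: T] (fun x => dotv h (l th x)).
Proof. by move=> Tth; apply: measurable_dotv; exact: ml. Qed.

Lemma coord_le_norm (u : 'rV[R]_m) i : `|u ord0 i| <= `|u|.
Proof.
by rewrite [leRHS]mx_normrE (le_bigmax _ (fun ij : 'I_1 * 'I_m => `|u ij.1 ij.2|) (ord0, i)).
Qed.

Lemma sqnorm_le (u : 'rV[R]_m) : sqnorm u <= m%:R * `|u| ^+ 2.
Proof.
rewrite -[m in m%:R]card_ord -sumr_const mulr_suml; apply: ler_sum => i _.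
by rewrite mul1r -[leLHS]real_normK ?num_real// lerXn2r ?nnegrE// coord_le_norm.
Qed.

Lemma sqnorm_gt0 (u : 'rV[R]_m) : u != 0 -> 0 < sqnorm u.
Proof.
apply: contraNT; rewrite -leNgt => u0; apply/eqP/rowP => i; rewrite mxE.
apply/eqP; rewrite -sqrf_eq0 eq_le sqr_ge0 andbT (le_trans _ u0)//.
by rewrite /sqnorm (bigD1 i)//= lerDl sumr_ge0// => j _; exact: sqr_ge0.
Qed.

Let dqm_rem0 th : dqm_rem th 0 = fun=> 0.
Proof. by apply/funext => x; rewrite /dqm_rem addr0 dot0v subrr mulr0 mul0r subr0. Qed.

Let dqm_local th e : Theta th -> 0 < e -> exists2 r, 0 < r &
  forall h : 'rV[R]_m, `|h| < r -> L2le mu (dqm_rem th h) (e * `|h|).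
Proof.
(* The limit is in terms of [sqnorm], at most m times the square of the maximum norm; m + 1 avoids
   dividing by zero. *)
move=> Tth e0; pose k := e ^+ 2 / m.+1%:R.
have k0 : 0 < k by rewrite divr_gt0 ?exprn_gt0// ltr0n.
have : nbhs (0%E : \bar R) [set y | (y < k%:E)%E].
  by apply: open_nbhs_nbhs; split => /=; [exact: open_ereal_lt_ereal|rewrite lte_fin].
move=> /(dqm Tth); rewrite /= => /nbhs_ballP[r /= r0 hr].
exists r => // h hltr; have [->|h0] := eqVneq h 0.
  rewrite dqm_rem0 /L2le; under eq_integral do rewrite expr0n.
  by rewrite integral0 lee_fin sqr_ge0.
have : ball 0 r h by rewrite -ball_normE /= sub0r normrN.
move=> /hr/(_ h0)/= /ltW hk.
have sh0 := sqnorm_gt0 h0.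
rewrite /L2le; move: hk; rewrite lee_pdivrMl// => /le_trans; apply.
rewrite -EFinM lee_fin exprMn /k mulrC -mulrA ler_pM2l ?exprn_gt0//.
rewrite ler_pdivrMl ?ltr0n// (le_trans (sqnorm_le h))// ler_wpM2r ?sqr_ge0//.
by rewrite ler_nat.
Qed.

Let score_local th e : Theta th -> 0 < e -> exists2 r, 0 < r &
  forall th' : 'rV[R]_m, `|th' - th| < r ->
    Theta th' /\ forall i, L2le mu (fun x => W i th' x - W i th x) e.
Proof.
move=> Tth e0.
have : nbhs (0%E : \bar R) [set y | (y < (e ^+ 2)%:E)%E].
  apply: open_nbhs_nbhs; split => /=; [exact: open_ereal_lt_ereal|].
  by rewrite lte_fin exprn_gt0.
move=> /(cts Tth); rewrite /= => /nbhs_ballP[r1 /= r10 hr1].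
have /nbhs_ballP[r2 /= r20 hr2] := open_nbhs_nbhs (conj oTheta Tth).
exists (Num.min r1 r2) => [|th']; first by rewrite lt_min r10.
rewrite lt_min => /andP[/= lt1 lt2].
have Tth' : Theta th' by apply: hr2; rewrite -ball_normE /= distrC.
split=> // i.
have : ball th r1 th' by rewrite -ball_normE /= distrC.
move=> /hr1/= /ltW; apply: le_trans; apply: ge0_le_integral => //.
- by move=> x _; rewrite lee_fin sqr_ge0.
- apply/measurable_EFinP; apply: measurable_funX; apply: measurable_funB; exact: mW.
- apply/measurable_EFinP; apply: measurable_sum => j.
  by apply: measurable_funX; apply: measurable_funB; exact: mW.
move=> x _; rewrite lee_fin (bigD1 i)//= lerDl sumr_ge0// => j _.
exact: sqr_ge0.
Qed.

(** On the segment from th to th + h, sqrt p has at each point the L^2 derivative given by the score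
    there, and continuity at th0 keeps it close to the one at th. The mean value inequality turns
    this into a remainder uniform for th near th0. *)
Lemma dqm_uniform th0 e : Theta th0 -> 0 < e -> exists2 r, 0 < r &
  forall th h : 'rV[R]_m, `|th - th0| < r -> `|h| < r ->
    [/\ Theta th, Theta (th + h) & L2le mu (dqm_rem th h) (e * `|h|)].
Proof.
move=> T0 e0; pose e2 := e / 4 / m.+1%:R.
have e20 : 0 < e2 by rewrite !divr_gt0// ltr0n.
have [r0 r00 hr0] := score_local T0 e20.
(* Half the radius for th and half for h, so the whole segment stays within r0 of th0. *)
exists (r0 / 2); first by rewrite divr_gt0.
move=> th h thr hr.
have near_seg t : 0 <= t <= 1 -> `|th + t *: h - th0| < r0.
  move=> /andP[t0 t1]; rewrite addrAC [r0]splitr (le_lt_trans (ler_normD _ _))//.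
  rewrite ltrD// (le_lt_trans _ hr)// normrZ ger0_norm// ler_piMl//.
have Tseg t : 0 <= t <= 1 -> Theta (th + t *: h) by move=> /near_seg/hr0[].
have Tth : Theta th by have := Tseg 0; rewrite scale0r addr0; apply; rewrite lexx ler01.
have Tth' : Theta (th + h) by have := Tseg 1; rewrite scale1r; apply; rewrite lexx ler01.
split=> //; have [->|h0] := eqVneq h 0.
  rewrite dqm_rem0 /L2le; under eq_integral do rewrite expr0n.
  by rewrite integral0 lee_fin sqr_ge0.
have nh0 : 0 < `|h| by rewrite normr_gt0.
pose u t x := Num.sqrt (p (th + t *: h) x).
pose v x := 2^-1 * dotv h (l th x) * Num.sqrt (p th x).
have mv : measurable_fun [set: T] v.
  by apply: measurable_funM; [apply: measurable_funM => //; exact: mdotl|exact: msqrt].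
have mu_ t : 0 <= t <= 1 -> measurable_fun [set: T] (u t).
  by move=> /Tseg/msqrt.
have : L2le mu (fun x => u 1 x - u 0 x - v x) (2 * (e / 2 * `|h|)).
  apply: L2_mean_value => //; first by rewrite !mulr_gt0// invr_gt0.
  move=> t t01; have e40 : 0 < e / 4 by rewrite divr_gt0.
  have [r1 r10 hr1] := dqm_local (Tseg _ t01) e40.
  exists (r1 / `|h|); first by rewrite divr_gt0.
  move=> s s01 str sNt.
  have nst : 0 < `|s - t| by rewrite normr_gt0 subr_eq0.
  have hst : `|(s - t) *: h| < r1 by rewrite normrZ -ltr_pdivlMr.
  have ths : th + t *: h + (s - t) *: h = th + s *: h.
    by rewrite -addrA -scalerDl [t + _]addrC subrK.
  have := hr1 _ hst; set f1 := dqm_rem _ _ => L1.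
  pose g x := \sum_i (2^-1 * h ord0 i) * (W i (th + t *: h) x - W i th x).
  have L2 : L2le mu g (e / 4 * `|h|).
    have -> : e / 4 * `|h| = (size (index_enum 'I_m)).+1%:R * (`|h| * e2).
      rewrite /index_enum /= -enumT size_enum_ord /e2.
      by rewrite mulrCA [m.+1%:R * _]mulrC mulfVK ?pnatr_eq0// mulrC.
    apply: L2le_sum => [|i|i]; first by rewrite mulr_gt0.
      by apply: measurable_funM => //; apply: measurable_funB; apply: mW => //; exact: Tseg.
    (* Both points are compared with th0; the resulting 2 e2 is compensated by the factor 1/2 of the
       score. *)
    have La : L2le mu (fun x => W i (th + t *: h) x - W i th x) (e2 + `|(-1 : R)| * e2).
      rewrite (_ : (fun x => _) = (fun x => (W i (th + t *: h) x - W i th0 x) +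
        (-1) * (W i th x - W i th0 x))); last by apply/funext => x; ring.
      have mWB th' : Theta th' -> measurable_fun [set: T] (fun x => W i th' x - W i th0 x).
        by move=> ?; apply: measurable_funB; exact: mW.
      apply: L2leD => //.
      - exact: mWB (Tseg _ t01).
      - by apply: measurable_funM => //; exact: mWB.
      - by rewrite normrN1 mul1r.
      - by have [_] := hr0 _ (near_seg _ t01); apply.
      - apply: L2leZ; first exact: mWB.
        have : 0 <= (0 : R) <= 1 by rewrite lexx ler01.
        by move=> /near_seg; rewrite scale0r addr0 => /hr0[_]; apply.
    apply: L2leW (L2leZ (2^-1 * h ord0 i) _ La).
    - by rewrite normrN1 mul1r mulr_ge0// addr_ge0 ?(ltW e20).
    - rewrite normrN1 mul1r -mulr2n -[e2 *+ 2]mulr_natl normrM gtr0_norm ?invr_gt0//.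
      rewrite mulrACA mulVf// mul1r [leLHS]mulrC.
      by rewrite [leRHS]mulrC ler_wpM2l ?(ltW e20)// coord_le_norm.
    - by apply: measurable_funB; apply: mW => //; exact: Tseg.
  have -> : (fun x => u s x - u t x - (s - t) * v x) = (fun x => f1 x + (s - t) * g x).
    apply/funext => x; rewrite /f1 /dqm_rem ths /u /v /g.
    have -> : \sum_i 2^-1 * h ord0 i * (W i (th + t *: h) x - W i th x) =
       2^-1 * dotv h (l (th + t *: h) x) * Num.sqrt (p (th + t *: h) x) -
       2^-1 * dotv h (l th x) * Num.sqrt (p th x).
      rewrite /dotv !mulr_sumr !mulr_suml -sumrB; apply: eq_bigr => i _.
      by rewrite /W; ring.
    have -> : dotv ((s - t) *: h) (l (th + t *: h) x) = (s - t) * dotv h (l (th + t *: h) x).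
      by rewrite /dotv mulr_sumr; apply: eq_bigr => i _; rewrite mxE mulrA.
    by ring.
  have -> : e / 2 * `|h| * `|s - t| = e / 4 * `|(s - t) *: h| + `|s - t| * (e / 4 * `|h|).
    by rewrite normrZ; field.
  have mg : measurable_fun [set: T] g.
    apply: measurable_sum => i; apply: measurable_funM => //.
    by apply: measurable_funB; apply: mW => //; exact: Tseg.
  apply: L2leD => //.
  - apply: measurable_funB; last first.
      by apply: measurable_funM; [apply: measurable_funM => //; apply: mdotl; exact: Tseg|
        apply: msqrt; exact: Tseg].
    by rewrite ths; apply: measurable_funB; apply: msqrt; exact: Tseg.
  - exact: measurable_funM.
  - by rewrite !mulr_gt0// ?invr_gt0// normrZ mulr_gt0.
  - by rewrite !mulr_gt0// invr_gt0.
  - exact: L2leZ.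
rewrite (_ : 2 * (e / 2 * `|h|) = e * `|h|); last by field.
rewrite (_ : (fun x => _) = dqm_rem th h)//.
by apply/funext => x; rewrite /u /v scale1r scale0r addr0.
Qed.

End dqm.

(** * Likelihood ratios as subdensities *)

Section likelihood_ratio.
Context d (T : measurableType d) (R : realType) (m : nat).
Variables (mu : {measure set T -> \bar R}) (P P' : probability T R).
Variables (p p' : T -> R) (l : T -> 'rV[R]_m) (h : 'rV[R]_m) (n : nat).
Hypotheses (mp : measurable_fun [set: T] p) (p0 : forall x, 0 <= p x).
Hypotheses (mp' : measurable_fun [set: T] p') (p'0 : forall x, 0 <= p' x).
Hypothesis Pp : forall A, measurable A -> P A = (\int[mu]_(x in A) (p x)%:E)%E.
Hypothesis Pp' : forall A, measurable A -> P' A = (\int[mu]_(x in A) (p' x)%:E)%E.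
Hypothesis ml : forall i, measurable_fun [set: T] (fun x => l x ord0 i).

(** Division by zero yields 0, so [q] ignores the part of P' living where p vanishes. *)
Let q x := p' x / p x.
Let k := rate R n *: h.
Let rem x := Num.sqrt (p' x) - Num.sqrt (p x) - 2^-1 * dotv k (l x) * Num.sqrt (p x).
Let rho x := Num.sqrt (q x) - 1 - 2^-1 * (rate R n * dotv h (l x)).

Let q0 x : 0 <= q x. Proof. by rewrite divr_ge0. Qed.

Let mq : measurable_fun [set: T] q.
Proof.
apply: measurable_funM => //.
rewrite (_ : (fun x => _) = (fun x => p x `^ (-1))); last first.
  by apply/funext => x; rewrite powR_inv1.
exact: (measurableT_comp (measurable_powR (-1)) mp).
Qed.

Let msqrt (f : T -> R) : measurable_fun [set: T] f ->
  measurable_fun [set: T] (fun x => Num.sqrt (f x)).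
Proof.
move=> mf; apply: measurableT_comp => //.
by apply: continuous_measurable_fun; exact: sqrt_continuous.
Qed.

Let mrem : measurable_fun [set: T] rem.
Proof.
apply: measurable_funB; first by apply: measurable_funB; exact: msqrt.
apply: measurable_funM; last exact: msqrt.
by apply: measurable_funM => //; exact: measurable_dotv.
Qed.

Let mrho : measurable_fun [set: T] rho.
Proof.
apply: measurable_funB; first by apply: measurable_funB => //; exact: msqrt.
by apply: measurable_funM => //; apply: measurable_funM => //; exact: measurable_dotv.
Qed.

Let qp x : q x * p x <= p' x.
Proof.
have [e|pN0] := eqVneq (p x) 0; first by rewrite e mulr0.
by rewrite /q divfK.
Qed.

Let rho_rem x : rho x ^+ 2 * p x <= rem x ^+ 2.
Proof.
have [e|pN0] := eqVneq (p x) 0; first by rewrite e mulr0 sqr_ge0.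
rewrite -[p x in leLHS]sqr_sqrtr// -exprMn le_eqVlt; apply/orP; left; apply/eqP.
have pK : Num.sqrt (q x) * Num.sqrt (p x) = Num.sqrt (p' x).
  by rewrite -sqrtrM// /q divfK.
congr (_ ^+ 2); rewrite /rem -pK /rho /k.
have -> : dotv (rate R n *: h) (l x) = rate R n * dotv h (l x).
  by rewrite /dotv mulr_sumr; apply: eq_bigr => i _; rewrite mxE mulrA.
by ring.
Qed.

(** Where p = 0 the remainder is sqrt p', so the mass of P' missed by [q] is bounded by the integral
    of the squared remainder. *)
Let rem_defect x : p' x <= q x * p x + rem x ^+ 2.
Proof.
have [e|pN0] := eqVneq (p x) 0.
  by rewrite /rem e sqrtr0 mulr0 add0r subr0 mulr0 subr0 sqr_sqrtr.
by rewrite /q divfK// lerDl sqr_ge0.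
Qed.

Lemma likelihood_ratio_local_density a dl : L2le mu rem a -> a ^+ 2 = dl / n%:R ->
  local_density P P' l h n dl q.
Proof.
move=> La adl.
have qA A : measurable A -> (\int[P]_(x in A) (q x)%:E <= P' A)%E.
  move=> mA; rewrite Pp' // [leLHS]integral_mkcond [leRHS]integral_mkcond.
  have mqA : measurable_fun [set: T] ((fun x => (q x)%:E) \_ A).
    by apply: (measurable_restrictT _ mA).1; apply: measurable_funTS; exact/measurable_EFinP.
  rewrite (@integral_density _ T R mu P p)//; last first.
    by move=> x; rewrite patchE; case: ifP => // _; rewrite lee_fin.
  apply: ge0_le_integral => //.
  - move=> x _; rewrite patchE; case: ifP => // _; last by rewrite mul0e.
    by rewrite mule_ge0 ?lee_fin.
  - by apply: emeasurable_funM => //; exact/measurable_EFinP.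
  - by apply: (measurable_restrictT _ mA).1; apply: measurable_funTS; exact/measurable_EFinP.
  - move=> x _; rewrite !patchE; case: ifP => // _; last by rewrite mul0e.
    by rewrite -EFinM lee_fin.
have qle1 : (\int[P]_x (q x)%:E <= 1%:E)%E.
  by rewrite (le_trans (qA _ measurableT))// (probability_setT P').
have rhoa : (\int[P]_x ((rho x) ^+ 2)%:E <= (a ^+ 2)%:E)%E.
  apply: le_trans La.
  rewrite (@integral_density _ T R mu P p)//; first 1 last.
  - by apply/measurable_EFinP; exact: measurable_funX.
  - by move=> x; rewrite lee_fin sqr_ge0.
  apply: ge0_le_integral => //.
  - by move=> x _; rewrite -EFinM lee_fin mulr_ge0 ?sqr_ge0.
  - by apply/measurable_EFinP; apply: measurable_funM => //; exact: measurable_funX.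
  - by apply/measurable_EFinP; exact: measurable_funX.
  - by move=> x _; rewrite -EFinM lee_fin.
have iq := integrable_le_cst mq q0 qle1.
have mrho2 : measurable_fun [set: T] (fun x => rho x ^+ 2) by exact: measurable_funX.
have irho := integrable_le_cst mrho2 (fun x => sqr_ge0 (rho x)) rhoa.
split=> //; last first.
  by split=> //; rewrite -adl; apply: Rintegral_le_cst => // x; exact: sqr_ge0.
rewrite -adl lerBlDr -lee_fin EFinD EFin_Rintegral//.
apply: (@le_trans _ _ (\int[mu]_x ((q x)%:E * (p x)%:E + ((rem x) ^+ 2)%:E))%E).
  rewrite -(probability_setT P') Pp'//; apply: ge0_le_integral => //.
  - by move=> x _; rewrite lee_fin.
  - exact/measurable_EFinP.
  - apply: emeasurable_funD; first by apply: emeasurable_funM; exact/measurable_EFinP.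
    by apply/measurable_EFinP; exact: measurable_funX.
  - by move=> x _; rewrite -EFinM -EFinD lee_fin.
rewrite ge0_integralD//; first 1 last.
- by move=> x _; rewrite -EFinM lee_fin mulr_ge0.
- by apply: emeasurable_funM; exact/measurable_EFinP.
- by move=> x _; rewrite lee_fin sqr_ge0.
- by apply/measurable_EFinP; exact: measurable_funX.
by rewrite (@integral_density _ T R mu P p)// ?leeD//; [exact/measurable_EFinP].
Qed.

End likelihood_ratio.

(** * Centering and exponential moments of the score *)

Section score.
Context d (T : measurableType d) (R : realType) (m : nat).
Variables (P : probability T R) (l : T -> 'rV[R]_m).
Hypothesis ml : forall i, measurable_fun [set: T] (fun x => l x ord0 i).

Let mdotl h : measurable_fun [set: T] (fun x => dotv h (l x)).
Proof. exact: measurable_dotv. Qed.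

(** With rho the remainder, q - 1 - r h.l = 2 rho + (r h.l / 2 + rho)^2, while the integral of q - 1
    lies between - (s r)^2 and 0. Bounding the integral of the right-hand side and dividing by r
    leaves 2 s and terms of order r. *)
Lemma normr_expectation_score_le (P' : probability T R) h n s q :
  (0 < n)%N -> 0 < s ->
  P.-integrable [set: T] (EFin \o (fun x => dotv h (l x))) ->
  P.-integrable [set: T] (EFin \o (fun x => dotv h (l x) ^+ 2)) ->
  local_density P P' l h n (s ^+ 2) q ->
  `|\int[P]_x dotv h (l x)| <=
    2 * s + rate R n * (2^-1 * \int[P]_x (dotv h (l x) ^+ 2) + 3 * s ^+ 2).
Proof.
move=> n0 s0 i1 i2 [mq q0 qP' q1 [irho rho_le]].
set r := rate R n in irho rho_le *; set E := \int[P]_x dotv h (l x).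
set V := \int[P]_x (dotv h (l x) ^+ 2).
have r0 : 0 < r by rewrite invr_gt0 sqrtr_gt0 ltr0n.
have r2 : r ^+ 2 = n%:R^-1 by exact: rate_sqr.
pose rho x := Num.sqrt (q x) - 1 - 2^-1 * (r * dotv h (l x)).
rewrite -r2 -exprMn in q1 rho_le.
have qle1 : (\int[P]_x (q x)%:E <= 1%:E)%E.
  by rewrite (le_trans (qP' _ measurableT))// (probability_setT P').
have iq := integrable_le_cst mq q0 qle1.
have q2 := Rintegral_le_cst mq q0 qle1.
have ks0 : 0 < s * r by rewrite mulr_gt0.
pose f x := q x - 1 - r * dotv h (l x).
pose g x := s * r + ((s * r)^-1 + 2) * rho x ^+ 2 + 2^-1 * r ^+ 2 * dotv h (l x) ^+ 2.
have mf : measurable_fun [set: T] f.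
  by apply: measurable_funB; [exact: measurable_funB|exact: measurable_funM].
have iZ c (F : T -> R) : P.-integrable [set: T] (EFin \o F) ->
    P.-integrable [set: T] (EFin \o (fun x => c * F x)).
  move=> iF; have := integrableZl measurableT c iF.
  by apply: eq_integrable => // x _ /=; rewrite EFinM.
have iD (F G : T -> R) : P.-integrable [set: T] (EFin \o F) ->
    P.-integrable [set: T] (EFin \o G) ->
    P.-integrable [set: T] (EFin \o (fun x => F x + G x)).
  move=> iF iG; have := integrableD measurableT iF iG.
  by apply: eq_integrable => // x _ /=; rewrite EFinD.
have ir := iZ ((s * r)^-1 + 2) _ irho.
have iv := iZ (2^-1 * r ^+ 2) _ i2.
have isr := iD _ _ (integrable_cst P (s * r)) ir.
have ig : P.-integrable [set: T] (EFin \o g) by exact: (iD _ _ isr iv).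
have fg x : `|f x| <= g x.
  have fE : f x = 2 * rho x + (2^-1 * r * dotv h (l x) + rho x) ^+ 2.
    rewrite /f -[q x in LHS](sqr_sqrtr (q0 x)).
    have -> : Num.sqrt (q x) = rho x + 1 + 2^-1 * (r * dotv h (l x)) by rewrite /rho; ring.
    by field.
  rewrite fE (le_trans (ler_normD _ _))//.
  (* Weight s r because the integral of rho^2 is at most (s r)^2: both terms then contribute s r. *)
  have h1 : `|2 * rho x| <= s * r + (s * r)^-1 * rho x ^+ 2.
    rewrite normrM (@ger0_norm _ 2)//.
    have := sqr_ge0 (s * r - `|rho x|); rewrite sqrrB real_normK ?num_real// => h1.
    rewrite -subr_ge0 (_ : _ - _ = (s * r)^-1 * ((s * r) ^+ 2 - s * r * `|rho x| *+ 2 + rho x ^+ 2)).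
      by rewrite mulr_ge0// invr_ge0 ltW.
    by field; rewrite !gt_eqF.
  have h2 : `|(2^-1 * r * dotv h (l x) + rho x) ^+ 2| <=
      2 * rho x ^+ 2 + 2^-1 * r ^+ 2 * dotv h (l x) ^+ 2.
    rewrite ger0_norm ?sqr_ge0// -subr_ge0.
    rewrite (_ : _ - _ = (2^-1 * r * dotv h (l x) - rho x) ^+ 2) ?sqr_ge0//.
    by field.
  by rewrite (le_trans (lerD h1 h2))// /g le_eqVlt; apply/orP; left; apply/eqP; ring.
have := le_normr_expectation mf fg ig.
have -> : \int[P]_x f x = \int[P]_x q x - 1 - r * E.
  have iq1 : P.-integrable [set: T] (EFin \o (fun x => q x - 1)).
    by apply: (iD _ (fun=> -1)) => //; exact: integrable_cst.
  have il := iZ r _ i1.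
  rewrite (RintegralB measurableT iq1 il) (RintegralB measurableT iq (integrable_cst P 1)).
  by rewrite expectation_cst RintegralZl.
have -> : \int[P]_x g x = s * r + ((s * r)^-1 + 2) * \int[P]_x (rho x ^+ 2)
    + 2^-1 * r ^+ 2 * V.
  rewrite (RintegralD measurableT isr iv) (RintegralD measurableT (integrable_cst P _) ir).
  by rewrite expectation_cst !RintegralZl.
set Q := \int[P]_x q x in q1 q2 *; set Z := \int[P]_x (rho x ^+ 2).
have {}rho_le : Z <= (s * r) ^+ 2 by [].
have Zle : ((s * r)^-1 + 2) * Z <= s * r + 2 * (s * r) ^+ 2.
  have -> : s * r + 2 * (s * r) ^+ 2 = ((s * r)^-1 + 2) * (s * r) ^+ 2.
    by field; rewrite !gt_eqF.
  by rewrite ler_wpM2l// addr_ge0// invr_ge0 ltW.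
rewrite ler_norml => /andP[g1 g2].
rewrite -(ler_pM2l r0) -[r * `|E|](_ : `|r * E| = _); last by rewrite normrM gtr0_norm.
rewrite ler_norml.
have -> : r * (2 * s + r * (2^-1 * V + 3 * s ^+ 2)) =
  2 * (s * r) + 2^-1 * r ^+ 2 * V + 3 * (s * r) ^+ 2 by field.
by apply/andP; split; lra.
Qed.

Lemma expectation_score_eq0 h :
  P.-integrable [set: T] (EFin \o (fun x => dotv h (l x))) ->
  P.-integrable [set: T] (EFin \o (fun x => dotv h (l x) ^+ 2)) ->
  (forall s, 0 < s -> \forall n \near \oo, exists (P' : probability T R) q,
    local_density P P' l h n (s ^+ 2) q) ->
  \int[P]_x dotv h (l x) = 0.
Proof.
move=> i1 i2 H; set E := \int[P]_x _.
apply/eqP; rewrite -normr_le0; apply/ler_addgt0Pl => e e0; rewrite addr0.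
set V := \int[P]_x (dotv h (l x) ^+ 2).
have V0 : 0 <= V by apply: Rintegral_ge0 => x _; exact: sqr_ge0.
(* The bound has the part 2 s, and n is taken large enough for the rest to be at most s. *)
pose s := e / 3; have s0 : 0 < s by rewrite divr_gt0.
pose C := 2^-1 * V + 3 * s ^+ 2.
have C0 : 0 < C by rewrite ltr_wpDl ?mulr_ge0// mulr_gt0// exprn_gt0.
near \oo => n.
have [P' [q lq]] : exists (P' : probability T R) q, local_density P P' l h n (s ^+ 2) q.
  by near: n; exact: H.
have n0 : (0 < n)%N by near: n; exists 1%N.
have rs : rate R n <= s / C.
  near: n; have /cvgrPdist_le/(_ (s / C)) := @rate_cvg0 R.
  rewrite divr_gt0// => /(_ isT); apply: filterS => n.
  by rewrite sub0r normrN ger0_norm// rate_ge0.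
rewrite (le_trans (normr_expectation_score_le n0 s0 i1 i2 lq))// -/V -/C.
have : rate R n * C <= s by rewrite -ler_pdivlMr.
by rewrite /s; lra.
Unshelve. all: by end_near. Qed.

(** B times the l1 norm is the largest linear form with coefficients B or -B; its exponential is
    bounded by the sum over all sign choices. *)
Lemma integral_exp_l1norm_le (M : 'rV[R]_m -> R) B :
  (forall h, (\int[P]_x (expR (dotv h (l x)))%:E <= (M h)%:E)%E) -> 0 <= B ->
  (\int[P]_x (expR (B * l1norm (l x)))%:E <=
    (\sum_(f : {ffun 'I_m -> bool}) M (\row_i (B * (-1) ^+ f i)))%:E)%E.
Proof.
move=> lM B0; pose c (f : {ffun 'I_m -> bool}) : 'rV[R]_m := \row_i (B * (-1) ^+ f i).
apply: (@le_trans _ _ (\int[P]_x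
    (\sum_(f : {ffun 'I_m -> bool}) (expR (dotv (c f) (l x)))%:E))%E).
  apply: ge0_le_integral => //.
  - apply/measurable_EFinP; apply: measurableT_comp => //.
    by apply: measurable_funM => //; exact: measurable_l1norm.
  - apply: emeasurable_sum => f; apply/measurable_EFinP.
    by apply: measurableT_comp => //; exact: mdotl.
  move=> x _; rewrite sumEFin lee_fin (bigD1 [ffun i => l x ord0 i < 0])//=.
  rewrite -[leLHS]addr0 lerD//; last by rewrite sumr_ge0// => f _; exact: expR_ge0.
  rewrite ler_expR le_eqVlt; apply/orP; left; apply/eqP.
  rewrite /l1norm /dotv mulr_sumr; apply: eq_bigr => i _.
  by rewrite /c mxE ffunE -mulrA -normrEsign.
rewrite ge0_integral_sum//.
- by rewrite -sumEFin; apply: lee_sum => f _; exact: lM.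
- by move=> f; apply/measurable_EFinP; apply: measurableT_comp => //; exact: mdotl.
Qed.

End score.

(** * Transfer kernels *)

Lemma pushforward_probability d d' (Y : measurableType d) (Z : measurableType d')
    (R : realType) (P : probability Y R) (f : Y -> Z) : measurable_fun [set: Y] f ->
  exists P' : probability Z R, forall A, P' A = P (f @^-1` A).
Proof.
move=> mf.
pose F : {mfun Y >-> Z} := HB.pack f (isMeasurableFun.Build _ _ _ _ f mf).
by exists (distribution P F).
Qed.

Section mixture.
Context d d' (X : measurableType d) (Y : measurableType d') (R : realType).
Variables (K : finType) (k0 : K) (phi : K -> X -> R) (kappa : K -> probability Y R).
Hypotheses (mphi : forall j, measurable_fun [set: X] (phi j))
  (phi0 : forall j x, 0 <= phi j x) (phi1 : forall x, \sum_j phi j x = 1).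

(** [msum] runs over naturals, so [K] is enumerated; [k0] is only the default of [nth]. *)
Definition mixture (x : X) : {measure set Y -> \bar R} :=
  msum (fun i => mscale (NngNum (phi0 (nth k0 (enum K) i) x))
                        (kappa (nth k0 (enum K) i))) #|K|.

Lemma mixtureE x A : mixture x A = (\sum_j (phi j x)%:E * kappa j A)%E.
Proof.
rewrite /mixture /= /msum -[RHS]big_enum/= (big_nth k0) -cardE big_mkord.
by apply: eq_bigr.
Qed.

Let measurable_mixture A : measurable A -> measurable_fun [set: X] (mixture ^~ A).
Proof.
move=> mA; under eq_fun do rewrite mixtureE.
apply: emeasurable_sum => j; apply: emeasurable_funM => //.
exact/measurable_EFinP.
Qed.

HB.instance Definition _ := isKernel.Build _ _ X Y R mixture measurable_mixture.

Let mixture_setT x : mixture x [set: Y] = 1%E.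
Proof.
rewrite mixtureE -(phi1 x) -sumEFin; apply: eq_bigr => j _.
by rewrite (probability_setT (kappa j)) mule1.
Qed.

HB.instance Definition _ := Kernel_isProbability.Build _ _ X Y R mixture mixture_setT.

Lemma mixture_kernel : exists Rk : R.-pker X ~> Y,
  forall x A, Rk x A = (\sum_j (phi j x)%:E * kappa j A)%E.
Proof. by exists mixture => x A; rewrite mixtureE. Qed.

End mixture.

(** The bound on the complement of A is the reverse inequality on A. Since [tv_norm] also subtracts
    the difference on the complement, it doubles the deviation. *)
Lemma tv_norm_le d (X : measurableType d) (R : realType) (P : probability X R)
    (Q : set X -> \bar R) (q : set X -> R) (e : R) :
  (forall A, measurable A -> [/\ Q A = (q A)%:E, q A + q (~` A) = 1 &
    q A <= fine (P A) + e]) ->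
  (tv_norm P Q <= (2 * e)%:E)%E.
Proof.
move=> H; apply: ge_ereal_sup => _ [A mA <-].
have [QA qC _] := H _ mA; have [QC _ qC_le] := H _ (measurableC mA).
rewrite QA QC -[P A]fineK ?fin_num_measure// -[P (~` A)]fineK ?fin_num_measure//; last first.
  exact: measurableC.
have PC : fine (P (~` A)) = 1 - fine (P A).
  by rewrite probability_setC// fineB ?fin_num_measure.
rewrite -!EFinB lee_fin; move: qC qC_le; rewrite PC; lra.
Qed.

(** * Uniformity over compact parameter sets *)

Section experiment.
Context d (T : measurableType d) (R : realType) (m : nat).
Variables (Theta : set 'rV[R]_m) (mu : {measure set T -> \bar R}).
Variables (P : 'rV[R]_m -> probability T R) (p : 'rV[R]_m -> T -> R) (l : 'rV[R]_m -> T -> 'rV[R]_m).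
Hypothesis oTheta : open Theta.
Hypothesis mp : forall th, Theta th -> measurable_fun [set: T] (p th).
Hypothesis p0 : forall th, Theta th -> forall x, 0 <= p th x.
Hypothesis Pp : forall th, Theta th -> forall A, measurable A ->
  P th A = (\int[mu]_(x in A) (p th x)%:E)%E.
Hypothesis ml : forall th, Theta th -> forall i,
  measurable_fun [set: T] (fun x => l th x ord0 i).

Hypothesis dqm : forall th, Theta th ->
  (fun h : 'rV[R]_m => ((sqnorm h)^-1)%:E * \int[mu]_x ((dqm_rem p l th h x) ^+ 2)%:E)%E
     @ (0 : 'rV[R]_m)^' --> 0%E.
Hypothesis cts : forall th, Theta th ->
  (fun th' : 'rV[R]_m =>
     \int[mu]_x (\sum_(i < m) (l th' x ord0 i * Num.sqrt (p th' x)
                               - l th x ord0 i * Num.sqrt (p th x)) ^+ 2)%:E)%E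
    @ th --> 0%E.

Hypothesis expl : forall K : set 'rV[R]_m, compact K -> K `<=` Theta ->
  forall h : 'rV[R]_m, exists C : R, forall th, K th ->
    (\int[P th]_x (expR (dotv h (l th x)))%:E <= C%:E)%E.

(** The near-covering form of compactness merges the local radii of [dqm_uniform] into one
    neighbourhood of h = 0. *)
Lemma dqm_compact K e : compact K -> K `<=` Theta -> 0 < e ->
  \forall h \near (0 : 'rV[R]_m), forall th, K th ->
    Theta (th + h) /\ L2le mu (dqm_rem p l th h) (e * `|h|).
Proof.
move=> cK KT e0; have /compact_near_coveringP nK := cK.
apply: (nK _ (nbhs (0 : 'rV[R]_m)) (fun h th => Theta (th + h) /\
  L2le mu (dqm_rem p l th h) (e * `|h|))) => th Kth.
have [r r0 hr] := dqm_uniform oTheta mp ml dqm cts (KT _ Kth) e0.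
exists (ball th r, ball 0 r); first by split; exact: nbhsx_ballx.
move=> [th' h] /= [].
rewrite -!ball_normE /= distrC sub0r normrN => th'r hr'.
by have [] := hr _ _ th'r hr'.
Qed.

Lemma local_density_compact K (D dl : R) : compact K -> K `<=` Theta -> 0 <= D -> 0 < dl ->
  \forall n \near \oo, forall th h, K th -> `|h| <= D ->
    Theta (th + rate R n *: h) /\
    local_density (P th) (P (th + rate R n *: h)) (l th) h n dl
      (fun x => p (th + rate R n *: h) x / p th x).
Proof.
(* For |h| <= D the remainder at h / sqrt n is then at most sqrt(dl / n); D + 1 avoids dividing by
   zero. *)
move=> cK KT D0 dl0; pose e := Num.sqrt dl / (D + 1).
have D1 : 0 < D + 1 by rewrite ltr_wpDl.
have e0 : 0 < e by rewrite divr_gt0// sqrtr_gt0.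
have /nbhs_ballP[r /= r0 hr] := dqm_compact cK KT e0.
have rD : 0 < r / (D + 1) by rewrite divr_gt0.
near=> n => th h Kth hD.
have n0 : (0 < n)%N by near: n; exists 1%N.
have rn : rate R n < r / (D + 1).
  near: n; have /cvgrPdist_lt/(_ _ rD) := @rate_cvg0 R; apply: filterS => j.
  by rewrite sub0r normrN ger0_norm// rate_ge0.
have rhD : `|rate R n *: h| <= rate R n * (D + 1).
  rewrite normrZ ger0_norm ?rate_ge0// ler_wpM2l ?rate_ge0//.
  by rewrite (le_trans hD)// lerDl.
have : ball 0 r (rate R n *: h).
  rewrite -ball_normE /= sub0r normrN (le_lt_trans rhD)//.
  by rewrite -ltr_pdivlMr.
move=> /hr/(_ _ Kth)[Tth' Lth]; split=> //.
have Tth := KT _ Kth.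
apply: (@likelihood_ratio_local_density _ T R m mu _ _ (p th) _ _ _ _ _ _ _ _ _ _ _
    (Num.sqrt dl * rate R n)) => //; try by [exact: mp | exact: p0 | exact: Pp | exact: ml].
- apply: L2leW Lth; first by rewrite mulr_ge0// ltW.
  rewrite (le_trans (ler_wpM2l (ltW e0) rhD))// /e mulrCA divfK ?gt_eqF//.
  by rewrite mulrC.
- by rewrite exprMn rate_sqr sqr_sqrtr// ltW.
Unshelve. all: by end_near. Qed.

(** [M] sums the exponential bounds chosen on K over sign vectors. Centering is deduced from
    quadratic-mean differentiability along each basis vector, at one parameter at a time. *)
Lemma score_class_compact K : compact K -> K `<=` Theta ->
  exists M : R -> R, forall th, K th -> score_class M (P th) (l th).
Proof.
move=> cK KT; have [C hC] := choice (expl cK KT).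
pose M B := \sum_(f : {ffun 'I_m -> bool}) C (\row_i (B * (-1) ^+ f i)).
exists M => th Kth; have Tth := KT _ Kth.
have lM B : 0 <= B -> (\int[P th]_x (expR (B * l1norm (l th x)))%:E <= (M B)%:E)%E.
  by move=> B0; apply: integral_exp_l1norm_le => //; [exact: ml|move=> h; exact: hC].
split=> // [|i]; first exact: ml.
pose ei : 'rV[R]_m := delta_mx 0 i.
have eiE x : dotv ei (l th x) = l th x ord0 i.
  rewrite /dotv (bigD1 i)//= mxE !eqxx mul1r big1 ?addr0// => j ji.
  by rewrite mxE (negbTE ji) andbF mul0r.
have ei1 x : `|dotv ei (l th x)| <= 1 * l1norm (l th x).
  by rewrite eiE mul1r /l1norm (bigD1 i)//= lerDl sumr_ge0.
have me : measurable_fun [set: T] (fun x => dotv ei (l th x)).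
  by apply: measurable_dotv; exact: ml.
have ma : measurable_fun [set: T] (fun x => 1 * l1norm (l th x)).
  by apply: measurable_funM => //; apply: measurable_l1norm; exact: ml.
have aM : (\int[P th]_x (expR (2 * (1 * l1norm (l th x))))%:E <= (M 2)%:E)%E.
  by under eq_integral do rewrite mul1r; exact: lM.
have i1 := integrable_X me ma ei1 aM.
have i2 := integrable_XX me ma ei1 aM.
rewrite -[LHS](_ : \int[P th]_x dotv ei (l th x) = _); last first.
  by apply: eq_Rintegral => x _.
apply: (@expectation_score_eq0 _ T R m (P th) (l th)) => //; first exact: ml.
move=> s s0; have s20 : 0 < s ^+ 2 by rewrite exprn_gt0.
have sT : [set th] `<=` Theta by move=> _ ->.
have := local_density_compact (@compact_set1 _ th) sT (normr_ge0 ei) s20.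
apply: filterS => n hn; have [_ ld] := hn th ei erefl (lexx _).
by exists (P (th + rate R n *: ei)), (fun x => p (th + rate R n *: ei) x / p th x).
Qed.

End experiment.

Section transfer.
Context d (T : measurableType d) d' (Y : measurableType d') (R : realType) (m : nat).
Variables (z0 : Y).

Let embed n (w : n.-tuple T) : n.-tuple T * Y := (w, z0).

Lemma measurable_embed n : measurable_fun [set: n.-tuple T] (@embed n).
Proof. exact: measurable_fun_pair. Qed.

Lemma exists_product_embedding (P : 'rV[R]_m -> probability T R) :
  exists Pt : forall n : nat, 'rV[R]_m -> probability (n.-tuple T * Y)%type R,
    forall n th A, Pt n th A = iprod (P th) n ((fun w => (w, z0)) @^-1` A).
Proof.
have H (n : nat) : exists Q : 'rV[R]_m -> probability (n.-tuple T * Y)%type R,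
    forall th A, Q th A = iprod (P th) n ((fun w => (w, z0)) @^-1` A).
  have [Q hQ] := choice (fun th => pushforward_probability (iprod (P th) n) (@measurable_embed n)).
  by exists Q => th A; rewrite hQ.
by exists (fun n => projT1 (cid (H n))) => n; exact: projT2 (cid (H n)).
Qed.


(** The Gaussian average of the kernel is the finite mixture with weights E phi_j(J x), so the
    one-sided inequality on Omega^n carries over to the slice at [z0]. *)
Lemma gaussian_transfer (J : 'M[R]_m) (K : finType) (phi : K -> 'rV[R]_m -> R) n
    (kappa : K -> probability (n.-tuple T) R) :
  (forall j, trig (phi j)) -> (forall j z, 0 <= phi j z) ->
  (forall z, \sum_j phi j z = 1) ->
  exists Rk : R.-pker (m.-tuple R) ~> (n.-tuple T * Y)%type,
    (forall x A, (forall w, A (w, z0)) -> Rk x A = 1%E) /\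
    forall (nu : probability (m.-tuple R) R) (P : probability (n.-tuple T) R)
        (Pt : probability (n.-tuple T * Y)%type R) e,
      (forall A, Pt A = P ((fun w => (w, z0)) @^-1` A)) ->
      (forall A, measurable A -> \sum_j (\int[nu]_x phi j (mxact J x)) *
        fine (kappa j A) <= fine (P A) + e) ->
      (tv_norm Pt (fun A => \int[nu]_x Rk x A) <= (2 * e)%:E)%E.
Proof.
move=> tphi phi0 phi1.
(* [K] is inhabited, as an empty sum cannot equal 1. *)
have k0 : K.
  have /card_gt0P/cid[j _] : (0 < #|K|)%N => //.
  rewrite lt0n; apply/eqP => K0; have := phi1 0.
  rewrite big_pred0 => [/esym/eqP|j]; first by rewrite oner_eq0.
  by have := card0_eq K0 j; rewrite inE.
have mphi j : measurable_fun [set: m.-tuple R] (fun x => phi j (mxact J x)).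
  by apply: measurable_trig => // i; exact: measurable_mxact.
have [kappa' hk] := choice (fun j => pushforward_probability (kappa j) (@measurable_embed n)).
have [Rk RkE] := mixture_kernel k0 kappa' mphi (fun j x => phi0 j _) (fun x => phi1 _).
exists Rk; split=> [x A A1|nu P Pt e PtE le_e].
  rewrite RkE -(phi1 (mxact J x)) -sumEFin; apply: eq_bigr => j _.
  rewrite hk (_ : _ @^-1` A = [set: _]) ?(probability_setT (kappa j)) ?mule1//.
  by apply/seteqP; split => // w _; exact: A1.
have iphi j : nu.-integrable [set: m.-tuple R] (EFin \o (fun x => phi j (mxact J x))).
  apply: (integrable_dominated (mphi j) (g := cst 1)); last exact: integrable_cst.
  move=> x; rewrite ger0_norm// -(phi1 (mxact J x)) (bigD1 j)//= lerDl.
  by rewrite sumr_ge0.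
pose c j := \int[nu]_x phi j (mxact J x).
apply: (@tv_norm_le _ _ _ _ _
  (fun A => \sum_j c j * fine (kappa j ((fun w => (w, z0)) @^-1` A)))) => A mA.
have mA' : measurable ((fun w : n.-tuple T => (w, z0)) @^-1` A).
  by rewrite -[X in measurable X]setTI; exact: measurable_embed.
have fk j := fin_num_measure (kappa j) _ mA'.
split.
- under eq_integral do rewrite RkE.
  rewrite ge0_integral_sum//; first 1 last.
  + by move=> j; apply: emeasurable_funM => //; exact/measurable_EFinP.
  + by move=> j x _; rewrite mule_ge0 ?lee_fin.
  rewrite -sumEFin; apply: eq_bigr => j _.
  rewrite ge0_integralZr//; [|exact/measurable_EFinP|by move=> x _; rewrite lee_fin].
  by rewrite hk EFinM /c EFin_Rintegral// (fineK (fk j)).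
- rewrite -big_split /=.
  transitivity (\int[nu]_x \sum_j phi j (mxact J x)); last first.
    by rewrite -[RHS](expectation_cst nu 1); apply: eq_Rintegral => x _; exact: phi1.
  have [_ ->] := Rintegral_sum (index_enum K) measurableT iphi.
  apply: eq_bigr => j _; rewrite -mulrDr preimage_setC probability_setC//.
  by rewrite fineB ?fin_num_measure//= addrC subrK mulr1.
- by rewrite PtE; exact: le_e.
Qed.

End transfer.

(** * Approximation at fixed precision and diagonal choice *)

Section approximation.
Context d (T : measurableType d) d' (Y : measurableType d') (R : realType) (m : nat).
Variables (z0 : Y) (Theta : set 'rV[R]_m) (mu : {measure set T -> \bar R}).
Variables (P : 'rV[R]_m -> probability T R) (p : 'rV[R]_m -> T -> R) (l : 'rV[R]_m -> T -> 'rV[R]_m).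
Variable Pt : forall n : nat, 'rV[R]_m -> probability (n.-tuple T * Y)%type R.
Hypothesis PtE : forall n th A,
  Pt n th A = iprod (P th) n ((fun w => (w, z0)) @^-1` A).
Hypothesis oTheta : open Theta.
Hypothesis mp : forall th, Theta th -> measurable_fun [set: T] (p th).
Hypothesis p0 : forall th, Theta th -> forall x, 0 <= p th x.
Hypothesis Pp : forall th, Theta th -> forall A, measurable A ->
  P th A = (\int[mu]_(x in A) (p th x)%:E)%E.
Hypothesis ml : forall th, Theta th -> forall i,
  measurable_fun [set: T] (fun x => l th x ord0 i).
Hypothesis dqm : forall th, Theta th ->
  (fun h : 'rV[R]_m => ((sqnorm h)^-1)%:E * \int[mu]_x ((dqm_rem p l th h x) ^+ 2)%:E)%E
     @ (0 : 'rV[R]_m)^' --> 0%E.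
Hypothesis cts : forall th, Theta th ->
  (fun th' : 'rV[R]_m =>
     \int[mu]_x (\sum_(i < m) (l th' x ord0 i * Num.sqrt (p th' x)
                               - l th x ord0 i * Num.sqrt (p th x)) ^+ 2)%:E)%E
    @ th --> 0%E.
Hypothesis expl : forall K : set 'rV[R]_m, compact K -> K `<=` Theta ->
  forall h : 'rV[R]_m, exists C : R, forall th, K th ->
    (\int[P th]_x (expR (dotv h (l th x)))%:E <= C%:E)%E.
Hypothesis Junit : forall th, Theta th -> fisher P l th \in unitmx.

(** Here h and nu are quantified after the kernel, which is thereby the same for all of them. *)
Definition approximates n th D eps (Rk : R.-pker (m.-tuple R) ~> (n.-tuple T * Y)%type) :=
  forall (h : 'rV[R]_m) (nu : probability (m.-tuple R) R), `|h| <= D ->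
    is_gaussian nu h (invmx (fisher P l th)) ->
    (tv_norm (Pt n (th + rate R n *: h)) (fun A => \int[nu]_x Rk x A) <= eps%:E)%E.

Definition concentrated n (Rk : R.-pker (m.-tuple R) ~> (n.-tuple T * Y)%type) :=
  forall x A, (forall w, A (w, z0)) -> Rk x A = 1%E.

Lemma approximating_kernel K (D eps : R) :
  compact K -> K `<=` Theta -> 0 <= D -> 0 < eps ->
  \forall n \near \oo, forall th, K th ->
    exists Rk, @concentrated n Rk /\ approximates th D eps Rk.
Proof.
(* Half the precision, because the total variation norm doubles the one-sided error. *)
move=> cK KT D0 e0; have e20 : 0 < eps / 2 by rewrite divr_gt0.
have [M hM] := score_class_compact oTheta mp p0 Pp ml dqm cts expl cK KT.
have [dl [J [phi [dl0 tphi phi0 phi1 near_le]]]] :=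
  @gaussian_mixture_le _ T _ m M _ _ D0 e20.
near=> n => th Kth; have Tth := KT _ Kth.
have Hn : forall (P : probability T R) (l : T -> 'rV[R]_m),
      score_class M P l -> info P l \in unitmx ->
      exists kappa : J -> probability (n.-tuple T) R,
      forall (h : 'rV[R]_m) (nu : probability (m.-tuple R) R)
          (P' : probability T R) (q : T -> R),
        (forall i, `|h ord0 i| <= D) ->
        is_gaussian nu h (invmx (info P l)) ->
        local_density P P' l h n dl q ->
        forall A, measurable A ->
          \sum_j (\int[nu]_x phi j (mxact (info P l) x)) * fine (kappa j A)
          <= fine (iprod P' n A) + eps / 2.
  by near: n.
have ld : forall th h, K th -> `|h| <= D ->
    Theta (th + rate R n *: h) /\
    local_density (P th) (P (th + rate R n *: h)) (l th) h n dl
      (fun x => p (th + rate R n *: h) x / p th x).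
  by near: n; exact: (local_density_compact oTheta mp p0 Pp ml dqm cts).
have [kappa hkappa] := Hn _ _ (hM _ Kth) (Junit Tth).
have [Rk [Rk1 hRk]] := gaussian_transfer z0 (info (P th) (l th)) kappa tphi phi0 phi1.
exists Rk; split=> // h nu hD gnu.
have -> : eps = 2 * (eps / 2) by field.
apply: hRk; first by move=> A; rewrite PtE.
have [_ ldh] := ld _ _ Kth hD.
apply: hkappa gnu ldh => i; exact: le_trans (coord_le_norm _ _) hD.
Unshelve. all: by end_near. Qed.

(* For each n and theta, take the kernel with the best precision j among the
   j <= n that can be achieved; uniformity on compacts makes j tend to infinity. *)
Lemma diagonal_kernel : exists Rk : forall n : nat, 'rV[R]_m ->
    R.-pker (m.-tuple R) ~> (n.-tuple T * Y)%type,
  (forall n th, concentrated (Rk n th)) /\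
  forall K k, compact K -> K `<=` Theta ->
    \forall n \near \oo, forall th, K th -> exists2 j, (k <= j)%N &
      approximates th j%:R (j.+1%:R^-1) (Rk n th).
Proof.
(* Level 0 asks for no precision, so for every n and theta some kernel is admissible. *)
pose good n th k (Q : R.-pker (m.-tuple R) ~> (n.-tuple T * Y)%type) :=
  concentrated Q /\ ((0 < k)%N -> approximates th k%:R (k.+1%:R^-1) Q).
have good0 n th : exists Q, @good n th 0 Q.
  have t1 (j : unit) : trig (fun _ : 'rV[R]_m => 1) by exact: trig_cst.
  have s1 (z : 'rV[R]_m) : \sum_(j : unit) (1 : R) = 1 by rewrite big_const card_unit /= addr0.
  have [Q [Q1 _]] := gaussian_transfer z0 0 (fun=> iprod (P th) n) t1 (fun _ _ => ler01) s1.
  by exists Q; split.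
have best n th N : exists Q, concentrated Q /\ forall k, (k <= N)%N ->
    (exists Q', @good n th k Q') -> exists2 j, (k <= j)%N & good n th j Q.
  elim: N => [|N [Q [Q1 hQ]]].
    have [Q gQ] := good0 n th; exists Q; split; first by case: gQ.
    by move=> k; rewrite leqn0 => /eqP-> _; exists 0%N.
  have [[Q' gQ']|nQ] := pselect (exists Q', @good n th N.+1 Q').
    exists Q'; split; first by case: gQ'.
    by move=> k kN _; exists N.+1.
  exists Q; split=> // k; rewrite leq_eqVlt => /predU1P[->//|kN].
  exact: hQ.
exists (fun n th => projT1 (cid (best n th n))); split.
  by move=> n th; have [] := projT2 (cid (best n th n)).
move=> K k cK KT; near=> n => th Kth.
(* Level k + 1 rather than k forces j > 0, without which [good] says nothing about precision. *)
have kn : (k.+1 <= n)%N by near: n; exists k.+1.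
have ker : forall th, K th ->
    exists Rk, @concentrated n Rk /\ approximates th k.+1%:R (k.+2%:R^-1) Rk.
  by near: n; apply: approximating_kernel.
have [_ /(_ _ kn)[]] := projT2 (cid (best n th n)).
  by have [Q [Q1 hQ]] := ker _ Kth; exists Q; split.
move=> j kj [_ hj]; exists j; first exact: ltnW.
by apply: hj; exact: leq_trans kj.
Unshelve. all: by end_near. Qed.

End approximation.

Theorem theorem1
  (R : realType) (m : nat)
  (Theta : set 'rV[R]_m)
  (d : measure_display) (T : measurableType d)
  (mu : {measure set T -> \bar R})
  (P : 'rV[R]_m -> probability T R)
  (p : 'rV[R]_m -> T -> R)
  (l : 'rV[R]_m -> T -> 'rV[R]_m)
  (Theta0 : set 'rV[R]_m) :
  open Theta ->
  polish_borel R T ->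
  (* densities p_theta of P_theta w.r.t. mu *)
  (forall theta, Theta theta ->
     [/\ measurable_fun [set: T] (p theta),
         (forall x, 0 <= p theta x) &
         (forall A, measurable A ->
            P theta A = (\int[mu]_(x in A) (p theta x)%:E)%E)]) ->
  (* measurable score l_theta *)
  (forall theta, Theta theta -> forall i,
     measurable_fun [set: T] (fun x => l theta x ord0 i)) ->
  (* differentiability in quadratic mean *)
  (forall theta, Theta theta ->
     (fun h : 'rV[R]_m => ((sqnorm h)^-1)%:E *
        \int[mu]_x ((Num.sqrt (p (theta + h) x) - Num.sqrt (p theta x)
                     - 2^-1 * dotv h (l theta x) * Num.sqrt (p theta x)) ^+ 2)%:E)%E
       @ (0 : 'rV[R]_m)^' --> 0%E) ->
  (* continuity of theta |-> l_theta (in L^2(mu), as theta |-> l_theta sqrt(p_theta)) *)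
  (forall theta, Theta theta ->
     (fun theta' : 'rV[R]_m =>
        \int[mu]_x (\sum_(i < m) (l theta' x ord0 i * Num.sqrt (p theta' x)
                                  - l theta x ord0 i * Num.sqrt (p theta x)) ^+ 2)%:E)%E
       @ theta --> 0%E) ->
  (* uniform exponential moments on compacts *)
  (forall K : set 'rV[R]_m, compact K -> K `<=` Theta ->
     forall h : 'rV[R]_m, exists C : R, forall theta, K theta ->
       (\int[P theta]_x (expR (dotv h (l theta x)))%:E <= C%:E)%E) ->
  (* nonsingular Fisher information *)
  (forall theta, Theta theta -> fisher P l theta \in unitmx) ->
  countable Theta0 -> Theta0 `<=` Theta ->
  exists (Pt : forall n : nat, 'rV[R]_m ->
             probability (n.-tuple T * (m.-tuple R * R))%type R)
         (Rk : forall n : nat, 'rV[R]_m ->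
             R.-pker (m.-tuple R) ~> (n.-tuple T * (m.-tuple R * R))%type),
    (* Pt n theta lives on Omega^n x (R^m x [0,1]) and has marginal P_theta^n *)
    (forall n, (0 < n)%N -> forall theta, Theta theta ->
       Pt n theta [set z | 0 <= z.2.2 <= 1] = 1%E /\
       marginal_is_product (Pt n theta) (P theta)) /\
    (* R^n_theta is a Markov kernel from R^m to Omega^n x (R^m x [0,1]) *)
    (forall n, (0 < n)%N -> forall theta, Theta theta -> forall x,
       Rk n theta x [set z | 0 <= z.2.2 <= 1] = 1%E) /\
    (* for lambda ~ N(h, J_theta^{-1}) and
       Q^n_{theta,h}(A) = int R^n_theta(A | x) N(h, J_theta^{-1})(dx) *)
    (forall nu : 'rV[R]_m -> 'rV[R]_m -> probability (m.-tuple R) R,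
       (forall theta, Theta theta -> forall h,
          is_gaussian (nu theta h) h (invmx (fisher P l theta))) ->
       forall K K' : set 'rV[R]_m, compact K -> K `<=` Theta -> compact K' ->
       forall eps : R, 0 < eps ->
         \forall n \near \oo, forall h theta, K' h -> K theta -> Theta0 theta ->
           (tv_norm (Pt n (theta + (Num.sqrt n%:R)^-1 *: h)%R)
                    (fun A => \int[nu theta h]_x Rk n theta x A)
             <= eps%:E)%E).

Proof.
move=> oTheta _ dens ml dqm cts expl Junit _ Theta0T.
have mp th : Theta th -> measurable_fun [set: T] (p th) by case/dens.
have p0 th : Theta th -> forall x, 0 <= p th x by case/dens.
have Pp th : Theta th -> forall A, measurable A ->
    P th A = (\int[mu]_(x in A) (p th x)%:E)%E by case/dens.
pose z0 : m.-tuple R * R := (nseq_tuple m 0, 0).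
have [Pt PtE] := exists_product_embedding z0 P.
have [Rk [Rk1 RkP]] :=
  diagonal_kernel PtE oTheta mp p0 Pp ml dqm cts expl Junit.
have z0P n (w : n.-tuple T) : [set z : n.-tuple T * (m.-tuple R * R) | 0 <= z.2.2 <= 1] (w, z0).
  by rewrite /= lexx ler01.
exists Pt, Rk; split; last split.
- move=> n _ th _; split.
    rewrite PtE (_ : _ @^-1` _ = [set: _]) ?(probability_setT (iprod (P th) n))//.
    by apply/seteqP; split => // w _; exact: z0P.
  by move=> A mA; rewrite PtE -iprod_rectangle.
- by move=> n _ th _ x; apply: Rk1 => w; exact: z0P.
move=> nu gnu K K' cK KT cK' eps e0.
have [D [Dreal hD]] := compact_bounded cK'.
(* For j >= k, level j covers every h in K' and has precision 1 / (j + 1) <= eps. The bound is D + 1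
   since boundedness gives the estimate for reals strictly above D. *)
pose k := maxn (Num.truncn (D + 1)).+1 (Num.truncn eps^-1).+1.
have := RkP K k cK KT; apply: filterS => n hn h th K'h Kth Th.
have [j kj app] := hn _ Kth.
have jD : `|h| <= j%:R.
  rewrite (le_trans (hD (D + 1) _ _ K'h))//; first by rewrite ltrDl.
  rewrite (le_trans (ltW (truncnS_gt _)))// ler_nat (leq_trans _ kj)//.
  exact: leq_maxl.
apply: le_trans (app _ _ jD (gnu _ (KT _ Kth) h)) _.
rewrite lee_fin -[leRHS]invrK lef_pV2 ?posrE ?invr_gt0// ?ltr0n//.
rewrite (le_trans (ltW (truncnS_gt _)))// ler_nat (leq_trans _ (leqW kj))//.
exact: leq_maxr.
Qed.
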